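(* Let $f(z)=\sum_{n\ge1}a(n)e^{2\pi i n z}$ be a normalized Hecke eigenform of weight $2$ for $\Gamma_0(N)$ with rational integer Fourier coefficients and with complex multiplication. There is a constant $\mu_f>0$ such that $$\prod_{\substack{5\le p<z\\ a(p)\ne 0}}\left(1-\frac1p\right)=\frac{\mu_f}{(\log z)^{1/2}}+O_f\!\left(\frac{1}{(\log z)^{3/2}}\right),$$ where the product is over primes $p$.
   Context: Normalized means $a(1)=1$. $f$ has complex multiplication if there is an imaginary quadratic field $K$ and a Hecke character $\Psi$ of $K$ with conductor $\mathfrak m$ such that $f(z)=\sum_{(\mathfrak a,\mathfrak m)=1}\Psi(\mathfrak a)e^{2\pi i N(\mathfrak a)z}$, the sum being over integral ideals $\mathfrak a$ of the ring of integers of $K$ coprime to $\mathfrak m$, with $N(\mathfrak a)$ the norm. Standing setting: $f$ corresponds to an elliptic curve $E$ over $\mathbb Q$ of conductor $N$ with complex multiplication by an order in $K$. $O_f$ means the implied constant may depend on $f$; the estimate is for all sufficiently large $z$. *)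

(* Defs.v *)
From HB Require Import structures.
From mathcomp Require Import all_boot all_order all_algebra all_field.
From mathcomp Require Import finmap complex.
From mathcomp Require Import all_classical all_reals all_analysis.

Set Implicit Arguments.
Unset Strict Implicit.
Unset Printing Implicit Defensive.

Import Order.TTheory GRing.Theory Num.Theory.
Import numFieldNormedType.Exports.

Local Open Scope classical_set_scope.
Local Open Scope ring_scope.
Local Open Scope complex_scope.

Section ModularForms.
Variable R : realType.
Local Notation C := R[i].

Definition cexp (z : C) : C :=
  (expR (complex.Re z))%:C * (cos (complex.Im z) +i* sin (complex.Im z)).

(* qpow n z = e^{2 pi i n z} *)
Definition qpow (n : nat) (z : C) : C :=
  cexp ((0 +i* (pi *+ 2)) * n%:R * z).

Definition upper_half_plane : set C := [set z | 0 < complex.Im z].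

Definition SL2Z : set 'M[int]_2 := [set g | \det g = 1].

Definition Gamma0 (N : nat) : set 'M[int]_2 :=
  [set g | SL2Z g /\ (N%:Z %| g ord_max ord0)%Z].

(* (f |_k g)(z) = (cz + d)^(-k) f((az + b) / (cz + d)) for g = (a, b; c, d) *)
Definition slash (k : nat) (g : 'M[int]_2) (f : C -> C) (z : C) : C :=
  let num := (g ord0 ord0)%:~R * z + (g ord0 ord_max)%:~R in
  let den := (g ord_max ord0)%:~R * z + (g ord_max ord_max)%:~R in
  den ^- k * f (num / den).

(* A modular form is represented by a total function on C, of which only the
   values on the upper half plane matter.  Complex differentiability is
   [derivable] over the scalar field C in the direction 1. The last clause is
   holomorphy at every cusp. *)
Definition modular_form (k N : nat) (f : C -> C) : Prop :=
  [/\ forall z, upper_half_plane z -> derivable (f : C^o -> C^o) z 1,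
      forall g, Gamma0 N g ->
        forall z, upper_half_plane z -> slash k g f z = f z
    & forall g, SL2Z g -> exists A B : R, 0 < A /\
        forall z, A <= complex.Im z -> `|slash k g f z| <= B%:C].

(* The Hecke operator T_n on forms of weight k for Gamma_0(N) (so that T_p is
   U_p when p divides N):
   T_n f(z) = n^(k-1) \sum_(ad = n, (a, N) = 1) d^(-k)
                        \sum_(0 <= b < d) f((az + b) / d). *)
Definition hecke_T (k N n : nat) (f : C -> C) (z : C) : C :=
  n%:R ^+ k.-1 *
  \sum_(d <- divisors n | coprime (n %/ d) N)
    d%:R ^- k * \sum_(0 <= b < d) f (((n %/ d)%:R * z + b%:R) / d%:R).

Definition hecke_eigenform (k N : nat) (f : C -> C) : Prop :=
  [/\ modular_form k N f,
      exists2 z, upper_half_plane z & f z != 0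
    & forall n, (0 < n)%N -> exists lambda : C,
        forall z, upper_half_plane z -> hecke_T k N n f z = lambda * f z].

Definition q_expansion (f : C -> C) (a : nat -> C) : Prop :=
  forall z, upper_half_plane z ->
    (fun X : nat => \sum_(1 <= n < X.+1) a n * qpow n z : C^o) @ \oo --> (f z : C^o).

End ModularForms.

Section Ideals.
Variable K : fieldExtType rat.

Definition ring_of_integers : set K :=
  [set x | integralOver (intr : int -> K) x].
Local Notation OK := ring_of_integers.

Definition integral_ideal (I : set K) : Prop :=
  [/\ I `<=` OK, exists2 x, I x & x != 0,
      forall x y, I x -> I y -> I (x + y)
    & forall r x, OK r -> I x -> I (r * x)].

Definition principal_ideal (alpha : K) : set K := [set r * alpha | r in OK].

Definition ideal_mul (I J : set K) : set K :=
  smallest integral_ideal [set x * y | x in I & y in J].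

Definition coprime_ideals (I J : set K) : Prop :=
  exists x y, [/\ I x, J y & x + y = 1].

(* N(I) = #(O_K / I) *)
Definition ideal_norm (I : set K) : nat :=
  #|` fset_set [set [set (x + y)%R | y in I] | x in OK]|%fset.

End Ideals.

Section HeckeCharacters.
Variables (R : realType) (K : fieldExtType rat).
Local Notation C := R[i].

Definition imaginary_quadratic : Prop :=
  \dim {:K} = 2%N /\
  forall iota : {rmorphism K -> C}, exists x, complex.Im (iota x) != 0.

(* Algebraic Hecke characters (Groessencharaktere of type A_0) modulo m, in
   terms of ideals.  A homomorphism to C^* from the group of fractional ideals
   prime to m is the same thing as a multiplicative map with nonzero values on
   the integral ideals prime to m, which generate this group; likewise every
   alpha = 1 mod^* m is a quotient of two nonzero integers = 1 mod m.
   The integers u, v are the infinity type; no relation between (u, v) and the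
   weight of a form is imposed.  The values of psi on sets which are
   not integral ideals prime to m are irrelevant. *)
Definition hecke_character (m : set K) (psi : set K -> C) : Prop :=
  [/\ integral_ideal m,
      forall I, integral_ideal I -> coprime_ideals I m -> psi I != 0,
      forall I J, integral_ideal I -> coprime_ideals I m ->
        integral_ideal J -> coprime_ideals J m ->
        psi (ideal_mul I J) = psi I * psi J
    & exists (iota : {rmorphism K -> C}) (u v : int),
        forall alpha, ring_of_integers alpha -> alpha != 0 -> m (alpha - 1) ->
          psi (principal_ideal alpha) = iota alpha ^ u * conjc (iota alpha) ^ v].

(* psi has conductor m: it is not induced from any proper divisor of m. *)
Definition hecke_character_of_conductor (m : set K) (psi : set K -> C) : Prop :=
  hecke_character m psi /\
  forall m' psi', m `<=` m' -> hecke_character m' psi' ->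
    (forall I, integral_ideal I -> coprime_ideals I m -> psi' I = psi I) ->
    m' = m.

(* f(z) = \sum_((I, m) = 1) psi(I) e^{2 pi i N(I) z}, the (absolutely
   convergent) sum being taken by increasing norm; only finitely many ideals
   have norm at most X. *)
Definition is_theta_series (m : set K) (psi : set K -> C) (f : C -> C) : Prop :=
  forall z, upper_half_plane z ->
    (fun X : nat =>
       \sum_(I \in [set I | [/\ integral_ideal I, coprime_ideals I m
                               & (ideal_norm I <= X)%N]])
          psi I * qpow (ideal_norm I) z : C^o) @ \oo --> (f z : C^o).

End HeckeCharacters.

Definition complex_multiplication (R : realType) (f : R[i] -> R[i]) : Prop :=
  exists (K : fieldExtType rat) (m : set K) (psi : set K -> R[i]),
    [/\ imaginary_quadratic R K, hecke_character_of_conductor m psi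
      & is_theta_series m psi f].

(* Main.v *)
(** Write N(x, y) = x^2 + t x y + n y^2 for the norm form of the maximal order
    O = Z + Z w of the CM field K, with w^2 = t w - n and D = 4n - t^2 > 0.

    A prime p, outside a finite set, either has no ideal of norm p, and then
    the theta series gives a(p) = 0, or it splits as P P' and then
    a(p) = psi(P) + psi(P').  The Hecke relation a(p^2) = a(p)^2 - p at an inert
    p gives psi((p)) = -p, which forces u + v = 1 for the infinity type (u, v), in
    particular u <> v.  For split p choose b in P with b = 1 modulo the
    conductor and N(b) = c p with c bounded; then (b) = P J with J in a finite
    set of ideals, and a(p) = 0 puts (b / b')^(u - v) in a finite set.
    Since b / b' determines p when p > c, only finitely many split p have
    a(p) = 0.

    The split primes satisfy sum_(p <= x) ln p / p = (1/2) ln x + O(1).  This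
    follows from evaluating sum ln N(alpha) over alpha = 1 modulo a multiple of D
    with N(alpha) <= x in two ways.  It equals G ln x + O(x), where G >= c x is
    the number of terms.  It is also the sum over p^k of ln p times the number
    of terms with p^k | N(alpha); for k = 1 and p split this number is
    2 G / p + O(sqrt(x / p)), and the other prime powers contribute O(x).  The
    counts come from the fact that the number of lattice points in a translate
    of an ellipse f <= s, f an integral form of discriminant -D, depends on
    the translate only up to O(sqrt s), uniformly in f.  Partial summation
    then gives the product. *)
Require Import Defs.
From HB Require Import structures.
From mathcomp Require Import all_boot all_order all_algebra all_field.
From mathcomp Require Import finmap complex.
From mathcomp Require Import all_classical all_reals all_analysis.
From mathcomp Require Import ring lra zify.
From mathcomp Require cyclic.
Import Order.TTheory GRing.Theory Num.Theory.
Import numFieldNormedType.Exports.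
Local Open Scope classical_set_scope.
Local Open Scope ring_scope.

Set Implicit Arguments.
Unset Strict Implicit.
Unset Printing Implicit Defensive.

(** * Counting lattice points *)

(** Only [(1/2) ln x + O(1)] is asked of the split primes because partial summation turns a bounded
    error there into a relative error [O(1 / ln z)] in the product. The obstacle is uniformity: [p]
    runs up to [x], so the forms attached to the ideals above [p] have unbounded coefficients, and
    an error of size [sqrt x] for each prime would exceed the main term. On the ideal the norm is
    [p] times a form of the same discriminant, so the scale drops to [x / p]; every such form is
    equivalent to one with coefficients bounded by [D], and the resulting errors [sqrt (x / p)],
    weighted by [ln p], add up to [O(x)] by Chebyshev's bound. The density [1 / p] comes from
    comparing the [p] cosets of the ideal with each other. The congruence modulo a multiple of [D]
    keeps the ramified primes out of all norms. The inert prime to which the Hecke relation is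
    applied exists because the Mertens sum over all primes grows like [ln x], twice as fast as the
    sum over split primes. *)

Section Counting.
Variable R : realType.

(** Real-valued so as to be compared with [s / q]. An infinite set has count 0, because [fset_set]
    is then empty; hence the finiteness hypotheses throughout. *)
Definition cnt (T : choiceType) (A : set T) : R := (#|` fset_set A|)%:R.

Lemma cnt_sum (T : choiceType) (A : set T) :
  cnt A = \sum_(a <- fset_set A) (1 : R).
Proof. by rewrite /cnt -sum1_size natr_sum. Qed.

Lemma cnt_ge0 (T : choiceType) (A : set T) : 0 <= cnt A.
Proof. exact: ler0n. Qed.

Lemma cnt0 (T : choiceType) : cnt (set0 : set T) = 0.
Proof. by rewrite /cnt fset_set0 cardfs0. Qed.

Lemma le_cnt (T : choiceType) (A B : set T) :
  finite_set B -> A `<=` B -> cnt A <= cnt B.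
Proof.
move=> fB AB; have fA := sub_finite_set AB fB.
by rewrite ler_nat fsubset_leq_card // -fset_set_sub.
Qed.

Lemma cntU_le (T : choiceType) (A B : set T) :
  finite_set A -> finite_set B -> cnt (A `|` B) <= cnt A + cnt B.
Proof.
move=> fA fB; rewrite /cnt -natrD ler_nat fset_setU //.
by rewrite cardfsU leq_subr.
Qed.

Lemma cntUI (T : choiceType) (A B : set T) :
  finite_set A -> finite_set B ->
  cnt (A `|` B) + cnt (A `&` B) = cnt A + cnt B.
Proof.
move=> fA fB; rewrite /cnt -!natrD fset_setU // fset_setI // cardfsU.
by congr (_%:R); rewrite subnK // (leq_trans (fsubset_leq_card (fsubsetIl _ _))) // leq_addr.
Qed.

Lemma cnt_image (T U : choiceType) (f : T -> U) (A : set T) :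
  finite_set A -> {in A &, injective f} -> cnt (f @` A) = cnt A.
Proof.
move=> fA fI; rewrite /cnt fset_set_image // card_in_imfset //= => x y.
by rewrite !in_fset_set // => /[!inE] xA yA; apply: fI; rewrite inE.
Qed.

Lemma cnt_cond (T : choiceType) (A : set T) (P : pred T) : finite_set A ->
  cnt (A `&` [set a | P a]) = \sum_(a <- fset_set A) (P a)%:R.
Proof.
move=> fA; have fAP : finite_set (A `&` [set a | P a]) by exact: finite_setIl.
rewrite cnt_sum [RHS](eq_bigr (fun a => if P a then 1 else 0)); last first.
  by move=> a _; case: (P a).
rewrite -big_mkcond /= -[RHS]big_filter; apply: perm_big.
apply: uniq_perm => //; first exact: filter_uniq.
move=> a; rewrite mem_filter !in_fset_set //.
by apply/idP/andP; rewrite !inE /=; tauto.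
Qed.

Lemma cnt_fibers (T U : choiceType) (f : T -> U) (A : set T) (Y : set U) :
  finite_set A -> finite_set Y -> (forall a, A a -> Y (f a)) ->
  cnt A = \sum_(y <- fset_set Y) cnt (A `&` [set a | f a == y]).
Proof.
move=> fA fY AY.
under eq_bigr do rewrite (cnt_cond (fun a => f a == _)) //.
rewrite exchange_big /= cnt_sum big_seq [RHS]big_seq; apply: eq_bigr => a.
rewrite in_fset_set // inE => aA.
have fay : f a \in fset_set Y by rewrite in_fset_set // inE; exact: AY.
rewrite (bigD1_seq (f a)) //= eqxx big1 ?addr0 // => y /negbTE yn.
by rewrite eq_sym yn.
Qed.

Lemma finite_itv_int (l h : int) : finite_set [set x : int | l <= x <= h].
Proof.
apply: (@sub_finite_set _ _ ((fun i : nat => l + i%:Z) @` `I_(absz (h - l)%R).+1)).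
  move=> x /= /andP[lx xh]; exists (absz (x - l)%R) => /=; first by lia.
  by lia.
exact: finite_image.
Qed.

Lemma cnt_itv_int (l h : int) : l <= h + 1 ->
  cnt [set x : int | l <= x <= h] = (h - l + 1)%:~R.
Proof.
move=> lh.
have -> : [set x : int | l <= x <= h] =
    ((fun i : nat => l + i%:Z) @` `I_(absz (h + 1 - l)%R)).
  apply/seteqP; split => [x /= /andP[lx xh]|x /= [i iI <-]]; last by lia.
  by exists (absz (x - l)%R); lia.
rewrite cnt_image //; last by move=> i j _ _; lia.
rewrite /cnt (card_fset_set (n := absz (h + 1 - l)%R)) //.
have -> : h - l + 1 = Posz (absz (h + 1 - l)%R) by lia.
by [].
Qed.

Lemma finite_itv_real (lo hi : R) :
  finite_set [set x : int | lo <= x%:~R <= hi].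
Proof.
apply: sub_finite_set (finite_itv_int (Num.ceil lo) (Num.floor hi)).
by move=> x /=; rewrite ceil_le_int floor_ge_int.
Qed.

Lemma cnt_itv_real (lo hi : R) : lo <= hi ->
  hi - lo - 1 <= cnt [set x : int | lo <= x%:~R <= hi] <= hi - lo + 1.
Proof.
move=> lohi.
have -> : [set x : int | lo <= x%:~R <= hi] =
   [set x : int | Num.ceil lo <= x <= Num.floor hi].
  by apply/seteqP; split=> x /=; rewrite ceil_le_int floor_ge_int.
have /andP[c1 c2] := ceil_itv lo; have /andP[f1 f2] := floor_itv hi.
rewrite cnt_itv_int.
  rewrite !(rmorphD, rmorphN) /= in c1 c2 f1 f2 *.
  by apply/andP; split; lra.
have : ((Num.ceil lo)%:~R : R) < (Num.floor hi + 1 + 1)%:~R.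
  rewrite !(rmorphD, rmorphN) /= in c1 c2 f1 f2 *; lra.
by rewrite ltr_int; lia.
Qed.

End Counting.

(** * Lattice points in a translated ellipse, row by row *)

Section Disc.
Variable R : realType.
Implicit Types a b c u v s : R.

Definition disc a b c u v s : set (int * int) :=
  [set p | a * (p.1%:~R + u) ^+ 2 + b * (p.1%:~R + u) * (p.2%:~R + v)
           + c * (p.2%:~R + v) ^+ 2 <= s].

Lemma sqr_le_itv (h x w : R) : 0 <= h ->
  ((x + w) ^+ 2 <= h) = (- Num.sqrt h - w <= x <= Num.sqrt h - w).
Proof.
move=> h0; rewrite -(ler_sqrt _ h0) sqrtr_sqr ler_norml.
by apply/andP/andP => -[H1 H2]; split; lra.
Qed.

Lemma sqr_gt_h (h x w : R) : h < 0 -> ((x + w) ^+ 2 <= h) = false.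
Proof. by move=> h0; apply/negbTE; rewrite -ltNge (lt_le_trans h0) // sqr_ge0. Qed.

(** Squared half-width of the ellipse at height [y], from [4 a f = (2 a X + b Y)^2 + (4 a c - b^2)
    Y^2]; a negative value means an empty row. *)
Let rowh a b c v s (y : int) : R :=
  (4 * a * s - (4 * a * c - b ^+ 2) * (y%:~R + v) ^+ 2) / (4 * a ^+ 2).

Lemma disc_row a b c u v s (x y : int) : 0 < a ->
  disc a b c u v s (x, y) <->
  (x%:~R + (u + b * (y%:~R + v) / (2 * a))) ^+ 2 <= rowh a b c v s y.
Proof.
move=> a0; rewrite /disc /rowh /= ler_pdivlMr; last by rewrite mulr_gt0 ?exprn_gt0.
set X : R := x%:~R; set Y : R := y%:~R.
have -> : (X + (u + b * (Y + v) / (2 * a))) ^+ 2 * (4 * a ^+ 2) =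
   (2 * a * (X + u) + b * (Y + v)) ^+ 2 by field; exact: lt0r_neq0.
by split => H; nra.
Qed.

Let rows a b c v s : set int := [set y : int |
  - Num.sqrt (4 * a * s / (4 * a * c - b ^+ 2)) - v <= y%:~R
     <= Num.sqrt (4 * a * s / (4 * a * c - b ^+ 2)) - v].

Lemma disc_rows a b c u v s (p : int * int) : 0 < a -> 0 < 4 * a * c - b ^+ 2 ->
  0 <= s -> disc a b c u v s p -> rows a b c v s p.2.
Proof.
case: p => x y a0 D0 s0 /disc_row - /(_ a0) /(le_trans (sqr_ge0 _)).
rewrite /rowh pmulr_lge0 ?invr_gt0 ?mulr_gt0 ?exprn_gt0 // subr_ge0 => H.
rewrite /rows /= -sqr_le_itv; last first.
  by rewrite divr_ge0 ?(ltW D0) // mulr_ge0 // mulr_ge0 ?ltW.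
by rewrite ler_pdivlMr // mulrC.
Qed.

Lemma cnt_rows a b c v s : 
  cnt R (rows a b c v s) <= 2 * Num.sqrt (4 * a * s / (4 * a * c - b ^+ 2)) + 1.
Proof.
have H0 := sqrtr_ge0 (4 * a * s / (4 * a * c - b ^+ 2)).
have /(@cnt_itv_real R)/andP[_] : - Num.sqrt (4 * a * s / (4 * a * c - b ^+ 2)) - v <=
  Num.sqrt (4 * a * s / (4 * a * c - b ^+ 2)) - v by lra.
by move=> H; apply: (le_trans H); lra.
Qed.

Lemma rowE a b c u v s (y : int) : 0 < a -> 0 <= rowh a b c v s y ->
  [set x | disc a b c u v s (x, y)] =
  [set x : int | - Num.sqrt (rowh a b c v s y) - (u + b * (y%:~R + v) / (2 * a)) <= x%:~R
    <= Num.sqrt (rowh a b c v s y) - (u + b * (y%:~R + v) / (2 * a))].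
Proof.
move=> a0 h0; apply/seteqP; split => x /=.
  by move/disc_row => /(_ a0); rewrite sqr_le_itv.
by rewrite -sqr_le_itv // => H; apply/disc_row.
Qed.

Lemma row0 a b c u v s (y : int) : 0 < a -> rowh a b c v s y < 0 ->
  [set x | disc a b c u v s (x, y)] = set0.
Proof.
move=> a0 h0; apply/seteqP; split => x //= /disc_row - /(_ a0).
by rewrite sqr_gt_h.
Qed.

Lemma finite_row a b c u v s (y : int) : 0 < a ->
  finite_set [set x | disc a b c u v s (x, y)].
Proof.
move=> a0; case: (ltP (rowh a b c v s y) 0) => h0; first by rewrite row0.
by rewrite rowE //; exact: finite_itv_real.
Qed.

Lemma finite_disc a b c u v s : 0 < a -> 0 < 4 * a * c - b ^+ 2 ->
  finite_set (disc a b c u v s).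
Proof.
move=> a0 D0.
case: (ltP s 0) => s0.
  suff -> : disc a b c u v s = set0 by [].
  apply/seteqP; split => -[x y] //= /disc_row - /(_ a0) /(le_trans (sqr_ge0 _)).
  rewrite /rowh pmulr_lge0 ?invr_gt0 ?mulr_gt0 ?exprn_gt0 // subr_ge0 => H.
  have := mulr_ge0 (ltW D0) (sqr_ge0 (y%:~R + v)); nra.
apply: (@sub_finite_set _ _ (\bigcup_(y in rows a b c v s)
   ((fun x => (x, y)) @` [set x | disc a b c u v s (x, y)]))).
  move=> p dp; exists p.2; first exact: disc_rows dp.
  by exists p.1 => //=; case: p dp.
apply: bigcup_finite; first exact: finite_itv_real.
by move=> y _; apply: finite_image; exact: finite_row.
Qed.

Lemma cnt_disc_rows a b c u v s : 0 < a -> 0 < 4 * a * c - b ^+ 2 -> 0 <= s ->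
  cnt R (disc a b c u v s) =
  \sum_(y <- fset_set (rows a b c v s)) cnt R [set x | disc a b c u v s (x, y)].
Proof.
move=> a0 D0 s0.
rewrite (@cnt_fibers R _ _ snd (disc a b c u v s) (rows a b c v s)).
- apply: eq_bigr => y _.
  rewrite -(@cnt_image R _ _ (fun x => (x, y)) [set x | disc a b c u v s (x, y)]).
  + congr (cnt R _); apply/seteqP; split => [[x y'] /= [dp /eqP <-]|]; first by exists x.
    by move=> p /= [x dx <-] /=.
  + exact: finite_row.
  + by move=> x x' _ _ [].
- exact: finite_disc.
- exact: finite_itv_real.
- by move=> p; exact: disc_rows.
Qed.

(** Both rows are the integer points of real intervals of one length, and each count is within 1 of
    that length. *)
Lemma cnt_row_shift a b c u u' v s (y : int) : 0 < a ->
  `|cnt R [set x | disc a b c u v s (x, y)] - cnt R [set x | disc a b c u' v s (x, y)]| <= 2.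
Proof.
move=> a0; case: (ltP (rowh a b c v s y) 0) => h0.
  by rewrite !row0 // subrr normr0.
have H0 := sqrtr_ge0 (rowh a b c v s y).
rewrite !rowE //.
set w := u + _; set w' := u' + _; set q := Num.sqrt _ in H0 *.
have /(@cnt_itv_real R)/andP[A1 A2] : - q - w <= q - w by lra.
have /(@cnt_itv_real R)/andP[B1 B2] : - q - w' <= q - w' by lra.
by rewrite ler_norml; apply/andP; split; lra.
Qed.

Lemma sum_cst_cnt (T : choiceType) (Y : set T) (C : R) :
  \sum_(y <- fset_set Y) C = C * cnt R Y.
Proof. by rewrite cnt_sum mulr_sumr; apply: eq_bigr => y _; rewrite mulr1. Qed.

(** Moving the centre horizontally slides every row without changing its length, so the error is 2
    per row; the number of rows is controlled by the height of the ellipse. *)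
Lemma cnt_disc_shift1 a b c u u' v s : 0 < a -> 0 < 4 * a * c - b ^+ 2 -> 0 <= s ->
  `|cnt R (disc a b c u v s) - cnt R (disc a b c u' v s)| <=
  2 * (2 * Num.sqrt (4 * a * s / (4 * a * c - b ^+ 2)) + 1).
Proof.
move=> a0 D0 s0; rewrite !cnt_disc_rows // -sumrB.
apply: (le_trans (ler_norm_sum _ _ _)).
apply: (@le_trans _ _ (\sum_(y <- fset_set (rows a b c v s)) 2)).
  by apply: ler_sum => y _; exact: cnt_row_shift.
by rewrite sum_cst_cnt ler_pM2l // cnt_rows.
Qed.

Lemma cnt_disc_le a b c u v s : 0 < a -> 0 < 4 * a * c - b ^+ 2 -> 0 <= s ->
  cnt R (disc a b c u v s) <=
  (2 * Num.sqrt (s / a) + 1) * (2 * Num.sqrt (4 * a * s / (4 * a * c - b ^+ 2)) + 1).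
Proof.
move=> a0 D0 s0; rewrite !cnt_disc_rows //.
apply: (@le_trans _ _ (\sum_(y <- fset_set (rows a b c v s)) (2 * Num.sqrt (s / a) + 1))).
  apply: ler_sum => y _.
  have S0 := sqrtr_ge0 (s / a).
  case: (ltP (rowh a b c v s y) 0) => h0; first by rewrite row0 // cnt0; lra.
  have H0 := sqrtr_ge0 (rowh a b c v s y).
  rewrite !rowE //.
  have : Num.sqrt (rowh a b c v s y) <= Num.sqrt (s / a).
    rewrite ler_sqrt ?divr_ge0 ?(ltW a0) // /rowh ler_pdivrMr ?mulr_gt0 ?exprn_gt0 //.
    have -> : s / a * (4 * a ^+ 2) = 4 * a * s by field; exact: lt0r_neq0.
    have := mulr_ge0 (ltW D0) (sqr_ge0 (y%:~R + v)); lra.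
  set w := u + _; set q := Num.sqrt (rowh _ _ _ _ _ _) in H0 * => Hq.
  have /(@cnt_itv_real R)/andP[A1 A2] : - q - w <= q - w by lra.
  lra.
rewrite sum_cst_cnt ler_pM2l ?cnt_rows //.
Qed.

Lemma cnt_disc_swap a b c u v s : 0 < a -> 0 < 4 * a * c - b ^+ 2 ->
  cnt R (disc a b c u v s) = cnt R (disc c b a v u s).
Proof.
move=> a0 D0.
rewrite -(@cnt_image R _ _ (fun p : int * int => (p.2, p.1)) (disc a b c u v s)).
- congr (cnt R _); apply/seteqP; split => [p /= [[x y] /= H <-]|[x y] /= H].
    by move: H; rewrite /disc /=; lra.
  by exists (y, x) => //; move: H; rewrite /disc /=; lra.
- exact: finite_disc.
- by move=> [x y] [x' y'] _ _ [-> ->].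
Qed.

Lemma form_pos_c a b c : 0 < a -> 0 < 4 * a * c - b ^+ 2 -> 0 < c.
Proof. by move=> a0 D0; have := sqr_ge0 b; rewrite -(pmulr_rgt0 _ a0); nra. Qed.

Lemma cnt_disc_shift2 a b c u v v' s : 0 < a -> 0 < 4 * a * c - b ^+ 2 -> 0 <= s ->
  `|cnt R (disc a b c u v s) - cnt R (disc a b c u v' s)| <=
  2 * (2 * Num.sqrt (4 * c * s / (4 * a * c - b ^+ 2)) + 1).
Proof.
move=> a0 D0 s0; have c0 := form_pos_c a0 D0.
rewrite (cnt_disc_swap u v s a0 D0) (cnt_disc_swap u v' s a0 D0) (_ : 4 * a * c = 4 * c * a); last by ring.
by apply: cnt_disc_shift1 => //; lra.
Qed.

(** A common bound [K] of [a] and [c] controls both dimensions of the ellipse; with [K] equal to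
    [4 a c - b^2] the radicand no longer depends on the form. *)
Lemma cnt_disc_shift a b c u v u' v' s K : 0 < a -> 0 < 4 * a * c - b ^+ 2 -> 0 <= s ->
  a <= K -> c <= K ->
  `|cnt R (disc a b c u v s) - cnt R (disc a b c u' v' s)| <=
  4 * (2 * Num.sqrt (4 * K * s / (4 * a * c - b ^+ 2)) + 1).
Proof.
move=> a0 D0 s0 aK cK.
have mono z : 0 < z -> z <= K -> Num.sqrt (4 * z * s / (4 * a * c - b ^+ 2)) <=
    Num.sqrt (4 * K * s / (4 * a * c - b ^+ 2)).
  move=> z0 zK; rewrite ler_wsqrtr // ler_pM2r ?invr_gt0 // ler_wpM2r //.
  by rewrite ler_pM2l.
have A := mono a a0 aK; have C := mono c (form_pos_c a0 D0) cK.
have H1 := cnt_disc_shift1 u u' v a0 D0 s0.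
have H2 := cnt_disc_shift2 u' v v' a0 D0 s0.
rewrite !ler_norml in H1 H2 *.
by move/andP: H1 => [? ?]; move/andP: H2 => [? ?]; apply/andP; split; lra.
Qed.

End Disc.

(* Descent on |b|; when |b| <= a and |b| <= c, the identity 4ac = D + b^2
   forces a c <= D, hence a, c <= D. *)
Lemma form_ind (D : int) (P : int -> int -> int -> Prop) :
  (forall a b c, 0 < a -> 4 * a * c - b ^+ 2 = D -> a <= D -> c <= D -> P a b c) ->
  (forall a b c k, 0 < a -> 4 * a * c - b ^+ 2 = D ->
     P a (b + 2 * a * k) (c + b * k + a * k ^+ 2) -> P a b c) ->
  (forall a b c, 0 < a -> 4 * a * c - b ^+ 2 = D -> P c b a -> P a b c) ->
  0 < D -> forall a b c, 0 < a -> 4 * a * c - b ^+ 2 = D -> P a b c.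
Proof.
move=> Pred Ptr Psw D0 a b c; have [n] := ubnP (absz b).
elim: n a b c => // n IH a b c bn a0 Dabc.
have c0 : 0 < c by nia.
(* When [|a'| < |b|], the translation by [-1] or [1], chosen by the sign of [b], changes [b] by
   [2 a'] towards the other sign and lowers its absolute value. *)
have step a' c' : 0 < a' -> 0 < c' -> 4 * a' * c' - b ^+ 2 = D ->
    (absz a' < absz b)%N -> P a' b c'.
  move=> a'0 c'0 D' ab.
  case: (ltP 0 b) => b0.
    apply: (Ptr _ _ _ (-1)) => //; apply: IH => //; first by lia.
    by rewrite -D'; ring.
  apply: (Ptr _ _ _ 1) => //; apply: IH => //; first by lia.
  by rewrite -D'; ring.
case: (ltnP (absz a) (absz b)) => ab; first exact: step.
case: (ltnP (absz c) (absz b)) => cb.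
  by apply: Psw => //; apply: step => //; rewrite -Dabc; ring.
have bac : b ^+ 2 <= a * c.
  have [b0|b0] := ltP 0 b; nia.
by apply: Pred => //; nia.
Qed.

(** A reduced form takes the value [a <= D] at [(1, 0)], and equivalent forms take the same
    values. *)
Lemma form_represents_le_disc (D a b c : int) :
  0 < D -> 0 < a -> 4 * a * c - b ^+ 2 = D ->
  exists x y : int, [/\ (x, y) != (0, 0) &
    a * x ^+ 2 + b * x * y + c * y ^+ 2 <= D].
Proof.
move=> D0; move: a b c; apply: form_ind => //.
- by move=> a b c a0 Dabc aD cD; exists 1, 0; split => //; lia.
- move=> a b c k a0 Dabc [x [y [xy H]]]; exists (x + k * y), y; split.
    by apply/eqP => -[H1 H2]; move/eqP: xy; apply; congr pair; rewrite // -H1 H2; ring.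
  by apply: le_trans H; rewrite le_eqVlt; apply/orP; left; apply/eqP; ring.
- move=> a b c a0 Dabc [x [y [xy H]]]; exists y, x; split.
    by apply: contra xy => /eqP[-> ->].
  by apply: le_trans H; rewrite le_eqVlt; apply/orP; left; apply/eqP; ring.
Qed.

(** * Bounds uniform over the integral forms of one discriminant *)

Section IntForms.
Variable R : realType.

Definition idisc (a b c : int) : R -> R -> R -> set (int * int) :=
  disc (a%:~R : R) b%:~R c%:~R.

Lemma idisc_disc (D a b c : int) : 4 * a * c - b ^+ 2 = D ->
  4 * a%:~R * c%:~R - b%:~R ^+ 2 = D%:~R :> R.
Proof. by move<-; rewrite rmorphB rmorphXn !rmorphM. Qed.

(** The unimodular substitution [(x, y) -> (x + k y, y)], with the centre moved accordingly. *)
Lemma cnt_idisc_translate (D a b c k : int) (u v s : R) : 0 < D -> 0 < a ->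
  4 * a * c - b ^+ 2 = D ->
  cnt R (idisc a b c u v s) =
  cnt R (idisc a (b + 2 * a * k) (c + b * k + a * k ^+ 2) (u - k%:~R * v) v s).
Proof.
move=> D0 a0 Dabc.
have D' : 4 * a * (c + b * k + a * k ^+ 2) - (b + 2 * a * k) ^+ 2 = D.
  by rewrite -Dabc; ring.
rewrite -(@cnt_image R _ _ (fun p : int * int => (p.1 + k * p.2, p.2))
   (idisc a (b + 2 * a * k) (c + b * k + a * k ^+ 2) _ _ _)).
- congr (cnt R _); apply/seteqP; split => [[x y] /= H|p /= [[x y] /= H <-]].
    exists (x - k * y, y) => /=; last by congr pair; ring.
    move: H; rewrite /idisc /disc /= !(rmorphXn, rmorphD, rmorphM, rmorphN) /=.
    by apply: le_trans; rewrite le_eqVlt; apply/orP; left; apply/eqP; ring.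
  move: H; rewrite /idisc /disc /= !(rmorphXn, rmorphD, rmorphM, rmorphN) /=.
  by apply: le_trans; rewrite le_eqVlt; apply/orP; left; apply/eqP; ring.
- by apply: finite_disc; rewrite ?ltr0z // (idisc_disc D') ltr0z.
- by move=> [x y] [x' y'] _ _ [H1 H2]; move: H1; rewrite H2 => /addIr ->.
Qed.

(** The descent [form_ind] leaves the forms with [a, c <= D]; there [4 D s / D = 4 s], and the error
    is [4 (2 * 2 sqrt s + 1)]. No trace of the form remains, which matters since later the form
    varies with a prime. *)
Lemma cnt_idisc_shift (D a b c : int) (u v u' v' s : R) : 0 < D -> 0 < a ->
  4 * a * c - b ^+ 2 = D -> 0 <= s ->
  `|cnt R (idisc a b c u v s) - cnt R (idisc a b c u' v' s)| <= 16 * Num.sqrt s + 4.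
Proof.
move=> D0 a0 Dabc s0; move: a b c a0 Dabc u v u' v'; apply: form_ind => //.
- move=> a b c a0 Dabc aD cD u v u' v'.
  have D0R : 0 < (D%:~R : R) by rewrite ltr0z.
  apply: (le_trans (@cnt_disc_shift R _ _ _ u v u' v' s D%:~R _ _ _ _ _)) => //.
  + by rewrite ltr0z.
  + by rewrite (idisc_disc Dabc).
  + by rewrite ler_int.
  + by rewrite ler_int.
  rewrite (idisc_disc Dabc).
  have -> : 4 * D%:~R * s / D%:~R = (2 ^+ 2) * s.
    by field; rewrite intr_eq0; apply/eqP; lia.
  by rewrite sqrtrM // sqrtr_sqr ger0_norm //; lra.
- move=> a b c k a0 Dabc IH u v u' v'.
  by rewrite !(cnt_idisc_translate k _ _ _ D0 a0 Dabc); exact: IH.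
- move=> a b c a0 Dabc IH u v u' v'.
  have aR : 0 < (a%:~R : R) by rewrite ltr0z.
  have DR : 0 < 4 * a%:~R * c%:~R - b%:~R ^+ 2 :> R.
    by rewrite (idisc_disc Dabc) ltr0z.
  rewrite /idisc (cnt_disc_swap u v s aR DR) (cnt_disc_swap u' v' s aR DR).
  exact: IH.
Qed.

End IntForms.

(** * Elements of an ideal in a translated ellipse *)

Section Lattice.
Variables (R : realType) (t n : int).
Hypothesis D0 : 0 < 4 * n - t ^+ 2.

(** The pair [(x, y)] stands for [x + y w] with [w^2 = t w - n]. *)
Definition nrm (p : int * int) : int := p.1 ^+ 2 + t * p.1 * p.2 + n * p.2 ^+ 2.
Definition ndisc (u v s : R) := idisc 1 t n u v s.
(** For [r] a root modulo [q], this is the kernel of the ring map from [Z + Z w] to [Z / q] sending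
    [w] to [r]: an ideal of norm [q]. *)
Definition latt (q : nat) (r : int) : set (int * int) :=
  [set p | (q%:Z %| p.1 + r * p.2)%Z].
Definition is_root (q : nat) (r : int) := (q%:Z %| r ^+ 2 - t * r + n)%Z.

Lemma ndisc_nrm (s : R) p : ndisc 0 0 s p <-> (nrm p)%:~R <= s.
Proof.
rewrite /ndisc /idisc /disc /= /nrm !addr0 mul1r.
by rewrite !(rmorphXn, rmorphD, rmorphM, rmorphN).
Qed.

Lemma finite_ndisc u v s : finite_set (ndisc u v s).
Proof.
apply: finite_disc; first by rewrite ltr0z.
rewrite (@idisc_disc R (4 * n - t ^+ 2)) ?ltr0z //; ring.
Qed.

(** In the basis [(q, 0)], [(-r, 1)] of the ideal the norm is [q] times the form [(q, t - 2 r, m)],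
    which has the discriminant of the norm form. Dividing by [q] replaces [s] by [s / q]. *)
Lemma cnt_latt_idisc (q : nat) (r m : int) (u v s : R) : (0 < q)%N ->
  r ^+ 2 - t * r + n = q%:Z * m ->
  cnt R (latt q r `&` ndisc u v s) =
  cnt R (idisc q%:Z (t - 2 * r) m ((u + r%:~R * v) / q%:R) v (s / q%:R)).
Proof.
move=> q0 qm.
have q0R : 0 < (q%:R : R) by rewrite ltr0n.
have qmR : r%:~R ^+ 2 - t%:~R * r%:~R + n%:~R = q%:R * m%:~R :> R.
  have /(congr1 (fun z : int => z%:~R : R)) := qm.
  by rewrite !(rmorphXn, rmorphD, rmorphM, rmorphN).
have equi (x y : int) : ndisc u v s (q%:Z * x - r * y, y) <->
   idisc q%:Z (t - 2 * r) m ((u + r%:~R * v) / q%:R) v (s / q%:R) (x, y).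
  rewrite /ndisc /idisc /disc /= ler_pdivlMr //.
  rewrite !(rmorphXn, rmorphD, rmorphM, rmorphN) /=.
  set X : R := x%:~R; set Y : R := y%:~R; rewrite -!pmulrn.
  have -> : (q%:R * (X + (u + r%:~R * v) / q%:R) ^+ 2
    + (t%:~R - 2 * r%:~R) * (X + (u + r%:~R * v) / q%:R) * (Y + v)
    + m%:~R * (Y + v) ^+ 2) * q%:R =
    (q%:R * X + u + r%:~R * v) ^+ 2 +
    (t%:~R - 2 * r%:~R) * (q%:R * X + u + r%:~R * v) * (Y + v)
    + (q%:R * m%:~R) * (Y + v) ^+ 2.
    by field; exact: lt0r_neq0.
  rewrite -qmR; split; apply: le_trans; rewrite le_eqVlt; apply/orP; left; apply/eqP; ring.
rewrite -(@cnt_image R _ _ (fun p : int * int => (q%:Z * p.1 - r * p.2, p.2))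
   (idisc q%:Z (t - 2 * r) m _ _ _)).
- congr (cnt R _); apply/seteqP; split => [[x y] /= [/dvdzP[k /= kE] H]|p /= [[x y] /= H <-]].
    have xE : x = q%:Z * k - r * y by rewrite mulrC -kE; ring.
    exists (k, y); last by rewrite /= -xE.
    by apply/equi; rewrite -xE.
  split; last exact/equi.
  by rewrite /latt /= subrK; apply/dvdzP; exists x; rewrite mulrC.
- apply: finite_disc; first by rewrite ltr0z.
  rewrite (@idisc_disc R (4 * n - t ^+ 2)) ?ltr0z //.
  by rewrite -mulrA -qm; ring.
- move=> [x y] [x' y'] _ _ /= [+ H2]; rewrite H2 => /addIr /mulfI -> //.
  by apply/eqP; lia.
Qed.

Lemma cnt_latt_shift (q : nat) (r : int) (u v u' v' s : R) : (0 < q)%N ->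
  is_root q r -> 0 <= s ->
  `|cnt R (latt q r `&` ndisc u v s) - cnt R (latt q r `&` ndisc u' v' s)|
    <= 16 * Num.sqrt (s / q%:R) + 4.
Proof.
move=> q0 /dvdzP[m]; rewrite [m * _]mulrC => qm s0.
rewrite !(cnt_latt_idisc _ _ _ q0 qm).
apply: (cnt_idisc_shift _ _ _ _ D0) => //; last by rewrite divr_ge0.
by rewrite -mulrA -qm; ring.
Qed.

Lemma cnt_In (q : nat) : cnt R `I_q = q%:R.
Proof. by rewrite /cnt (card_fset_set (n := q)). Qed.

(** The [q] cosets of [latt q r] partition the integer points, and a coset inside the ellipse is
    [latt q r] inside a translated ellipse. All [q] counts agree up to the translation error, so
    each is close to their average. *)
Lemma cnt_latt (q : nat) (r : int) (u v s : R) : (0 < q)%N ->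
  is_root q r -> 0 <= s ->
  `|cnt R (latt q r `&` ndisc u v s) - cnt R (ndisc 0 0 s) / q%:R|
    <= 16 * Num.sqrt (s / q%:R) + 4.
Proof.
move=> q0 qr s0; have q0R : 0 < (q%:R : R) by rewrite ltr0n.
pose f (p : int * int) := absz ((p.1 + r * p.2) %% q%:Z)%Z.
have modE p : (f p)%:Z = ((p.1 + r * p.2) %% q%:Z)%Z.
  by rewrite /f gez0_abs // modz_ge0 //; lia.
have -> : cnt R (ndisc 0 0 s) = \sum_(i <- fset_set `I_q)
    cnt R (latt q r `&` ndisc i%:R 0 s).
  rewrite (@cnt_fibers R _ _ f _ `I_q); last 3 first.
  - exact: finite_ndisc.
  - exact: finite_II.
  - move=> p _ /=; rewrite -ltz_nat modE ltz_pmod //; lia.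
  rewrite big_seq [RHS]big_seq; apply: eq_bigr => i.
  rewrite in_fset_set // inE => /= iq.
  rewrite -(@cnt_image R _ _ (fun p : int * int => (p.1 + i%:Z, p.2)) (latt q r `&` _)).
  - congr (cnt R _); apply/seteqP; split => [[x y] /= [H /eqP fi]|p /= [[x y] /= [H1 H2] <-]].
      exists (x - i%:Z, y); last by rewrite /= subrK.
      split.
        rewrite /latt /=; apply/dvdzP; exists ((x + r * y) %/ q%:Z)%Z.
        have := divz_eq (x + r * y) q%:Z; rewrite -(modE (x, y)) fi; lia.
      move: H; rewrite /ndisc /idisc /disc /= rmorphB /= -pmulrn.
      by rewrite subrK !addr0.
    split.
      move: H2; rewrite /ndisc /idisc /disc /= rmorphD /= -pmulrn.
      by rewrite !addr0.
    move/dvdzP: H1 => [k /= kE]; apply/eqP/eqP.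
    rewrite -eqz_nat modE /= addrAC kE modzMDl modz_small //; lia.
  - by apply: finite_setIr; exact: finite_ndisc.
  - by move=> [x y] [x' y'] _ _ /= [/addIr -> ->].
rewrite -(ler_pM2r q0R) -{2}(ger0_norm (ltW q0R)) -normrM mulrBl divfK ?lt0r_neq0 //.
rewrite -cnt_In -sum_cst_cnt -sumrB -sum_cst_cnt.
apply: (le_trans (ler_norm_sum _ _ _)); apply: ler_sum => i _.
by rewrite cnt_In; exact: cnt_latt_shift.
Qed.
End Lattice.

Lemma dvdzD (d a b : int) : (d %| a)%Z -> (d %| b)%Z -> (d %| a + b)%Z.
Proof. exact: rpredD. Qed.

Lemma dvdzB (d a b : int) : (d %| a)%Z -> (d %| b)%Z -> (d %| a - b)%Z.
Proof. exact: rpredB. Qed.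

(** * Roots of [X^2 - t X + n] modulo prime powers *)

Section Roots.
Variables (t n : int).
Let D := 4 * n - t ^+ 2.

Lemma prime_dvdzM (p : nat) (a b : int) : prime p ->
  (p%:Z %| a * b)%Z = (p%:Z %| a)%Z || (p%:Z %| b)%Z.
Proof. by move=> pp; rewrite !dvdzE abszM Euclid_dvdM. Qed.

Lemma prime_coprimez (p : nat) (a : int) : prime p ->
  coprimez p%:Z a = ~~ (p%:Z %| a)%Z.
Proof. by move=> pp; rewrite coprimezE dvdzE prime_coprime. Qed.

Lemma natXz (p k : nat) : (p ^ k)%N%:Z = p%:Z ^+ k.
Proof. by rewrite -!natz natrX. Qed.

Lemma dvdz_prime_pow (p k : nat) (a : int) : (0 < k)%N ->
  ((p ^ k)%N%:Z %| a)%Z -> (p%:Z %| a)%Z.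
Proof.
move=> k0; apply: dvdz_trans; rewrite natXz -[k]prednK // exprS.
exact: dvdz_mulr.
Qed.

Lemma prime_pow_coprimez (p k : nat) (a : int) : prime p ->
  ~~ (p%:Z %| a)%Z -> coprimez (p ^ k)%N%:Z a.
Proof. by move=> pp pa; rewrite natXz coprimezXl // prime_coprimez. Qed.

(** The product [(r - r0) (r - (t - r0))] is a difference of two values of the polynomial. A prime
    dividing both factors divides [2 r - t], hence the discriminant. *)
Lemma root_cases (p k : nat) (r0 r : int) : prime p -> ~~ (p%:Z %| D)%Z -> 
  (0 < k)%N -> is_root t n (p ^ k) r0 -> is_root t n (p ^ k) r ->
  ((p ^ k)%N%:Z %| r - r0)%Z || ((p ^ k)%N%:Z %| r - (t - r0))%Z.
Proof.
move=> pp pD k0 h0 h.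
have H : ((p ^ k)%N%:Z %| (r - r0) * (r - (t - r0)))%Z.
  have -> : (r - r0) * (r - (t - r0)) =
    (r ^+ 2 - t * r + n) - (r0 ^+ 2 - t * r0 + n) by ring.
  exact: dvdzB.
have [pr|pr] := boolP (p%:Z %| r - r0)%Z; last first.
  by rewrite (Gauss_dvdzr _ (prime_pow_coprimez _ pp pr)) in H; rewrite H orbT.
have [pr'|pr'] := boolP (p%:Z %| r - (t - r0))%Z; last first.
  by rewrite (Gauss_dvdzl _ (prime_pow_coprimez _ pp pr')) in H; rewrite H.
case/negP: pD.
have -> : D = 4 * (r ^+ 2 - t * r + n) - (2 * r - t) * (2 * r - t).
  by rewrite /D; ring.
apply: dvdzB; first by apply: dvdz_mull; exact: dvdz_prime_pow h.
by apply: dvdz_mulr; have := dvdzD pr pr'; congr (_ %| _)%Z; ring.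
Qed.

Lemma latt_eq (q : nat) (r r' : int) : (q%:Z %| r - r')%Z -> latt q r = latt q r'.
Proof.
have H a b : (q%:Z %| a - b)%Z -> latt q a `<=` latt q b.
  move=> ab p; rewrite /latt /= => /dvdzB /(_ (dvdz_mulr p.2 ab)).
  by congr (_ %| _)%Z; ring.
move=> rr; apply/seteqP; split; apply: H => //.
by rewrite -opprB rpredN.
Qed.

Lemma dvdz_nrm_latt (q : nat) (r : int) (p : int * int) :
  is_root t n q r -> latt q r p -> (q%:Z %| nrm t n p)%Z.
Proof.
case: p => x y hr; rewrite /latt /= => H.
have -> : nrm t n (x, y) = (x + r * y) * (x + (t - r) * y) + (r ^+ 2 - t * r + n) * y ^+ 2.
  by rewrite /nrm /=; ring.
by apply: dvdzD; exact: dvdz_mulr.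
Qed.

(** A prime dividing the norm and [y] divides [x] too, so [y] is invertible modulo [p^k] and the
    root is [- x / y]. *)
Lemma nrm_dvdz_latt (p k : nat) (a : int * int) : prime p -> (0 < k)%N ->
  ((p ^ k)%N%:Z %| nrm t n a)%Z -> ~~ ((p%:Z %| a.1)%Z && (p%:Z %| a.2)%Z) ->
  exists2 r, is_root t n (p ^ k) r & latt (p ^ k) r a.
Proof.
case: a => x y pp k0 H /= nxy.
have py : ~~ (p%:Z %| y)%Z.
  apply: contra nxy => py; rewrite py andbT.
  have := dvdz_prime_pow k0 H.
  move=> /dvdzB /(_ (dvdz_mulr (t * x + n * y) py)).
  have -> : nrm t n (x, y) - y * (t * x + n * y) = x * x by rewrite /nrm /=; ring.
  by rewrite prime_dvdzM // orbb.
have cy := prime_pow_coprimez k pp py.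
have /coprimezP[[u v] /= uv] := cy.
have hl : ((p ^ k)%N%:Z %| x + - (x * v) * y)%Z.
  have -> : x + - (x * v) * y = x * u * (p ^ k)%N%:Z.
    have -> : x + - (x * v) * y = x * (1 - v * y) by ring.
    by rewrite -uv; ring.
  exact: dvdz_mull.
exists (- (x * v)) => //.
have cy2 : coprimez (p ^ k)%N%:Z (y ^+ 2) by exact: coprimezXr.
rewrite /is_root -(Gauss_dvdzr _ cy2).
set r := - (x * v) in hl *.
have -> : y ^+ 2 * (r ^+ 2 - t * r + n) =
  nrm t n (x, y) - (x + r * y) * (x + (t - r) * y) by rewrite /nrm /=; ring.
by apply: dvdzB => //; exact: dvdz_mulr.
Qed.

Lemma is_rootN (q : nat) (r : int) : is_root t n q r -> is_root t n q (t - r).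
Proof. by rewrite /is_root; congr (_ %| _)%Z; ring. Qed.

(* Away from the discriminant there are at most two roots modulo p^k. *)
Lemma nrm_dvdz_cases (p k : nat) (a : int * int) (r0 : int) : prime p ->
  ~~ (p%:Z %| D)%Z -> (0 < k)%N -> is_root t n (p ^ k) r0 ->
  ((p ^ k)%N%:Z %| nrm t n a)%Z -> ~~ ((p%:Z %| a.1)%Z && (p%:Z %| a.2)%Z) ->
  latt (p ^ k) r0 a \/ latt (p ^ k) (t - r0) a.
Proof.
move=> pp pD k0 h0 H na; have [r hr la] := nrm_dvdz_latt pp k0 H na.
have /orP[/latt_eq|/latt_eq] := root_cases pp pD k0 h0 hr.
  by move=> <-; left.
by move=> <-; right.
Qed.

End Roots.

(** * Upper and lower bounds for counts by norm *)

Section Bounds.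
Variables (R : realType) (t n : int).
Hypothesis D0 : 0 < 4 * n - t ^+ 2.
Local Notation N := (nrm t n).
Local Notation ndisc := (@ndisc R t n).

Lemma nrm_gt0 (p : int * int) : (0 < N p) = (p != (0, 0)).
Proof.
case: p => x y; have E : 4 * N (x, y) = (2 * x + t * y) ^+ 2 + (4 * n - t ^+ 2) * y ^+ 2.
  by rewrite /nrm /=; ring.
apply/idP/idP => [|xy]; first by apply: contraTneq => -[-> ->]; rewrite /nrm /=; lia.
have [y0|y0] := eqVneq y 0.
  have x0 : x != 0 by apply: contra xy => /eqP ->; rewrite y0.
  rewrite /nrm /= y0 expr0n /= !mulr0 !addr0; nia.
suff : 0 < 4 * N (x, y) by lia.
have := sqr_ge0 (2 * x + t * y).
have : 0 < (4 * n - t ^+ 2) * y ^+ 2 by rewrite mulr_gt0 // lt0r sqr_ge0 sqrf_eq0 y0.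
by lia.
Qed.

Lemma D1R : 1 <= (4 * n - t ^+ 2)%:~R :> R.
Proof. by rewrite -[1]/(1%:~R) ler_int; lia. Qed.

(** At most [2 sqrt s + 1 <= 3 sqrt s] points per row and [4 sqrt s + 1 <= 5 sqrt s] rows, as
    [D >= 1]. *)
Lemma cnt_ndisc_le (u v s : R) : 1 <= s -> cnt R (ndisc u v s) <= 15 * s.
Proof.
move=> s1; have E : 4 * 1%:~R * n%:~R - t%:~R ^+ 2 = (4 * n - t ^+ 2)%:~R :> R.
  by apply: idisc_disc; ring.
apply: (le_trans (@cnt_disc_le R _ _ _ u v s _ _ _)).
- by rewrite ltr0z.
- by rewrite E ltr0z.
- by lra.
have sq : Num.sqrt s ^+ 2 = s by rewrite sqr_sqrtr //; lra.
have sq1 : 1 <= Num.sqrt s by rewrite -sqrtr1 ler_wsqrtr.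
have H : Num.sqrt (4 * 1%:~R * s / (4 * 1%:~R * n%:~R - t%:~R ^+ 2)) <= 2 * Num.sqrt s.
  rewrite E -[2]ger0_norm // -sqrtr_sqr -sqrtrM ?sqr_ge0 //.
  apply: ler_wsqrtr; rewrite ler_pdivrMr ?ltr0z // mulr1.
  have := D1R; nra.
rewrite divr1; have H0 := sqrtr_ge0 (4 * 1%:~R * s / (4 * 1%:~R * n%:~R - t%:~R ^+ 2)).
nra.
Qed.

(** The square [0 <= x, y <= h] with [h = sqrt (s / C)] lies inside the ellipse, since the norm
    there is at most [C h^2]; it holds at least [h^2] integer points. *)
Lemma cnt_ndisc_ge (s : R) : 0 <= s ->
  s / (1 + `|t| + n)%:~R <= cnt R (ndisc 0 0 s).
Proof.
move=> s0; set C := 1 + `|t| + n.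
have n0 : 0 < n by nia.
have C0 : 0 < (C%:~R : R) by rewrite ltr0z /C; lia.
set h := Num.sqrt (s / C%:~R).
have h0 : 0 <= h := sqrtr_ge0 _.
have h2 : h ^+ 2 = s / C%:~R by rewrite sqr_sqrtr // divr_ge0 // ltW.
pose k := Num.truncn h.
have /andP[k1 k2] : (k%:R <= h < k.+1%:R) by exact: truncn_itv.
pose f (p : nat * nat) : int * int := (p.1%:Z, p.2%:Z).
have fI : finite_set (`I_k.+1 `*` `I_k.+1) by exact: finite_setX.
have sub : f @` (`I_k.+1 `*` `I_k.+1) `<=` ndisc 0 0 s.
  move=> _ [[x y] [/= xk yk] <-]; apply/ndisc_nrm.
  have : (N (f (x, y))) <= C * k%:Z ^+ 2.
    have tx : t * x%:Z * y%:Z <= `|t| * k%:Z * k%:Z.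
      apply: (@le_trans _ _ (`|t| * x%:Z * y%:Z)).
        by rewrite -!mulrA ler_wpM2r // ler_norm.
      by rewrite -!mulrA ler_wpM2l //; nia.
    have xx : x%:Z ^+ 2 <= k%:Z ^+ 2 by rewrite ler_sqr ?nnegrE; lia.
    have yy : n * y%:Z ^+ 2 <= n * k%:Z ^+ 2 by rewrite ler_wpM2l ?ler_sqr ?nnegrE; lia.
    rewrite /nrm /f /= /C; lia.
  rewrite -(ler_int R) => /le_trans; apply.
  rewrite rmorphM rmorphXn /= -pmulrn.
  have -> : s = C%:~R * h ^+ 2 by rewrite h2 mulrC divfK // lt0r_neq0.
  rewrite ler_pM2l // ler_sqr ?nnegrE //.
apply: (le_trans _ (le_cnt R (finite_ndisc D0 0 0 s) sub)).
rewrite cnt_image //; last by move=> [x y] [x' y'] _ _ [-> ->].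
rewrite (@cnt_fibers R _ _ snd _ `I_k.+1) //; last by move=> p [].
have fib (y : nat) : y \in fset_set `I_k.+1 ->
    cnt R ((`I_k.+1 `*` `I_k.+1) `&` [set a | a.2 == y]) = k.+1%:R.
  rewrite in_fset_set // inE => yk; rewrite -(@cnt_In R k.+1).
  rewrite -(@cnt_image R _ _ (fun x => (x, y)) `I_k.+1) //.
    congr (cnt R _); apply/seteqP; split => [[x y'] [[/= xk _]] /= /eqP <-|]; first by exists x.
    by move=> _ [x xk <-]; split => /=.
  by move=> x x' _ _ [].
rewrite big_seq (eq_bigr (fun=> k.+1%:R : R)) => [|y yk]; last by rewrite fib.
rewrite -big_seq sum_cst_cnt cnt_In -h2.
nra.
Qed.

(** For [q <= s] the errors are absorbed in [s / q]: [15 + 16 + 4 = 35]. *)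
Lemma cnt_latt_le (q : nat) (r : int) (u v s : R) : (0 < q)%N -> is_root t n q r ->
  q%:R <= s -> cnt R (latt q r `&` ndisc u v s) <= 35 * (s / q%:R).
Proof.
move=> q0 qr qs.
have q1 : 1 <= (q%:R : R) by rewrite ler1n.
have s1 : 1 <= s / q%:R by rewrite ler_pdivlMr ?mul1r // ltr0n.
have s0 : 0 <= s by lra.
have q0R : 0 < (q%:R : R) by lra.
have /andP[_] : - (16 * Num.sqrt (s / q%:R) + 4) <=
    cnt R (latt q r `&` ndisc u v s) - cnt R (ndisc 0 0 s) / q%:R <=
    16 * Num.sqrt (s / q%:R) + 4 by rewrite -ler_norml; exact: cnt_latt.
have : cnt R (ndisc 0 0 s) / q%:R <= 15 * (s / q%:R).
  by rewrite mulrA ler_pM2r ?invr_gt0 // cnt_ndisc_le //; lra.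
have sq : Num.sqrt (s / q%:R) ^+ 2 = s / q%:R by rewrite sqr_sqrtr //; lra.
have sq1 : 1 <= Num.sqrt (s / q%:R) by rewrite -[leLHS]sqrtr1 ler_wsqrtr.
move: sq sq1; set X := Num.sqrt _ => <- X1; set c1 := cnt _ _ / _; set c2 := cnt _ _.
nra.
Qed.

(** The origin is left out: its norm 0 is divisible by every [q]. *)
Definition nzdisc (q : nat) (s : R) : set (int * int) :=
  [set a | [/\ 0 < N a, (N a)%:~R <= s & (q%:Z %| N a)%Z]].

Lemma nzdisc_sub q s : nzdisc q s `<=` ndisc 0 0 s.
Proof. by move=> a [_ H _]; apply/ndisc_nrm. Qed.

Lemma finite_nzdisc q s : finite_set (nzdisc q s).
Proof. by apply: sub_finite_set (finite_ndisc D0 0 0 s); exact: nzdisc_sub. Qed.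

Lemma cnt_nzdisc1 (q : nat) s : 0 <= s -> cnt R (nzdisc q s) <= 15 * s.
Proof.
move=> s0; have [s1|s1] := leP 1 s.
  apply: (le_trans _ (cnt_ndisc_le 0 0 s1)); apply: le_cnt (@nzdisc_sub q s).
  exact: finite_ndisc.
suff -> : nzdisc q s = set0 by rewrite cnt0 mulr_ge0.
apply/seteqP; split => // a [a0 H _].
have : (1%:~R : R) <= (N a)%:~R by rewrite ler_int; lia.
by rewrite -[1%:~R]/1; lra.
Qed.

Lemma nrm_scale (p : int) a : N (p * a.1, p * a.2) = p ^+ 2 * N a.
Proof. by rewrite /nrm /=; ring. Qed.

(** Induction in steps of two. Elements not divisible by [p] lie in one of the two lattices of roots
    modulo [p^k], with at most [35 s / p^k] elements each; the others are [p] times elements of norm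
    divisible by [p^(k-2)] and at most [s / p^2]. *)
Lemma cnt_nzdisc (p k : nat) s : prime p -> ~~ (p%:Z %| 4 * n - t ^+ 2)%Z -> 0 <= s ->
  cnt R (nzdisc (p ^ k) s) <= 70 * (k.+1%:R * (s / p%:R ^+ k)).
Proof.
move=> pp pD; have [m] := ubnP k; elim: m k s => // m IH [|k] s km s0.
  by apply: (le_trans (cnt_nzdisc1 _ s0)); rewrite expr0 divr1; lra.
have p2 : 2 <= (p%:R : R) by rewrite ler_nat prime_gt1.
have p0 : 0 < (p%:R : R) by lra.
have pk0 j : 0 < (p%:R : R) ^+ j by rewrite exprn_gt0.
have pkR : (p ^ k.+1)%N%:R = p%:R ^+ k.+1 :> R by rewrite natrX.
case: (ltP s (p%:R ^+ k.+1)) => sp.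
  suff -> : nzdisc (p ^ k.+1) s = set0.
    by rewrite cnt0 !mulr_ge0 ?invr_ge0 // ltW.
  apply/seteqP; split => // a [a0 H d].
  have : (p ^ k.+1)%N%:Z <= N a.
    have := @dvdn_leq (p ^ k.+1) (absz (N a)); rewrite dvdzE /= in d.
    by move=> /(_ _ d); lia.
  by rewrite -(ler_int R) -pmulrn pkR; lra.
pose S1 := (fun a : int * int => (p%:Z * a.1, p%:Z * a.2)) @` nzdisc (p ^ k.-1) (s / p%:R ^+ 2).
have fS1 : finite_set S1 by apply: finite_image; exact: finite_nzdisc.
(* For [k = 0] the truncated exponent [k.-1] is 0 and the plain bound [15 s / p^2] is used; the
   summand [*+ (k == 0)] makes room for it. *)
have cS1 : cnt R S1 <= 70 * (k%:R * (s / p%:R ^+ k.+1) + s / p%:R ^+ k.+1 *+ (k == 0)%N).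
  rewrite /S1 cnt_image; last 2 first.
  - exact: finite_nzdisc.
  - move=> [x y] [x' y'] _ _ /= [].
    have pz : p%:Z != 0 by have := prime_gt0 pp; lia.
    by move=> /(mulfI pz) -> /(mulfI pz) ->.
  have s20 : 0 <= s / p%:R ^+ 2 by rewrite divr_ge0 // ltW.
  case: k {S1 fS1} km sp pkR => [|k] km sp pkR.
    apply: (le_trans (cnt_nzdisc1 _ s20)).
    rewrite mul0r add0r expr1 /=.
    have : s / p%:R ^+ 2 <= s / p%:R.
      by rewrite ler_wpM2l // lef_pV2 ?posrE ?exprn_gt0 // expr2; nra.
    have : 0 <= s / p%:R by rewrite divr_ge0 // ltW.
    lra.
  apply: (le_trans (IH k _ _ s20)); first by lia.
  rewrite /= addr0 (_ : s / p%:R ^+ k.+2 = s / p%:R ^+ 2 / p%:R ^+ k) //.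
  by rewrite -mulrA -invfM -exprD add2n.
have inS1 a : nzdisc (p ^ k.+1) s a -> (p%:Z %| a.1)%Z && (p%:Z %| a.2)%Z -> S1 a.
  case: a => x y [a0 H d] /= /andP[/dvdzP[x' xE] /dvdzP[y' yE]].
  have pz : p%:Z != 0 by have := prime_gt0 pp; lia.
  have aE : (x, y) = (p%:Z * (x', y').1, p%:Z * (x', y').2).
    by rewrite /= xE yE ![_ * p%:Z]mulrC.
  rewrite aE nrm_scale in a0 H d; exists (x', y') => //.
  have p20 : 0 < p%:Z ^+ 2 by rewrite exprn_gt0 //; lia.
  split.
  - by rewrite pmulr_rgt0 in a0.
  - by rewrite ler_pdivlMr // mulrC; move: H; rewrite rmorphM rmorphXn.
  - case: (k) d => [|j] d; first by rewrite expn0 dvd1z.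
    rewrite natXz -(@dvdz_mul2l (p%:Z ^+ 2)) ?lt0r_neq0 // -exprD.
    by rewrite natXz in d.
case: (pselect (exists r0, is_root t n (p ^ k.+1) r0)) => [[r0 h0]|nr].
  have sub : nzdisc (p ^ k.+1) s `<=` S1 `|`
     ((latt (p ^ k.+1) r0 `&` ndisc 0 0 s) `|` (latt (p ^ k.+1) (t - r0) `&` ndisc 0 0 s)).
    move=> a aN; have nd := nzdisc_sub aN.
    have [pa|pa] := boolP ((p%:Z %| a.1)%Z && (p%:Z %| a.2)%Z); first by left; exact: inS1.
    right; case: aN => _ _ d.
    by case: (nrm_dvdz_cases pp pD (ltn0Sn k) h0 d pa); [left|right].
  have fL r : finite_set (latt (p ^ k.+1) r `&` ndisc 0 0 s).
    by apply: finite_setIr; exact: finite_ndisc.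
  have fLL : finite_set ((latt (p ^ k.+1) r0 `&` ndisc 0 0 s) `|` (latt (p ^ k.+1) (t - r0) `&` ndisc 0 0 s)) by rewrite finite_setU; split; exact: fL.
  apply: (le_trans (le_cnt R _ sub)); first by rewrite finite_setU.
  apply: (le_trans (cntU_le R fS1 fLL)).
  have := cntU_le R (fL r0) (fL (t - r0)).
  have pk : (0 < p ^ k.+1)%N by rewrite expn_gt0 prime_gt0.
  have ps : (p ^ k.+1)%N%:R <= s by rewrite pkR.
  have := cnt_latt_le 0 0 pk h0 ps; have := cnt_latt_le 0 0 pk (is_rootN h0) ps.
  rewrite pkR; move: cS1; set X := s / _.
  have X0 : 0 <= X by rewrite /X divr_ge0 // ltW.
  rewrite [k.+2%:R]mulrS [k.+1%:R]mulrS.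
  case: (k) => [|j]; rewrite /= ?mulr0n ?mulr1n ?addr0; lra.
apply: (@le_trans _ _ (cnt R S1)).
  apply: le_cnt => // a aN; apply: inS1 => //; apply: contra_notT nr => pa.
  case: aN => _ _ d.
  by have [r hr _] := nrm_dvdz_latt pp (ltn0Sn k) d pa; exists r.
apply: (le_trans cS1); set X := s / _.
have X0 : 0 <= X by rewrite /X divr_ge0 // ltW.
rewrite [k.+2%:R]mulrS [k.+1%:R]mulrS.
case: (k) => [|j]; rewrite /= ?mulr0n ?mulr1n ?addr0; lra.
Qed.
End Bounds.

(** * Elements congruent to 1 modulo [M] *)

Section Congruence.
Variables (R : realType) (t n : int) (M : nat).
Hypothesis D0 : 0 < 4 * n - t ^+ 2.
Hypothesis M1 : (1 < M)%N.
Hypothesis DM : (4 * n - t ^+ 2 %| M%:Z)%Z.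
Local Notation N := (nrm t n).
Local Notation ndisc := (@ndisc R t n).

(** The congruence makes every norm prime to [M], so the primes dividing the discriminant never
    occur in these norms; with [1 < M] it also keeps 0 out. *)
Definition cdisc (x : R) : set (int * int) :=
  [set a | [/\ (M%:Z %| a.1 - 1)%Z, (M%:Z %| a.2)%Z & (N a)%:~R <= x]].

Let M0R : 0 < (M%:R : R). Proof. by rewrite ltr0n; lia. Qed.

Lemma finite_cdisc x : finite_set (cdisc x).
Proof.
apply: sub_finite_set (finite_ndisc D0 0 0 x) => a [_ _ H].
exact/ndisc_nrm.
Qed.

Lemma cdisc_gt0 x a : cdisc x a -> 0 < N a.
Proof.
case: a => u v [/= + _ _]; rewrite nrm_gt0 //.
apply: contraTneq => -[-> _]; rewrite sub0r rpredN dvdz1 /=; lia.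
Qed.

Lemma cdisc_ndvd x a (p : nat) : prime p -> (p %| M)%N -> cdisc x a ->
  ~~ (p%:Z %| N a)%Z.
Proof.
case: a => u v pp pM [/= H1 H2 _].
have H : (p%:Z %| u - 1)%Z by apply: dvdz_trans H1; rewrite dvdzE.
have H' : (p%:Z %| v)%Z by apply: dvdz_trans H2; rewrite dvdzE.
apply/negP => H3.
have : (p%:Z %| N (u, v) - (u - 1) * (u + 1) - v * (t * u + n * v))%Z.
  by apply: dvdzB; [apply: dvdzB => //|]; exact: dvdz_mulr.
have -> : N (u, v) - (u - 1) * (u + 1) - v * (t * u + n * v) = 1.
  by rewrite /nrm /=; ring.
by rewrite dvdz1 /= => /eqP p1; rewrite p1 in pp.
Qed.

Lemma cnt_cdisc_latt_eq (q : nat) (r : int) (x : R) : (0 < q)%N -> coprime q M ->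
  exists u : R, cnt R (latt q r `&` cdisc x) =
                cnt R (latt q r `&` ndisc u 0 (x / M%:R ^+ 2)).
Proof.
move=> q0 qM.
have /coprimezP[[c d] /= cd] : coprimez q%:Z M%:Z by rewrite coprimezE.
(* [b] is divisible by [q] and is 1 modulo [M]. So the elements in question are the
   [(b + M u, M v)], such an element lies in the lattice exactly when [(u, v)] does, and the
   congruence becomes a shift of the centre by [b / M]. *)
pose b := c * q%:Z.
exists (b%:~R / M%:R).
rewrite -(@cnt_image R _ _ (fun p : int * int => (b + M%:Z * p.1, M%:Z * p.2))
  (latt q r `&` ndisc _ 0 _)).
- have disE (u v : int) : ndisc (b%:~R / M%:R) 0 (x / M%:R ^+ 2) (u, v) <->
      (N (b + M%:Z * u, M%:Z * v))%:~R <= x.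
    rewrite /ndisc /idisc /disc /nrm /= ler_pdivlMr ?exprn_gt0 //.
    rewrite !(rmorphXn, rmorphD, rmorphM, rmorphN) /= -!pmulrn.
    by split; apply: le_trans; rewrite le_eqVlt; apply/orP; left; apply/eqP;
      field; exact: lt0r_neq0.
  congr (cnt R _); apply/seteqP; split => [[y z] [/= L [/= H1 /dvdzP[v vE] H]]|].
    have /dvdzP[u uE] : (M%:Z %| y - b)%Z.
      have -> : y - b = (y - 1) + d * M%:Z by rewrite /b -cd; ring.
      by apply: dvdzD => //; exact: dvdz_mull.
    have yE : y = b + M%:Z * u by rewrite mulrC -uE; ring.
    exists (u, v); last by rewrite /= yE vE [v * _]mulrC.
    split; last by apply/disE; rewrite -yE [_ * v]mulrC -vE.
    rewrite /latt /= in L *.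
    have cM : coprimez q%:Z M%:Z by rewrite coprimezE.
    rewrite -(Gauss_dvdzr _ cM).
    have -> : M%:Z * (u + r * v) = (y + r * z) - c * q%:Z by rewrite yE vE /b; ring.
    by apply: dvdzB => //; exact: dvdz_mull.
  move=> _ [[u v] [/= L /disE H] <-]; split.
    rewrite /latt /= in L *.
    have -> : b + M%:Z * u + r * (M%:Z * v) = c * q%:Z + M%:Z * (u + r * v) by rewrite /b; ring.
    by apply: dvdzD; exact: dvdz_mull.
  split => //=; last exact: dvdz_mulr.
  have -> : b + M%:Z * u - 1 = M%:Z * (u - d) by rewrite /b -cd; ring.
  exact: dvdz_mulr.
- by apply: finite_setIr; exact: finite_ndisc.
- have MZ : M%:Z != 0 by lia.
  by move=> [y z] [y' z'] _ _ /= [/addrI /(mulfI MZ) -> /(mulfI MZ) ->].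
Qed.

Lemma cnt_cdisc_latt0 (q : nat) (r : int) (x : R) : (0 < q)%N -> coprime q M ->
  is_root t n q r -> 0 <= x ->
  `|cnt R (latt q r `&` cdisc x) - cnt R (ndisc 0 0 (x / M%:R ^+ 2)) / q%:R|
    <= 16 * Num.sqrt (x / q%:R) + 4.
Proof.
move=> q0 qM qr x0; have [u ->] := cnt_cdisc_latt_eq r x q0 qM.
have M1R : 1 <= (M%:R : R) ^+ 2 by rewrite exprn_ege1 // ler1n; lia.
apply: (le_trans (@cnt_latt R t n D0 q r _ _ _ q0 qr _)).
  by rewrite divr_ge0 // ltW // exprn_gt0.
rewrite lerD2r ler_pM2l // ler_wsqrtr // ler_wpM2r ?invr_ge0 //.
by rewrite ler_pdivrMr ?exprn_gt0 // ler_peMr.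
Qed.

Lemma cdisc_latt1 x : latt 1 0 `&` cdisc x = cdisc x.
Proof. by apply/seteqP; split => [a [_ //]|a H]; split => //; exact: dvd1z. Qed.

Lemma cnt_cdisc0 (x : R) : 0 <= x ->
  `|cnt R (cdisc x) - cnt R (ndisc 0 0 (x / M%:R ^+ 2))| <= 16 * Num.sqrt x + 4.
Proof.
move=> x0; have := @cnt_cdisc_latt0 1 0 x (ltn0Sn 0) (coprime1n _) _ x0.
by rewrite cdisc_latt1 !divr1; apply; exact: dvd1z.
Qed.

Lemma cnt_cdisc_le (x : R) : 0 <= x -> cnt R (cdisc x) <= 15 * x.
Proof.
move=> x0; apply: (le_trans _ (@cnt_nzdisc1 R t n D0 1 x x0)).
apply: le_cnt; first exact: finite_nzdisc.
move=> a Xa; split; [exact: cdisc_gt0 Xa|by case: Xa|exact: dvd1z].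
Qed.

Lemma cnt_cdisc_ge : exists c : R, exists x0 : R, 0 < c /\
  forall x, x0 <= x -> c * x <= cnt R (cdisc x).
Proof.
have n0 : 0 < n by nia.
have C0 : 0 < ((1 + `|t| + n)%:~R : R) by rewrite ltr0z; lia.
set K : R := (1 + `|t| + n)%:~R * M%:R ^+ 2.
have K0 : 0 < K by rewrite mulr_gt0 // exprn_gt0.
(* The threshold forces [sqrt x >= 40 K], so the error [16 sqrt x + 4 <= 20 sqrt x] takes at most
   half of the main term [x / K]. *)
exists (K^-1 / 2), (1 + (40 * K) ^+ 2); split; first by rewrite divr_gt0 ?invr_gt0.
move=> x xx; have x1 : 1 <= x by have := sqr_ge0 (40 * K); lra.
have x0 : 0 <= x by lra.
have := cnt_cdisc0 x0; rewrite ler_norml => /andP[+ _].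
have := @cnt_ndisc_ge R t n D0 (x / M%:R ^+ 2).
have -> : x / M%:R ^+ 2 / (1 + `|t| + n)%:~R = x * K^-1.
  rewrite /K; move: ((1 + `|t| + n)%:~R : R) (lt0r_neq0 C0) => C C0n.
  by field; rewrite C0n lt0r_neq0.
move=> /(_ (divr_ge0 x0 (ltW (exprn_gt0 _ M0R)))).
have sq : Num.sqrt x ^+ 2 = x by rewrite sqr_sqrtr.
have sq1 : 1 <= Num.sqrt x by rewrite -[leLHS]sqrtr1 ler_wsqrtr.
have sqK : 40 * K <= Num.sqrt x.
  have -> : 40 * K = Num.sqrt ((40 * K) ^+ 2) by rewrite sqrtr_sqr ger0_norm //; lra.
  by apply: ler_wsqrtr; lra.
have : 40 * Num.sqrt x <= x * K^-1.
  rewrite ler_pdivlMr // -{2}sq; nra.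
set A := cnt _ _; set B := cnt _ _; lra.
Qed.

Section OnePrime.
Variables (p : nat).
Hypothesis (pp : prime p) (pM : ~~ (p %| M)%N).

Let p0R : 0 < (p%:R : R). Proof. by rewrite ltr0n prime_gt0. Qed.
Let pM' : coprime p M. Proof. by rewrite prime_coprime. Qed.
Let pD : ~~ (p%:Z %| 4 * n - t ^+ 2)%Z.
Proof. by apply: contra pM => H; have := dvdz_trans H DM; rewrite dvdzE. Qed.

Lemma cnt_cdisc_pow (k : nat) (x : R) : 0 <= x ->
  cnt R (cdisc x `&` [set a | ((p ^ k)%N%:Z %| N a)%Z]) <= 70 * (k.+1%:R * (x / p%:R ^+ k)).
Proof.
move=> x0; apply: (le_trans _ (cnt_nzdisc D0 k pp pD x0)).
apply: le_cnt; first exact: finite_nzdisc.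
by move=> a [Xa H]; split => //; [exact: cdisc_gt0 Xa|case: Xa].
Qed.

Lemma cnt_cdisc_scale (x : R) : 0 <= x ->
  cnt R (cdisc x `&` [set a | ((p%:Z %| a.1) && (p%:Z %| a.2))%Z]) <= 15 * (x / p%:R ^+ 2).
Proof.
move=> x0; have x20 : 0 <= x / p%:R ^+ 2 by rewrite divr_ge0 // ltW // exprn_gt0.
apply: (le_trans _ (@cnt_nzdisc1 R t n D0 1 _ x20)).
have pz : p%:Z != 0 by have := prime_gt0 pp; lia.
have p20 : 0 < p%:Z ^+ 2 by rewrite exprn_gt0 //; have := prime_gt0 pp; lia.
rewrite -(@cnt_image R _ _ (fun a : int * int => (p%:Z * a.1, p%:Z * a.2)) (nzdisc _ _ _ _)).
- apply: le_cnt; first by apply: finite_image; exact: finite_nzdisc.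
  move=> [u v] [Xa /= /andP[/dvdzP[u' uE] /dvdzP[v' vE]]].
  have aE : (u, v) = (p%:Z * (u', v').1, p%:Z * (u', v').2).
    by rewrite /= uE vE ![_ * p%:Z]mulrC.
  have := cdisc_gt0 Xa; case: Xa => _ _; rewrite aE nrm_scale => H H'.
  exists (u', v') => //; split; last exact: dvd1z.
    by rewrite pmulr_rgt0 in H'.
  by rewrite ler_pdivlMr ?exprn_gt0 // mulrC; move: H; rewrite rmorphM rmorphXn.
- exact: finite_nzdisc.
- by move=> [y z] [y' z'] _ _ /= [/(mulfI pz) -> /(mulfI pz) ->].
Qed.

(** Without a root modulo [p], a norm divisible by [p] comes only from multiples of [p]. *)
Lemma cnt_cdisc_inert (x : R) : 0 <= x -> (forall r, ~ is_root t n p r) ->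
  cnt R (cdisc x `&` [set a | (p%:Z %| N a)%Z]) <= 15 * (x / p%:R ^+ 2).
Proof.
move=> x0 nr; apply: (le_trans _ (cnt_cdisc_scale x0)).
apply: le_cnt; first by apply: finite_setIl; exact: finite_cdisc.
move=> a [Xa /= d]; split => //=; apply: contra_notT (nr 0) => pa.
have [|r] := @nrm_dvdz_latt t n p 1 a pp isT _ pa; first by rewrite expn1.
by rewrite expn1 => /nr.
Qed.

(** Inclusion-exclusion over the two ideals above [p], whose intersection consists of multiples of
    [p]. For each ideal, the lattice count and the return from [ndisc] to [cdisc] as reference cost
    [20 sqrt (x / p)] apiece. *)
Lemma cnt_cdisc_split (x : R) (r : int) : is_root t n p r -> p%:R <= x ->
  `|cnt R (cdisc x `&` [set a | (p%:Z %| N a)%Z]) - 2 * cnt R (cdisc x) / p%:R|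
  <= 80 * Num.sqrt (x / p%:R) + 15 * (x / p%:R ^+ 2).
Proof.
move=> hr px.
have p1 : 1 <= (p%:R : R) by rewrite ler1n prime_gt0.
have x0 : 0 <= x by lra.
have fX := finite_cdisc x.
have root1 : is_root t n (p ^ 1) r by rewrite expn1.
have -> : cdisc x `&` [set a | (p%:Z %| N a)%Z] =
   (latt p r `&` cdisc x) `|` (latt p (t - r) `&` cdisc x).
  apply/seteqP; split => [a [Xa /= d]|a]; last first.
    case=> -[L Xa]; split => //=; first exact: dvdz_nrm_latt L.
    by apply: dvdz_nrm_latt L; exact: is_rootN.
  have [pa|pa] := boolP ((p%:Z %| a.1)%Z && (p%:Z %| a.2)%Z).
    left; split => //; move/andP: pa => [p1' p2'].
    by rewrite /latt /=; apply: dvdzD => //; exact: dvdz_mull.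
  have := @nrm_dvdz_cases t n p 1 a r pp pD isT; rewrite expn1 => /(_ hr d pa).
  by case; [left|right].
have fL r' : finite_set (latt p r' `&` cdisc x) by exact: finite_setIr.
have I : cnt R ((latt p r `&` cdisc x) `&` (latt p (t - r) `&` cdisc x)) <= 15 * (x / p%:R ^+ 2).
  apply: (le_trans _ (cnt_cdisc_scale x0)); apply: le_cnt; first exact: finite_setIl.
  move=> [u v] [[/= L1 Xa] [L2 _]]; split => //=; rewrite /latt /= in L1 L2.
  have pv : (p%:Z %| v)%Z.
    have /orP[//|H] : (p%:Z %| v)%Z || (p%:Z %| 2 * r - t)%Z.
      by rewrite -prime_dvdzM //; have := dvdzB L1 L2; congr (_ %| _)%Z; ring.
    case/negP: pD.
    have -> : 4 * n - t ^+ 2 = 4 * (r ^+ 2 - t * r + n) - (2 * r - t) * (2 * r - t) by ring.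
    by apply: dvdzB; [exact: dvdz_mull|exact: dvdz_mulr].
  rewrite pv andbT; have := dvdzB L1 (dvdz_mull r pv).
  by congr (_ %| _)%Z; ring.
have I0 := @cnt_ge0 R _ ((latt p r `&` cdisc x) `&` (latt p (t - r) `&` cdisc x)).
have UI := cntUI R (fL r) (fL (t - r)).
have A := cnt_cdisc_latt0 (prime_gt0 pp) pM' hr x0.
have B := cnt_cdisc_latt0 (prime_gt0 pp) pM' (is_rootN hr) x0.
have G := cnt_cdisc0 x0.
have y1 : 1 <= x / p%:R by rewrite ler_pdivlMr ?mul1r.
have sq1 : 1 <= Num.sqrt (x / p%:R) by rewrite -[leLHS]sqrtr1 ler_wsqrtr.
have G' : `|cnt R (cdisc x) / p%:R - cnt R (ndisc 0 0 (x / M%:R ^+ 2)) / p%:R| <=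
   20 * Num.sqrt (x / p%:R).
  rewrite -mulrBl normrM (ger0_norm (_ : 0 <= p%:R^-1)) ?invr_ge0 // ler_pdivrMr //.
  apply: (le_trans G).
  have sx : Num.sqrt x <= Num.sqrt (x / p%:R) * p%:R.
    rewrite -{2}[p%:R]ger0_norm ?ler0n // -sqrtr_sqr -sqrtrM ?divr_ge0 // ler_wsqrtr //.
    by rewrite expr2 mulrA divfK ?lt0r_neq0 // ler_peMr.
  nra.
have -> : 2 * cnt R (cdisc x) / p%:R = 2 * (cnt R (cdisc x) / p%:R) by rewrite mulrA.
rewrite !ler_norml in A B G' *.
move/andP: A => [A1 A2]; move/andP: B => [B1 B2]; move/andP: G' => [G1 G2].
by apply/andP; split; lra.
Qed.

End OnePrime.
End Congruence.

(** * Sums over primes *)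

Section PrimeSums.
Variable R : realType.

Lemma ln_nat_logn (m x : nat) : (0 < m <= x)%N ->
  ln (m%:R : R) = \sum_(0 <= p < x.+1 | prime p) (logn p m)%:R * ln p%:R.
Proof.
move=> /andP[m0 mx]; rewrite -{1}(partnT m0) (widen_partn _ mx) natr_prod.
have H s : ln (\prod_(p <- s) ((p ^ logn p m)%N%:R : R)) =
           \sum_(p <- s | prime p) (logn p m)%:R * ln p%:R.
  elim: s => [|p s IH]; first by rewrite !big_nil ln1.
  have P0 q : 0 < ((q ^ logn q m)%N%:R : R).
    rewrite ltr0n; case: (boolP (prime q)) => [/prime_gt0 q0|/negbTE q0].
      by rewrite expn_gt0 q0.
    by rewrite lognE q0 expn0.
  rewrite !big_cons lnM ?posrE //; last by apply: prodr_gt0.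
  rewrite IH; case: (boolP (prime p)) => pp.
    by rewrite natrX lnXn ?ltr0n ?prime_gt0 // mulr_natl.
  by rewrite lognE (negbTE pp) expn0 ln1 add0r.
exact: H.
Qed.

Lemma ln_nat_ge0 (m : nat) : 0 <= ln (m%:R : R).
Proof.
by case: m => [|m]; [rewrite ln0|rewrite ln_ge0 // ler1n].
Qed.

(** Such a prime divides [(2n)!] but not [n!]. *)
Lemma logn_bin_ge1 (n p : nat) : prime p -> (n < p <= n.*2)%N ->
  (0 < logn p 'C(n.*2, n))%N.
Proof.
move=> pp /andP[np p2n].
have n2 : (n <= n.*2)%N by lia.
have b0 : (0 < 'C(n.*2, n))%N by rewrite bin_gt0.
have nf0 : logn p n`! = 0%N.
  rewrite logn_fact // big1_seq // => k; rewrite mem_index_iota => /andP[_ /andP[k1 _]].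
  rewrite divn_small // (leq_trans np) // -[leqLHS]expn1 leq_exp2l //.
  exact: prime_gt1.
have := congr1 (logn p) (bin_fact n2).
have -> : (n.*2 - n = n)%N by lia.
rewrite !lognM ?fact_gt0 ?muln_gt0 ?fact_gt0 // nf0 !addn0 => ->.
by rewrite logn_gt0 mem_primes pp fact_gt0 dvdn_fact // prime_gt0.
Qed.

Lemma bin_le_exp2 (m k : nat) : ('C(m, k) <= 2 ^ m)%N.
Proof.
have [km|km] := leqP k m; last by rewrite bin_small.
have -> : (2 = 1 + 1)%N by []. rewrite expnDn.
rewrite (bigD1 (Ordinal (km : (k < m.+1)%N))) //= !exp1n !muln1.
exact: leq_addr.
Qed.

Lemma chebyshev_dyadic (n : nat) :
  \sum_(n.+1 <= p < n.*2.+1 | prime p) ln (p%:R : R) <= n.*2%:R * ln 2.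
Proof.
set C := 'C(n.*2, n).
have C0 : (0 < C)%N by rewrite bin_gt0; lia.
apply: (@le_trans _ _ (ln (C%:R : R))); last first.
  rewrite mulr_natl -lnXn // -natrX ler_ln ?posrE ?ltr0n ?expn_gt0 //.
  by rewrite ler_nat bin_le_exp2.
rewrite (@ln_nat_logn C (maxn C n.*2)); last by rewrite C0 leq_maxl.
have n1 : (n.+1 <= (maxn C n.*2).+1)%N by lia.
rewrite [leRHS](big_cat_nat (n := n.+1)) //=; apply: ler_wpDl.
  by apply: sumr_ge0 => p _; rewrite mulr_ge0 // ln_nat_ge0.
rewrite [leRHS](big_cat_nat (n := n.*2.+1)) //=; [|lia|lia].
apply: ler_wpDr.
  by apply: sumr_ge0 => p _; rewrite mulr_ge0 // ln_nat_ge0.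
rewrite big_nat_cond [leRHS]big_nat_cond; apply: ler_sum => p /andP[np pp].
rewrite ler_peMl ?ln_nat_ge0 // ler1n logn_bin_ge1 //; lia.
Qed.

Lemma ln2_le1 : ln (2 : R) <= 1.
Proof. by have := @le_ln1Dx R 1; rewrite -[1 + 1]/(2 : R); apply; lra. Qed.

(** The dyadic block above [2^j] contributes at most [2 sqrt (2^j)] by Chebyshev's bound. The
    induction closes with the constant 6 because [6 sqrt 2 >= 6 + 2], that is [sqrt 2 >= 4/3]. *)
Lemma sum_ln_div_sqrt_pow2 (j : nat) :
  \sum_(1 <= p < (2 ^ j).+1 | prime p) ln (p%:R : R) / Num.sqrt p%:R <=
  6 * Num.sqrt (2 ^+ j).
Proof.
elim: j => [|j IH].
  rewrite expn0 big_mkcond /= big_nat1 /=; by rewrite mulr_ge0 // sqrtr_ge0.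
have j0 : (0 < 2 ^ j)%N by rewrite expn_gt0.
rewrite (big_cat_nat (n := (2 ^ j).+1)) //=; last by rewrite ltnS leq_exp2l.
have q0 : 0 < Num.sqrt (2 ^+ j : R) by rewrite sqrtr_gt0 exprn_gt0.
have q2 : Num.sqrt (2 ^+ j : R) ^+ 2 = 2 ^+ j by rewrite sqr_sqrtr // exprn_ge0.
have H : \sum_((2 ^ j).+1 <= p < (2 ^ j.+1).+1 | prime p) ln (p%:R : R) / Num.sqrt p%:R <=
    2 * Num.sqrt (2 ^+ j).
  apply: (@le_trans _ _ ((\sum_((2 ^ j).+1 <= p < (2 ^ j.+1).+1 | prime p) ln (p%:R : R))
      / Num.sqrt (2 ^+ j))).
    rewrite mulr_suml big_nat_cond [leRHS]big_nat_cond; apply: ler_sum => p /andP[np pp].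
    rewrite ler_wpM2l ?ln_nat_ge0 // lef_pV2 ?posrE // ?sqrtr_gt0 ?ltr0n ?prime_gt0 //.
    by rewrite ler_wsqrtr // -natrX ler_nat; lia.
  rewrite ler_pdivrMr // -mulrA -expr2 q2.
  have := chebyshev_dyadic (2 ^ j); rewrite -mul2n -expnS natrX exprS.
  move/le_trans; apply; rewrite -[leRHS]mulr1 ler_wpM2l ?ln2_le1 //.
apply: (le_trans (lerD IH H)).
rewrite exprS sqrtrM //.
have s2 : Num.sqrt (2 : R) ^+ 2 = 2 by rewrite sqr_sqrtr.
have s20 := sqrtr_ge0 (2 : R).
have : 4 / 3 <= Num.sqrt (2 : R) by nra.
nra.
Qed.

(** The total weight of the errors [sqrt (x / p)] in the ideal counts; it has to be [O(x)], the size
    of the count of elements itself. *)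
Lemma sum_ln_sqrt (x : nat) : (0 < x)%N ->
  \sum_(1 <= p < x.+1 | prime p) ln (p%:R : R) * Num.sqrt (x%:R / p%:R) <= 12 * x%:R.
Proof.
move=> x0; have /= /andP[k1 k2] := @trunc_log_bounds 2 x isT x0.
set k := trunc_log 2 x in k1 k2.
have xR : 0 < (x%:R : R) by rewrite ltr0n.
have q2 : Num.sqrt (x%:R : R) ^+ 2 = x%:R by rewrite sqr_sqrtr.
have q0 := sqrtr_ge0 (x%:R : R).
apply: (@le_trans _ _ (Num.sqrt x%:R * (6 * Num.sqrt (2 ^+ k.+1)))).
  apply: (@le_trans _ _ (Num.sqrt x%:R * \sum_(1 <= p < x.+1 | prime p) ln (p%:R : R) / Num.sqrt p%:R)).
    rewrite mulr_sumr; apply: ler_sum => p pp.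
    by rewrite sqrtrM // sqrtrV // mulrCA.
  rewrite ler_wpM2l //; apply: (le_trans _ (sum_ln_div_sqrt_pow2 k.+1)).
  rewrite [leRHS](big_cat_nat (n := x.+1)) //=; last by lia.
  by rewrite lerDl; apply: sumr_ge0 => p _; rewrite mulr_ge0 ?ln_nat_ge0 // invr_ge0 sqrtr_ge0.
have H : Num.sqrt (2 ^+ k.+1 : R) <= 2 * Num.sqrt x%:R.
  have e2 : 2 = Num.sqrt (2 ^+ 2) :> R by rewrite sqrtr_sqr ger0_norm.
  rewrite [X in _ <= X * _]e2.
  rewrite -sqrtrM ?exprn_ge0 // ler_wsqrtr // exprS.
  have : 2 ^+ k <= (x%:R : R) by rewrite -natrX ler_nat.
  nra.
nra.
Qed.

Lemma ln_le_sqrt (y : R) : 0 < y -> ln y <= 2 * Num.sqrt y.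
Proof.
move=> y0; have q0 : 0 < Num.sqrt y by rewrite sqrtr_gt0.
rewrite -{1}(sqr_sqrtr (ltW y0)) lnXn // mulr_natl lerMn2r /=.
exact: ltW (ln_sublinear q0).
Qed.

(** As [ln m <= 2 sqrt m], the terms with [m >= 2] are at most [2 / m^(3/2)], which is dominated by
    the telescoping difference [4 / sqrt (m - 1) - 4 / sqrt m]. *)
Lemma sum_ln_div_sqr (x : nat) : \sum_(1 <= m < x.+1) ln (m%:R : R) / m%:R ^+ 2 <= 4.
Proof.
case: x => [|x]; first by rewrite big_geq.
suff H : \sum_(1 <= m < x.+2) ln (m%:R : R) / m%:R ^+ 2 <= 4 - 4 / Num.sqrt x.+1%:R.
  have : 0 <= 4 / Num.sqrt (x.+1%:R : R) by rewrite divr_ge0 // sqrtr_ge0.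
  lra.
elim: x => [|x IH]; first by rewrite big_nat1 ln1 mul0r sqrtr1 divr1 subrr.
rewrite big_nat_recr //=; apply: (le_trans (lerD IH (lexx _))).
set a : R := Num.sqrt x.+1%:R; set b : R := Num.sqrt x.+2%:R.
have a0 : 0 < a by rewrite sqrtr_gt0.
have b0 : 0 < b by rewrite sqrtr_gt0.
have a2 : a ^+ 2 = x.+1%:R by rewrite sqr_sqrtr.
have b2 : b ^+ 2 = x.+2%:R by rewrite sqr_sqrtr.
have ab : (b - a) * (a + b) = 1.
  have -> : (b - a) * (a + b) = b ^+ 2 - a ^+ 2 by ring.
  by rewrite a2 b2 -natrB // subSnn.
have ab' : 0 < b - a by rewrite -(pmulr_lgt0 _ (_ : 0 < a + b)) ?ab //; lra.
have L : ln (x.+2%:R : R) <= 2 * b by exact: ln_le_sqrt.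
have T : ln (x.+2%:R : R) / x.+2%:R ^+ 2 <= 2 / b ^+ 3.
  rewrite -b2 ler_pdivrMr ?exprn_gt0 //.
  have -> : 2 / b ^+ 3 * (b ^+ 2) ^+ 2 = 2 * b by field; exact: lt0r_neq0.
  by rewrite b2.
suff K : 2 / b ^+ 3 <= 4 / a - 4 / b by move: T K; set c := ln _ / _; lra.
rewrite -subr_ge0.
have -> : 4 / a - 4 / b - 2 / b ^+ 3 = (4 * b ^+ 2 * (b - a) - 2 * a) / (a * b ^+ 3).
  by field; rewrite !lt0r_neq0.
apply: divr_ge0; last by rewrite mulr_ge0 ?exprn_ge0 // ltW.
have : (4 * b ^+ 2 * (b - a) - 2 * a) * (a + b) = 4 * b ^+ 2 - 2 * a * (a + b).
  have -> : (4 * b ^+ 2 * (b - a) - 2 * a) * (a + b) =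
     4 * b ^+ 2 * ((b - a) * (a + b)) - 2 * a * (a + b) by ring.
  by rewrite ab mulr1.
have : 0 <= 4 * b ^+ 2 - 2 * a * (a + b) by nra.
by move=> h e; rewrite -e pmulr_lge0 // in h; lra.
Qed.

End PrimeSums.

(** * Mertens' theorem for the primes that split *)

Section Mertens.
Variables (R : realType) (t n : int) (M : nat).
Hypothesis D0 : 0 < 4 * n - t ^+ 2.
Hypothesis M1 : (1 < M)%N.
Hypothesis DM : (4 * n - t ^+ 2 %| M%:Z)%Z.
Local Notation N := (nrm t n).
Local Notation CX x := (@cdisc R t n M x).

(** Also true at the primes dividing the discriminant, finitely many, which only affect the
    [O(1)]. *)
Definition splitp (p : nat) : bool := `[< exists r, is_root t n p r >].

Let c (x : R) (p k : nat) : R := cnt R (CX x `&` [set a | ((p ^ k)%N%:Z %| N a)%Z]).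

Let fX x : finite_set (CX x). Proof. exact: finite_cdisc. Qed.

Lemma logn_sum_dvd (p m x : nat) : prime p -> (0 < m <= x)%N ->
  logn p m = (\sum_(1 <= k < x.+1) (p ^ k %| m))%N.
Proof.
move=> pp /andP[m0 mx]; rewrite logn_count_dvd //.
rewrite [RHS](big_cat_nat (n := m)) //=; last by lia.
rewrite [X in (_ = _ + X)%N]big_nat_cond [X in (_ = _ + X)%N]big1 ?addn0 // => k /andP[/andP[mk _] _].
rewrite gtnNdvd // (leq_ltn_trans mk) // ltn_expl // prime_gt1 //.
Qed.

Let XN (x : nat) a : CX x%:R a -> (0 < absz (N a) <= x)%N /\ (absz (N a))%:Z = N a.
Proof.
move=> Xa; have a0 := cdisc_gt0 D0 M1 DM Xa; case: Xa => _ _ ax.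
have : N a <= x%:Z by rewrite -(ler_int R) -pmulrn.
lia.
Qed.

(** Chebyshev's double counting, with the product of all norms in place of a factorial. *)
Lemma sum_ln_nrm (x : nat) :
  \sum_(a <- fset_set (CX x%:R)) ln ((N a)%:~R : R) =
  \sum_(1 <= p < x.+1 | prime p) ln p%:R * \sum_(1 <= k < x.+1) c x%:R p k.
Proof.
transitivity (\sum_(a <- fset_set (CX x%:R)) \sum_(1 <= p < x.+1 | prime p)
   \sum_(1 <= k < x.+1) ln (p%:R : R) * ((p ^ k)%N%:Z %| N a)%Z%:R).
  rewrite big_seq [RHS]big_seq; apply: eq_bigr => a; rewrite in_fset_set // inE => Xa.
  have [ax aE] := XN Xa.
  rewrite -{1}aE -pmulrn (ln_nat_logn _ ax).
  rewrite big_ltn_cond //= -/(index_iota _ _).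
  apply: eq_bigr => p pp; rewrite (logn_sum_dvd pp ax) natr_sum mulr_suml.
  by apply: eq_bigr => k _; rewrite mulrC dvdzE.
rewrite exchange_big /=; apply: eq_bigr => p pp.
rewrite exchange_big /= mulr_sumr; apply: eq_bigr => k _.
by rewrite /c cnt_cond // mulr_sumr.
Qed.

(** [ln (x / N)] is at most the number of [j] with [2^j N <= x], because [ln 2 <= 1]. After
    exchanging the sums the counts are at most [15 x / 2^j], with total at most [30 x]. *)
Lemma sum_ln_ratio (x : nat) : (0 < x)%N ->
  \sum_(a <- fset_set (CX x%:R)) (ln (x%:R : R) - ln ((N a)%:~R : R)) <= 30 * x%:R.
Proof.
move=> x0; have x0R : 0 < (x%:R : R) by rewrite ltr0n.
have l20 : 0 <= ln (2 : R) by exact: (ln_nat_ge0 R 2).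
apply: (@le_trans _ _ (\sum_(a <- fset_set (CX x%:R))
   \sum_(0 <= j < x) ((absz (N a) * 2 ^ j <= x)%N%:R : R))).
  rewrite big_seq [leRHS]big_seq; apply: ler_sum => a; rewrite in_fset_set // inE => Xa.
  have [/andP[a0 ax] aE] := XN Xa.
  set m := absz (N a) in a0 ax *.
  have m0R : 0 < (m%:R : R) by rewrite ltr0n.
  have -> : (N a)%:~R = m%:R :> R by rewrite pmulrn aE.
  have q0 : (0 < x %/ m)%N by rewrite divn_gt0.
  have /= /andP[J1 J2] := @trunc_log_bounds 2 _ isT q0.
  set J := trunc_log 2 (x %/ m) in J1 J2.
  have Jx : (J < x)%N.
    rewrite (leq_trans _ (leq_div x m)) // (leq_trans _ J1) // ltn_expl //.
  apply: (@le_trans _ _ J.+1%:R).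
    rewrite -ln_div ?posrE //.
    apply: (@le_trans _ _ (ln (2 ^+ J.+1 : R))).
      rewrite ler_ln ?posrE ?divr_gt0 ?exprn_gt0 // ler_pdivrMr // -natrX -natrM ler_nat.
      by move: J2; rewrite ltn_divLR // mulnC => /ltnW; rewrite mulnC.
    rewrite lnXn // -[leRHS]mulr1 mulr_natl lerMn2r /=; exact: ln2_le1.
  rewrite (big_cat_nat (n := J.+1)) //=; apply: ler_wpDr.
    by apply: sumr_ge0 => j _; exact: ler0n.
  rewrite big_nat (eq_bigr (fun=> 1 : R)).
    by rewrite -big_nat sumr_const_nat subn0.
  move=> j /andP[_ jJ]; suff -> : (m * 2 ^ j <= x)%N by [].
  rewrite mulnC -leq_divRL //; apply: (leq_trans _ J1).
  by rewrite leq_exp2l.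
rewrite exchange_big /=.
apply: (@le_trans _ _ (\sum_(0 <= j < x) 15 * (x%:R * (1 / 2) ^+ j))).
  apply: ler_sum => j _; rewrite -(@cnt_cond R _ _ (fun a => (absz (N a) * 2 ^ j <= x)%N)) //.
  have y0 : 0 <= (x%:R : R) * (1 / 2) ^+ j by rewrite mulr_ge0 // exprn_ge0.
  apply: (le_trans _ (cnt_cdisc_le D0 M1 DM y0)); apply: le_cnt => //.
  move=> a [Xa /= H]; have [_ aE] := XN Xa; case: Xa => ? ? _; split => //.
  rewrite -aE -pmulrn expr_div_n expr1n mulrA mulr1 ler_pdivlMr ?exprn_gt0 //.
  by rewrite -natrX -natrM ler_nat.
rewrite -!mulr_sumr.
have G : \sum_(0 <= j < x) (1 / 2 : R) ^+ j <= 2.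
  suff : \sum_(0 <= j < x) (1 / 2 : R) ^+ j = 2 - 2 * (1 / 2) ^+ x.
    move=> ->; have : 0 <= (1 / 2 : R) ^+ x by rewrite exprn_ge0.
    lra.
  elim: (x) => [|y IH]; first by rewrite big_geq // expr0; lra.
  by rewrite big_nat_recr //= IH exprS; lra.
nra.
Qed.

Lemma sum_pow_tail (p x : nat) : (1 < p)%N ->
  \sum_(2 <= k < x.+1) k.+1%:R / (p%:R : R) ^+ k <= 12 / p%:R ^+ 2.
Proof.
move=> p1; have p2 : 2 <= (p%:R : R) by rewrite ler_nat.
have p0 : 0 < (p%:R : R) by lra.
(* The ratio of consecutive terms is [(k + 4) / ((k + 3) p) <= 2/3 < 3/4]; the geometric series has
   sum 4, whence [12 = 3 * 4]. *)
have H k : k.+3%:R / (p%:R : R) ^+ k.+2 <= 3 / p%:R ^+ 2 * (3 / 4) ^+ k.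
  elim: k => [|k IH]; first by rewrite expr0 mulr1.
  rewrite [X in _ <= _ * X]exprS mulrCA.
  apply: (@le_trans _ _ (3 / 4 * (k.+3%:R / p%:R ^+ k.+2))); last by rewrite ler_pM2l.
  rewrite [p%:R ^+ k.+3]exprS invfM mulrA mulrA ler_pM2r ?invr_gt0 ?exprn_gt0 //.
  rewrite ler_pdivrMr //.
  have : k.+4%:R = k.+3%:R + 1 :> R by rewrite -natr1.
  have : 3 <= k.+3%:R :> R by rewrite ler_nat.
  set u : R := k.+3%:R; nra.
have G y : \sum_(0 <= k < y) (3 / 4 : R) ^+ k = 4 - 4 * (3 / 4) ^+ y.
  elim: y => [|y IH]; first by rewrite big_geq // expr0; lra.
  by rewrite big_nat_recr //= IH exprS; lra.
have q0 : 0 <= 3 / (p%:R : R) ^+ 2 by rewrite divr_ge0 // exprn_ge0 // ltW.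
case: x => [|x]; first by rewrite big_geq // divr_ge0 // exprn_ge0 // ltW.
rewrite -(addn2 0%N) -[x.+2]addn2 big_addn addnK.
apply: (@le_trans _ _ (\sum_(0 <= k < x) 3 / (p%:R : R) ^+ 2 * (3 / 4) ^+ k)).
  by apply: ler_sum => k _; rewrite addn2; exact: H.
rewrite -mulr_sumr G.
have : 0 <= (3 / 4 : R) ^+ x by rewrite exprn_ge0.
have -> : 12 / (p%:R : R) ^+ 2 = 3 / p%:R ^+ 2 * 4 by rewrite mulrAC; congr (_ / _); lra.
set w := _ ^+ x; nra.
Qed.

Let S (x : nat) : R := 
  \sum_(1 <= p < x.+1 | prime p) (splitp p && ~~ (p %| M)%N)%:R * (ln p%:R / p%:R).

Lemma prime_term_bound (x p : nat) : (0 < x)%N -> prime p -> (p <= x)%N ->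
  `|\sum_(1 <= k < x.+1) c x%:R p k
    - 2 * cnt R (CX x%:R) / p%:R * (splitp p && ~~ (p %| M)%N)%:R|
  <= 80 * Num.sqrt (x%:R / p%:R) + 900 * (x%:R / p%:R ^+ 2).
Proof.
move=> x0 pp px; have xR : 0 <= (x%:R : R) by [].
have p0 : 0 < (p%:R : R) by rewrite ltr0n prime_gt0.
have B0 : 0 <= (x%:R : R) / p%:R ^+ 2 by rewrite divr_ge0 // exprn_ge0 // ltW.
have B1 := sqrtr_ge0 ((x%:R : R) / p%:R).
have [pM|pM] := boolP (p %| M)%N.
  rewrite andbF mulr0 subr0 big_nat_cond big1 ?normr0; first by lra.
  move=> k /andP[/andP[k1 _] _]; rewrite /c (_ : _ `&` _ = set0) ?cnt0 //.
  apply/seteqP; split => // a [Xa /= d].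
  by have := cdisc_ndvd pp pM Xa; rewrite (dvdz_prime_pow k1 d).
rewrite andbT big_ltn //; set T := \sum_(2 <= k < _) _.
have T0 : 0 <= T by apply: sumr_ge0 => k _; exact: cnt_ge0.
(* Higher powers: [840 = 70 * 12]; with the [15] from [k = 1] the total stays below 900. *)
have T1 : T <= 840 * (x%:R / p%:R ^+ 2).
  apply: (@le_trans _ _ (\sum_(2 <= k < x.+1) 70 * x%:R * (k.+1%:R / (p%:R : R) ^+ k))).
    apply: ler_sum => k _; apply: (le_trans (cnt_cdisc_pow D0 M1 DM pp pM k xR)).
    by rewrite le_eqVlt; apply/orP; left; apply/eqP; ring.
  rewrite -mulr_sumr; have := sum_pow_tail x (prime_gt1 pp).
  rewrite -(ler_pM2l (_ : 0 < 70 * x%:R)) ?mulr_gt0 ?ltr0n // => /le_trans; apply.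
  by rewrite le_eqVlt; apply/orP; left; apply/eqP; ring.
have c1E : c x%:R p 1 = cnt R (CX x%:R `&` [set a | (p%:Z %| N a)%Z]) by rewrite /c expn1.
have [/asboolP[r hr]|/asboolP nr] := boolP (splitp p).
  have : `|c x%:R p 1 - 2 * cnt R (CX x%:R) / p%:R|
     <= 80 * Num.sqrt (x%:R / p%:R) + 15 * (x%:R / p%:R ^+ 2).
    by rewrite c1E; apply: (cnt_cdisc_split D0 M1 DM pp pM hr); rewrite ler_nat.
  rewrite mulr1 !ler_norml => /andP[H1 H2].
  set U := 2 * _ / _ in H1 H2 *; set V := x%:R / p%:R ^+ 2 in T1 H1 H2 B0 *.
  by apply/andP; split; lra.
have : c x%:R p 1 <= 15 * (x%:R / p%:R ^+ 2).
  rewrite c1E; apply: (cnt_cdisc_inert D0 M1 DM pp pM) => // r hr.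
  by apply: nr; exists r.
have : 0 <= c x%:R p 1 by exact: cnt_ge0.
rewrite mulr0 subr0 => H1 H2; rewrite ger0_norm; last by rewrite addr_ge0.
set V := x%:R / p%:R ^+ 2 in T1 H1 H2 B0 *; lra.
Qed.

(** [4560 = 80 * 12 + 900 * 4], from [sum_ln_sqrt] and [sum_ln_div_sqr]. *)
Lemma sum_ln_nrm_approx (x : nat) : (0 < x)%N ->
  `|\sum_(a <- fset_set (CX x%:R)) ln ((N a)%:~R : R) - 2 * cnt R (CX x%:R) * S x|
  <= 4560 * x%:R.
Proof.
move=> x0; rewrite sum_ln_nrm /S mulr_sumr -sumrB.
apply: (le_trans (ler_norm_sum _ _ _)).
apply: (@le_trans _ _ (\sum_(1 <= p < x.+1 | prime p)
   (80 * (ln p%:R * Num.sqrt (x%:R / p%:R)) + 900 * x%:R * (ln p%:R / p%:R ^+ 2)))).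
  rewrite big_nat_cond [leRHS]big_nat_cond; apply: ler_sum => p /andP[/andP[p1 px] pp].
  have L0 := ln_nat_ge0 R p.
  have -> : ln p%:R * (\sum_(1 <= k < x.+1) c x%:R p k) -
      2 * cnt R (CX x%:R) * ((splitp p && ~~ (p %| M)%N)%:R * (ln p%:R / p%:R)) =
      ln p%:R * (\sum_(1 <= k < x.+1) c x%:R p k
    - 2 * cnt R (CX x%:R) / p%:R * (splitp p && ~~ (p %| M)%N)%:R) by ring.
  rewrite normrM ger0_norm //.
  have := prime_term_bound x0 pp px.
  move=> /(ler_wpM2l L0) /le_trans; apply.
  by rewrite le_eqVlt; apply/orP; left; apply/eqP; ring.
rewrite big_split /= -!mulr_sumr.
have H1 := sum_ln_sqrt R x0.
have H2 : \sum_(1 <= p < x.+1 | prime p) ln (p%:R : R) / p%:R ^+ 2 <= 4.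
  apply: (le_trans _ (sum_ln_div_sqr R x)); rewrite big_mkcond /=; apply: ler_sum => p _.
  by case: ifP => // _; rewrite divr_ge0 ?ln_nat_ge0 // exprn_ge0.
have xR : 0 <= (x%:R : R) by [].
have := ler_wpM2l xR H2; lra.
Qed.

(** With [G] the count of elements, the two evaluations give [|2 G S - G ln x| <= (4560 + 30) x];
    the lower bound [G >= c0 x] then permits division by [G]. *)
Lemma mertens_good : exists B : R, exists x0 : nat, forall x : nat, (x0 <= x)%N ->
  `|S x - 2^-1 * ln x%:R| <= B.
Proof.
have [c0 [x0 [c00 H]]] := cnt_cdisc_ge R D0 M1 DM.
exists (4590 / c0), (Num.truncn x0).+1 => x xx.
have x1 : (0 < x)%N by lia.
have x0R : x0 <= x%:R.
  by apply: (le_trans (ltW (truncnS_gt x0))); rewrite ler_nat.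
have G := H _ x0R.
have A := sum_ln_nrm_approx x1.
have E := sum_ln_ratio x1.
have E0 : 0 <= \sum_(a <- fset_set (CX x%:R)) (ln (x%:R : R) - ln ((N a)%:~R : R)).
  rewrite big_seq; apply: sumr_ge0 => a; rewrite in_fset_set // inE => Xa.
  have [/andP[a0 ax] <-] := XN Xa.
  by rewrite subr_ge0 -pmulrn ler_ln ?posrE ?ltr0n // ler_nat.
rewrite sumrB sum_cst_cnt in E E0.
move: A E E0 G; set Sg := \sum_(a <- _) _; set G := cnt _ _.
set L := ln _; set s := S x; rewrite !ler_norml => /andP[A1 A2] E E0 HG.
have xR : 0 < (x%:R : R) by rewrite ltr0n.
have G0 : 0 < G by apply: lt_le_trans HG; rewrite mulr_gt0.
have KG : 4590 * x%:R <= 4590 / c0 * G.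
  rewrite mulrAC ler_pdivlMr //; nra.
move: (4590 / c0) KG => K KG.
have H1 : G * - K <= G * (s - 2^-1 * L) by clear -A2 E KG xR; lra.
have H2 : G * (s - 2^-1 * L) <= G * K by clear -A1 E0 KG xR; lra.
by rewrite !(ler_pM2l G0) in H1 H2; rewrite H1 H2.
Qed.

End Mertens.

(** The bound is independent of [x]: altering the condition at finitely many primes costs [O(1)] in
    a Mertens sum. *)
Lemma sum_eventually_eq (R : realType) (F : nat -> R) (P Q : pred nat) (K x : nat) :
  (forall p, 0 <= F p) -> (forall p, prime p -> (K <= p)%N -> P p = Q p) ->
  `|\sum_(1 <= p < x.+1 | prime p) (P p)%:R * F p - \sum_(1 <= p < x.+1 | prime p) (Q p)%:R * F p|
   <= \sum_(1 <= p < K.+1) F p.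
Proof.
move=> F0 PQ; rewrite -sumrB; apply: (le_trans (ler_norm_sum _ _ _)).
apply: (@le_trans _ _ (\sum_(1 <= p < x.+1) (p <= K)%N%:R * F p)).
  rewrite big_mkcond /=; apply: ler_sum => p _; case: ifP => pp; last by rewrite mulr_ge0.
  case: (leqP p K) => pK; last by rewrite PQ ?subrr ?normr0 ?mul0r // ltnW.
  case: (P p) (Q p) => -[]; rewrite ?mul1r ?mul0r ?subrr ?subr0 ?sub0r ?normrN ?normr0 //;
    by rewrite ger0_norm.
have [xK|Kx] := leqP x K.
  rewrite [leRHS](big_cat_nat (n := x.+1)) //=; apply: ler_wpDr; first exact: sumr_ge0.
  by apply: ler_sum => p _; case: (p <= K)%N; rewrite ?mul1r ?mul0r.
rewrite (big_cat_nat (n := K.+1)) //=; last by lia.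
rewrite [X in _ + X]big_nat_cond [X in _ + X]big1 ?addr0.
  by apply: ler_sum => p _; case: (p <= K)%N; rewrite ?mul1r ?mul0r.
by move=> p /andP[/andP[Kp _] _]; rewrite leqNgt Kp mul0r.
Qed.

Theorem mertens_split (R : realType) (t n : int) : 0 < 4 * n - t ^+ 2 ->
  exists B : R, forall x : nat, (0 < x)%N ->
  `|\sum_(1 <= p < x.+1 | prime p) (splitp t n p)%:R * (ln p%:R / p%:R) - 2^-1 * ln x%:R| <= B.
Proof.
move=> D0; pose M := (2 * absz (4 * n - t ^+ 2)%R)%N.
have M1 : (1 < M)%N by rewrite /M; lia.
have DM : (4 * n - t ^+ 2 %| M%:Z)%Z by rewrite dvdzE /M dvdn_mull.
have [B [x0 H]] := @mertens_good R t n M D0 M1 DM.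
pose F (p : nat) : R := ln p%:R / p%:R.
have F0 p : 0 <= F p by rewrite divr_ge0 // ln_nat_ge0.
(* Covers [x < x0], where the sum and the logarithm are each bounded by their value at the
   threshold. *)
pose C := \sum_(1 <= p < x0.+1) F p + ln x0.+1%:R.
have C0 : 0 <= C by rewrite addr_ge0 ?ln_nat_ge0 // sumr_ge0.
exists (`|B| + C + \sum_(1 <= p < M.+2) F p) => x x1.
have Q : forall p, prime p -> (M.+1 <= p)%N ->
    (splitp t n p && ~~ (p %| M)%N) = splitp t n p.
  move=> p pp Mp; rewrite (_ : (p %| M)%N = false) ?andbT //.
  by apply/negbTE; rewrite gtnNdvd //; lia.
have T := sum_eventually_eq x F0 Q.
suff U : `|\sum_(1 <= p < x.+1 | prime p) (splitp t n p && ~~ (p %| M)%N)%:R * F p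
    - 2^-1 * ln x%:R| <= `|B| + C.
  move: U T; rewrite /F; move: C {C0} => C.
  set a := \sum_(_ <= _ < _ | _) _; set b := \sum_(_ <= _ < _ | _) _.
  set d := \sum_(_ <= _ < _) _; rewrite !ler_norml.
  by move=> /andP[? ?] /andP[? ?]; apply/andP; split; lra.
have [xx|xx] := leqP x0 x.
  by apply: (le_trans (H x xx)); have := ler_norm B; lra.
have L0 := ln_nat_ge0 R x.
have L1 : ln (x%:R : R) <= ln x0.+1%:R by rewrite ler_ln ?posrE ?ltr0n // ler_nat; lia.
have S0 : 0 <= \sum_(1 <= p < x.+1 | prime p) (splitp t n p && ~~ (p %| M)%N)%:R * F p.
  by apply: sumr_ge0 => p _; rewrite mulr_ge0.
have S1 : \sum_(1 <= p < x.+1 | prime p) (splitp t n p && ~~ (p %| M)%N)%:R * F p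
   <= \sum_(1 <= p < x0.+1) F p.
  rewrite [leRHS](big_cat_nat (n := x.+1)) //=; last by lia.
  apply: ler_wpDr; first exact: sumr_ge0.
  rewrite big_mkcond /=; apply: ler_sum => p _; case: ifP => // _.
  by case: (_ && _); rewrite ?mul1r ?mul0r.
have := normr_ge0 B; have := ln_nat_ge0 R x0.+1.
have : 0 <= \sum_(1 <= p < x0.+1) F p by exact: sumr_ge0.
rewrite /C ler_norml; move: S0 S1; set s := \sum_(_ <= _ < _ | _) _; set s' := \sum_(_ <= _ < _) _.
set l := ln _ in L0 L1 *; set l' := ln _ in L1 *.
by move=> ? ? ? ? ?; apply/andP; split; lra.
Qed.

(** * Mertens' lower bound over all primes and the existence of inert primes *)

Section Inert.
Variable R : realType.

Lemma ln_succ_sub_le (m : nat) : (0 < m)%N ->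
  ln (m.+1%:R : R) - ln m%:R <= m%:R^-1.
Proof.
move=> m0; have mR : 0 < (m%:R : R) by rewrite ltr0n.
rewrite -ln_div ?posrE ?ltr0n //.
have -> : m.+1%:R / m%:R = 1 + m%:R^-1 :> R by rewrite -natr1; field; exact: lt0r_neq0.
have i0 : 0 < (m%:R : R)^-1 by rewrite invr_gt0.
by apply: le_ln1Dx; lra.
Qed.

Lemma ln_fact_ge (m : nat) : m%:R * ln m%:R - m%:R <= ln (m`!%:R : R).
Proof.
elim: m => [|m IH]; first by rewrite mul0r fact0 ln1 subr0.
rewrite factS natrM lnM ?posrE ?ltr0n ?fact_gt0 //.
case: m IH => [|m] IH; first by rewrite fact0 !ln1 mulr0; lra.
have := ln_succ_sub_le (ltn0Sn m).
have m0 : 0 < (m.+1%:R : R) by rewrite ltr0n.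
rewrite -(ler_pM2l m0) mulfV ?lt0r_neq0 // mulrBr => H.
have -> : m.+2%:R = m.+1%:R + 1 :> R by rewrite -natr1.
have E : m.+2%:R = m.+1%:R + 1 :> R by rewrite -natr1.
rewrite E in H; move: H IH; set a : R := m.+1%:R; set l := ln a; set l' := ln (a + 1).
set f := ln _; lra.
Qed.

(** Double counting of [ln x!]: for each [p] the powers beyond the first contribute at most
    [12 x ln p / p^2], in total [12 * 4 x = 48 x], and Stirling's lower bound costs another [x]. *)
Lemma mertens_lower (x : nat) : (0 < x)%N ->
  ln (x%:R : R) - 49 <= \sum_(1 <= p < x.+1 | prime p) ln p%:R / p%:R.
Proof.
move=> x0; have xR : 0 < (x%:R : R) by rewrite ltr0n.
have bx : (0 < x`! <= x`!)%N by rewrite fact_gt0 leqnn.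
have E : ln (x`!%:R : R) =
   \sum_(1 <= p < x.+1 | prime p) (logn p x`!)%:R * ln p%:R.
  rewrite (ln_nat_logn _ bx) big_ltn_cond //=.
  have xf : (x <= x`!)%N by case: (x) => // y; rewrite factS leq_pmulr // fact_gt0.
  rewrite (big_cat_nat (n := x.+1)) //= [X in _ + X]big_nat_cond [X in _ + X]big1 ?addr0 //.
  move=> p /andP[/andP[xp _] pp]; rewrite logn_fact // big1_seq ?mul0r // => k.
  rewrite mem_index_iota => /andP[_ /andP[k1 _]].
  by rewrite divn_small // (leq_trans xp) // -[leqLHS]expn1 leq_exp2l // prime_gt1.
have H : ln (x`!%:R : R) <= x%:R * (\sum_(1 <= p < x.+1 | prime p) ln p%:R / p%:R + 48).
  rewrite E; apply: (@le_trans _ _ (\sum_(1 <= p < x.+1 | prime p)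
     (x%:R * (ln p%:R / p%:R) + x%:R * 12 * (ln p%:R / p%:R ^+ 2)))).
    apply: ler_sum => p pp; rewrite mulrC.
    have p0 : 0 < (p%:R : R) by rewrite ltr0n prime_gt0.
    have -> : x%:R * (ln p%:R / p%:R) + x%:R * 12 * (ln p%:R / p%:R ^+ 2) =
       ln p%:R * (x%:R / p%:R + x%:R * (12 / p%:R ^+ 2)) :> R by ring.
    rewrite ler_wpM2l ?ln_nat_ge0 // logn_fact // natr_sum.
    have D k : (x %/ p ^ k)%N%:R <= x%:R / p%:R ^+ k :> R.
      rewrite ler_pdivlMr ?exprn_gt0 // -natrX -natrM ler_nat; exact: leq_trunc_div.
    rewrite big_ltn //; apply: lerD; first by have := D 1%N; rewrite expr1.
    apply: (@le_trans _ _ (\sum_(2 <= k < x.+1) x%:R * (k.+1%:R / (p%:R : R) ^+ k))).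
      apply: ler_sum => k _; apply: (le_trans (D k)); rewrite ler_pM2l //.
      by rewrite ler_peMl ?invr_ge0 ?exprn_ge0 ?ler1n // ltW.
    by rewrite -mulr_sumr ler_pM2l // sum_pow_tail // prime_gt1.
  rewrite big_split /= -!mulr_sumr.
  have h4 : \sum_(1 <= p < x.+1 | prime p) ln (p%:R : R) / p%:R ^+ 2 <= 4.
    apply: (le_trans _ (sum_ln_div_sqr R x)); rewrite big_mkcond /=; apply: ler_sum => p _.
    by case: ifP => // _; rewrite divr_ge0 ?ln_nat_ge0 // exprn_ge0.
  have := ler_wpM2l (ltW xR) h4; lra.
have := le_trans (ln_fact_ge x) H.
by move=> h; rewrite -(ler_pM2l xR); move: h; set s := \sum_(_ <= _ < _ | _) _; lra.
Qed.

(** If every large prime had a root, the split sum would be the full Mertens sum up to [O(1)], and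
    [ln x <= (1/2) ln x + O(1)] would bound [ln x]. *)
Lemma inert_infinite (t n : int) (K : nat) : 0 < 4 * n - t ^+ 2 ->
  exists p : nat, [/\ prime p, (K < p)%N & forall r, ~ is_root t n p r].
Proof.
move=> D0; apply: contrapT => no.
have [B H] := mertens_split R D0.
have PQ : forall p, prime p -> (K.+1 <= p)%N -> splitp t n p = predT p.
  move=> p pp Kp; apply/asboolP; apply: contrapT => nr; apply: no.
  by exists p; split => // r hr; apply: nr; exists r.
have F0 p : 0 <= ln (p%:R : R) / p%:R by rewrite divr_ge0 // ln_nat_ge0.
pose C := \sum_(1 <= p < K.+2) ln (p%:R : R) / p%:R.
have bnd x : (0 < x)%N -> ln (x%:R : R) <= 2 * (49 + B + C).
  move=> x0; have := sum_eventually_eq x F0 PQ; have := H x x0.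
  have := mertens_lower x0; rewrite -/C.
  have -> : \sum_(1 <= p < x.+1 | prime p) (predT p)%:R * (ln (p%:R : R) / p%:R) =
    \sum_(1 <= p < x.+1 | prime p) ln (p%:R : R) / p%:R.
    by apply: eq_bigr => p _; rewrite mul1r.
  set s := \sum_(_ <= _ < _ | _) (_ / _); set s' := \sum_(_ <= _ < _ | _) _; set l := ln _.
  by rewrite !ler_norml => h /andP[h1 h2] /andP[h3 h4]; lra.
set Z := 2 * _ in bnd.
have := bnd (Num.truncn (expR Z)).+1 isT.
rewrite leNgt => /negP; apply.
by rewrite -{1}(expRK Z) ltr_ln ?posrE ?expR_gt0 ?ltr0n // truncnS_gt.
Qed.

End Inert.

(** * Partial summation *)

Section AbelSummation.
Variables (R : realType) (c : nat -> R) (B : R).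
Let rho (x : nat) := \sum_(1 <= m < x.+1) c m - 2^-1 * ln x%:R.
Hypothesis cB : forall x, (0 < x)%N -> `|rho x| <= B.
(** The sum starts at 3 so that every [ln m] is at least 1. *)
Let T (x : nat) := \sum_(3 <= m < x.+1) c m / ln m%:R.
(** The quotient [rho x / ln x] is the boundary term of partial summation; once it is removed, the
    increments are dominated by differences of [1 / ln x], which telescope. *)
Let V (x : nat) := T x - 2^-1 * ln (ln x%:R) - rho x / ln x%:R.

Lemma ln_ge1 (x : nat) : (3 <= x)%N -> 1 <= ln (x%:R : R).
Proof.
move=> x3; apply: (@le_trans _ _ (ln (3 : R))); last first.
  by rewrite ler_ln ?posrE ?ltr0n ?ler_nat //; lia.
rewrite -{1}(expRK 1) ler_ln ?posrE ?expR_gt0 //.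
(* e < 3, since e^-1 >= (1 - 1/16)^16 > 1/3 *)
have H : (1 - 1 / 16 : R) ^+ 16 <= expR (-1).
  have -> : -1 = 16%:R * (- (1 / 16)) :> R by field.
  rewrite expRM_natl; apply: lerXn2r; rewrite ?nnegrE ?expR_ge0 //; first by lra.
  exact: expR_ge1Dx.
have : (3 : R)^-1 <= expR (-1) by apply: le_trans H; lra.
by rewrite expRN lef_pV2 ?posrE ?expR_gt0.
Qed.

Lemma abel_step (x : nat) : (3 <= x)%N ->
  `|V x.+1 - V x| <= (2^-1 + B) * ((ln x%:R)^-1 - (ln x.+1%:R)^-1).
Proof.
move=> x3; have L1 := ln_ge1 x3; have L1' := ln_ge1 (leqW x3).
have x0 : (0 < x)%N by lia.
have xR : 1 <= (x%:R : R) by rewrite ler1n.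
have LL := ln_succ_sub_le R x0.
have LL0 : ln (x%:R : R) <= ln x.+1%:R by rewrite ler_ln ?posrE ?ltr0n // ler_nat.
have LL1 : ln (x.+1%:R : R) - ln x%:R <= 1 by apply: (le_trans LL); rewrite invf_le1 //; lra.
have TE : T x.+1 = T x + c x.+1 / ln x.+1%:R by rewrite /T big_nat_recr //; lia.
have cE : c x.+1 = 2^-1 * (ln x.+1%:R - ln x%:R) + (rho x.+1 - rho x).
  by rewrite /rho [X in X - 2^-1 * _]big_nat_recr //=; set l := ln _; ring.
have rB := cB x0; move: rB.
rewrite /V TE cE; set r' := rho x.+1; set r := rho x.
move: L1 L1' LL0 LL1; set L := ln (x%:R : R); set L' := ln (x.+1%:R : R) => L1 L1' LL0 LL1.
have L0 : 0 < L by lra.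
have L0' : 0 < L' by lra.
move=> rB.
have d0 : 0 <= L^-1 - L'^-1 by rewrite subr_ge0 lef_pV2 ?posrE.
(* The first part is [1 - w + ln w] with [w = L / L'], of second order in [1 - w]; the identity [q]
   and [L' - L <= 1] bring it below [1 / L - 1 / L']. *)
have -> : T x + (2^-1 * (L' - L) + (r' - r)) / L' - 2^-1 * ln L' - r' / L' -
   (T x - 2^-1 * ln L - r / L) =
   2^-1 * (1 - L / L' + ln (L / L')) + r * (L^-1 - L'^-1).
  rewrite ln_div ?posrE //; field; by rewrite !lt0r_neq0.
apply: (le_trans (ler_normD _ _)); rewrite [leRHS]mulrDl; apply: lerD; last first.
  by rewrite normrM (ger0_norm d0) ler_wpM2r.
rewrite normrM ger0_norm // ler_pM2l //.
have w0 : 0 < L / L' by rewrite divr_gt0.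
have up : ln (L / L') <= L / L' - 1.
  have -> : L / L' = 1 + (L / L' - 1) by ring.
  by apply: (le_trans (le_ln1Dx _)); lra.
have lo : 1 - L' / L <= ln (L / L').
  have -> : L / L' = (L' / L)^-1 by rewrite invf_div.
  rewrite lnV ?posrE ?divr_gt0 //.
  have e : L' / L = 1 + (L' / L - 1) by ring.
  have := @le_ln1Dx R (L' / L - 1); rewrite -e => H.
  have : 0 < L' / L by rewrite divr_gt0.
  lra.
have q : L' / L + L / L' - 2 = (L' - L) * (L^-1 - L'^-1).
  by field; rewrite !lt0r_neq0.
have q1 : (L' - L) * (L^-1 - L'^-1) <= L^-1 - L'^-1 by rewrite ler_piMl.
rewrite ler0_norm; lra.
Qed.

Lemma abel_summation : exists kappa B' : R, forall x, (3 <= x)%N ->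
  `|T x - 2^-1 * ln (ln x%:R) - kappa| <= B' / ln x%:R.
Proof.
have B0 : 0 <= B by apply: le_trans (cB (ltn0Sn 0)).
pose K := 2^-1 + B; have K0 : 0 <= K by rewrite addr_ge0.
(* Adding or subtracting [K / ln] makes [u] decrease and [v] increase; [kappa] is the supremum of
   [v], caught between them. The shift by 3 stays in the range of [ln_ge1]. *)
pose u (x : nat) := V (x + 3) + K / ln (x + 3)%:R.
pose v (x : nat) := V (x + 3) - K / ln (x + 3)%:R.
have st x : u x.+1 <= u x /\ v x <= v x.+1.
  have := @abel_step (x + 3) (leq_addl _ _); rewrite ler_norml -/K -addSn /u /v.
  by move=> /andP[]; rewrite mulrBr; set a := K / _; set b := K / _; split; lra.
have ud x k : u (x + k)%N <= u x.
  elim: k => [|k IH]; first by rewrite addn0.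
  by rewrite addnS (le_trans _ IH) //; case: (st (x + k)%N).
have vd x k : v x <= v (x + k)%N.
  elim: k => [|k IH]; first by rewrite addn0.
  by rewrite addnS (le_trans IH) //; case: (st (x + k)%N).
have vu x : v x <= u x.
  have : 0 <= K / ln (x + 3)%:R by rewrite divr_ge0 // ln_nat_ge0.
  by rewrite /u /v; set a := K / _; lra.
have vum x y : v x <= u y.
  apply: (le_trans (vd x y)); apply: (le_trans (vu _)).
  by rewrite addnC; exact: ud.
pose A := range v.
have A0 : A !=set0 by exists (v 0%N), 0%N.
have Aub y : ubound A (u y) by move=> _ [x _ <-]; exact: vum.
exists (sup A), (K + B) => x x3.
have k1 : v (x - 3)%N <= sup A by apply: ub_le_sup; [exists (u 0%N)|exists (x - 3)%N].
have k2 : sup A <= u (x - 3)%N by apply: ge_sup.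
rewrite /u /v subnK // /V in k1 k2.
have L1 := ln_ge1 x3.
have rB : `|rho x / ln x%:R| <= B / ln x%:R.
  have i0 : 0 < (ln (x%:R : R))^-1 by rewrite invr_gt0; lra.
  by rewrite normrM (ger0_norm (ltW i0)) ler_pM2r // cB //; lia.
move: rB; rewrite !ler_norml [(K + B) / _]mulrDl => /andP[r1 r2].
move: k1 k2 r1 r2; set a := rho x / _; set b := B / _; set d := K / _ => *.
by apply/andP; split; lra.
Qed.

End AbelSummation.

(** * From the sum over primes to the product *)

Section Product.
Variables (R : realType) (S : pred nat) (B : R).
Hypothesis SB : forall x : nat, (0 < x)%N ->
  `|\sum_(1 <= p < x.+1 | prime p) (S p)%:R * (ln p%:R / p%:R) - 2^-1 * ln x%:R| <= B.

(** With [- ln (1 - 1 / p)] in place of [1 / p], the sum of [c m / ln m] is exactly minus the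
    logarithm of the product, while the change from [ln p / p] is summable. *)
Let c (p : nat) : R := if prime p && ((5 <= p)%N && S p) then - ln (1 - p%:R^-1) * ln p%:R else 0.

Lemma ln_inv_bounds (p : nat) : (2 <= p)%N ->
  p%:R^-1 <= - ln (1 - p%:R^-1 : R) <= p%:R^-1 + 2 / p%:R ^+ 2.
Proof.
move=> p2; have pR : 2 <= (p%:R : R) by rewrite ler_nat.
have p0 : 0 < (p%:R : R) by lra.
have i0 : 0 < (p%:R : R)^-1 by rewrite invr_gt0.
have i1 : (p%:R : R)^-1 <= 2^-1 by rewrite lef_pV2 ?posrE.
apply/andP; split.
  by have := @le_ln1Dx R (- p%:R^-1); lra.
rewrite -lnV ?posrE; last by lra.
have -> : (1 - p%:R^-1)^-1 = 1 + (p%:R - 1)^-1 :> R.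
  by field; apply/andP; split; rewrite lt0r_neq0 //; lra.
have q0 : 0 < ((p%:R : R) - 1)^-1 by rewrite invr_gt0; lra.
apply: (le_trans (le_ln1Dx _)); first by lra.
rewrite -subr_ge0.
have -> : p%:R^-1 + 2 / p%:R ^+ 2 - (p%:R - 1)^-1 = (p%:R - 2) / (p%:R ^+ 2 * (p%:R - 1)) :> R.
  by field; apply/andP; split; rewrite lt0r_neq0 //; lra.
by rewrite divr_ge0 ?mulr_ge0 ?exprn_ge0 //; lra.
Qed.

Lemma sum_c_bound : exists B1 : R, forall x : nat, (0 < x)%N ->
  `|\sum_(1 <= m < x.+1) c m - 2^-1 * ln x%:R| <= B1.
Proof.
pose F (p : nat) : R := ln p%:R / p%:R.
have F0 p : 0 <= F p by rewrite divr_ge0 // ln_nat_ge0.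
(* The middle term pays for the primes below 5, and [8 = 2 * 4] for passing from [1 / p] to
   [- ln (1 - 1 / p)]. *)
exists (B + \sum_(1 <= p < 6) F p + 8) => x x0.
have P : forall p, prime p -> (5 <= p)%N -> (5 <= p)%N && S p = S p by move=> p _ ->.
have := sum_eventually_eq x F0 P; have := SB x0.
have : 0 <= \sum_(1 <= m < x.+1) c m -
    \sum_(1 <= p < x.+1 | prime p) ((5 <= p)%N && S p)%:R * F p <= 8.
  rewrite [X in _ - X]big_mkcond -sumrB /=.
  have E m : 0 <= c m - (if prime m then ((5 <= m)%N && S m)%:R * F m else 0)
     <= 2 * (ln m%:R / m%:R ^+ 2).
    have l0 := ln_nat_ge0 R m.
    have b0 : 0 <= 2 * (ln (m%:R : R) / m%:R ^+ 2) by rewrite mulr_ge0 // divr_ge0 // exprn_ge0.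
    rewrite /c; case: (boolP (prime m)) => pm /=; last by rewrite subrr lexx.
    case: (boolP ((5 <= m)%N && S m)) => _; last by rewrite mul0r subrr lexx.
    have /andP[h1 h2] := ln_inv_bounds (prime_gt1 pm).
    move: (ler_wpM2r l0 h1) (ler_wpM2r l0 h2); rewrite /F mulrDl mul1r.
    rewrite [p in p <= _]mulrC mulrAC; set a := - ln _ * _; set b := ln _ / _.
    rewrite [_^-1 * _]mulrC -/b -[2 * _ / _]mulrA.
    by move=> ? ?; apply/andP; split; lra.
  apply/andP; split; first by apply: sumr_ge0 => m _; case/andP: (E m).
  apply: (@le_trans _ _ (\sum_(1 <= m < x.+1) 2 * (ln (m%:R : R) / m%:R ^+ 2))).
    by apply: ler_sum => m _; case/andP: (E m).
  rewrite -mulr_sumr; have := sum_ln_div_sqr R x; lra.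
rewrite -/(F _); set s1 := \sum_(_ <= _ < _) c _.
set s2 := \sum_(_ <= _ < _ | _) _; set s3 := \sum_(_ <= _ < _ | _) _.
set l := ln _; set f := \sum_(_ <= _ < _) _; rewrite !ler_norml.
by move=> /andP[? ?] /andP[? ?] /andP[? ?]; apply/andP; split; lra.
Qed.

Lemma prod_exp (x : nat) :
  \prod_(5 <= p < x.+1 | prime p && S p) (1 - p%:R^-1 : R) =
  expR (- \sum_(3 <= m < x.+1) c m / ln m%:R).
Proof.
have E5 : \sum_(3 <= m < x.+1) c m / ln m%:R = \sum_(5 <= m < x.+1) c m / ln m%:R.
  have [x5|x5] := leqP 5 x.+1.
    rewrite (big_cat_nat (n := 5)) //= [X in X + _]big_nat_cond [X in X + _]big1 ?add0r //.
    move=> m /andP[/andP[_ m5] _]; rewrite /c [(5 <= m)%N]leqNgt m5 /= andbF.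
    by rewrite mul0r.
  rewrite [RHS]big_geq ?(ltnW x5) // big_nat_cond big1 // => m /andP[/andP[_ m5] _].
  have -> : c m = 0 by rewrite /c (_ : (5 <= m)%N = false) ?andbF //; lia.
  by rewrite mul0r.
rewrite E5 -sumrN (big_morph _ (@expRD R) (@expR0 R)) big_mkcond /=.
rewrite big_nat [RHS]big_nat; apply: eq_bigr => p /andP[p5 _].
rewrite /c p5 /=; case: ifP => [/andP[pp _]|_]; last by rewrite mul0r oppr0 expR0.
have pR : 5 <= (p%:R : R) by rewrite ler_nat.
have i1 : (p%:R : R)^-1 <= 5^-1 by rewrite lef_pV2 ?posrE //; lra.
have L1 : 1 <= ln (p%:R : R) by apply: ln_ge1; lia.
rewrite mulfK ?lt0r_neq0 //; last by lra.
by rewrite opprK lnK // posrE; lra.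
Qed.

Theorem mertens_product : exists mu B' : R, 0 < mu /\
    \forall z \near +oo,
      `|\prod_(5 <= p < (Num.truncn z).+1 |
                 [&& prime p, p%:R < z & S p]) (1 - p%:R^-1)
        - mu / (ln z `^ (1 / 2))|
      <= B' / (ln z `^ (3 / 2)).
Proof.
have [B1 /abel_summation[kappa [B2 H]]] := sum_c_bound.
(* [2 |B2|] comes from [B2 / ln x] through [ln z <= 2 ln x], and [1] from replacing [ln (ln x)] by
   [ln (ln z)]. *)
pose C := 2 * `|B2| + 1.
have C1 : 1 <= C by rewrite lerDr mulr_ge0.
exists (expR (- kappa)), (expR (- kappa) * (2 * C)); split; first exact: expR_gt0.
near=> z.
have z5 : 5 < z by near: z; exact: nbhs_pinfty_gt.
(* Ensures [|d| <= 1/2] below, where [|exp d - 1| <= 2 |d|]. *)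
have zC : expR (2 * C) < z by near: z; exact: nbhs_pinfty_gt.
have z0 : 0 < z by lra.
have LC : 2 * C <= ln z by rewrite -[leLHS]expRK ler_ln ?posrE ?expR_gt0 // ltW.
set L := ln z in LC *.
have L0 : 0 < L by lra.
(* [x] is the largest integer strictly below [z]: when [z] is an integer, the index [p = truncn z]
   is excluded by [p < z], so [x] is one less. *)
have [x [x4 xz zx ->]] : exists x : nat, [/\ (4 <= x)%N, x%:R < z, z <= x.+1%:R &
   \prod_(5 <= p < (Num.truncn z).+1 | [&& prime p, p%:R < z & S p]) (1 - p%:R^-1 : R)
   = \prod_(5 <= p < x.+1 | prime p && S p) (1 - p%:R^-1)].
  set m := Num.truncn z; have /andP[m1 m2] : m%:R <= z < m.+1%:R by apply: truncn_itv; lra.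
  have m5 : (5 <= m)%N by rewrite -ltnS -(ltr_nat R); lra.
  have [mz|mz] := eqVneq (m%:R) z; last first.
    have mz' : m%:R < z by rewrite lt_neqAle mz.
    exists m; split => //; [lia|exact: ltW|].
    rewrite big_nat_cond [RHS]big_nat_cond; apply: eq_bigl => p.
    case: (boolP (5 <= p < m.+1)%N) => //= /andP[_ pm].
    by rewrite (le_lt_trans _ mz') // ler_nat.
  exists m.-1; have mE : m = m.-1.+1 by rewrite prednK //; lia.
  split; [lia|by rewrite -mz ltr_nat; lia|by rewrite -mE mz|].
  rewrite big_mkcond big_nat_recr //= ltNge -{2}mz lexx /= andbF mulr1 -mE.
  rewrite -big_mkcond big_nat_cond [RHS]big_nat_cond; apply: eq_bigl => p.
  by case: (boolP (5 <= p < m)%N) => //= /andP[_ pm]; rewrite -mz ltr_nat pm.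
have x3 : (3 <= x)%N by lia.
have := H x x3; rewrite prod_exp; set T := \sum_(_ <= _ < _) _.
have L1 := ln_ge1 R x3; have xR : 4 <= (x%:R : R) by rewrite ler_nat.
have LL := @ln_succ_sub_le R x (ltnW (ltnW x3)).
have Lxz : ln x%:R <= L by rewrite ler_ln ?posrE // ?ltW //; lra.
have Lzx : L <= ln x.+1%:R by rewrite ler_ln ?posrE.
have xi : (x%:R : R)^-1 <= 4^-1 by rewrite lef_pV2 ?posrE //; lra.
set Lx := ln x%:R in L1 Lxz LL *.
have L2 : L <= 2 * Lx by lra.
have Lx0 : 0 < Lx by lra.
move=> HT.
pose d := - T + 2^-1 * ln L + kappa.
have lnL : 0 <= ln L - ln Lx <= Lx^-1.
  rewrite subr_ge0 ler_ln ?posrE // Lxz /= -ln_div ?posrE //.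
  have e : L / Lx = 1 + (L / Lx - 1) by ring.
  have e0 : 0 < L / Lx by rewrite divr_gt0.
  rewrite e; apply: (le_trans (le_ln1Dx _)); first by lra.
  have -> : L / Lx - 1 = (L - Lx) / Lx by field; exact: lt0r_neq0.
  by rewrite -[leRHS]mul1r ler_pM2r ?invr_gt0 //; lra.
have dB : `|d| <= C / L.
  have h1 : B2 / Lx <= 2 * `|B2| / L.
    rewrite ler_pdivrMr // mulrAC ler_pdivlMr //.
    have := ler_norm B2; have := normr_ge0 B2; nra.
  have h2 : 2^-1 * Lx^-1 <= L^-1.
    rewrite -invfM lef_pV2 ?posrE //; lra.
  have -> : C / L = 2 * `|B2| / L + L^-1 by rewrite /C mulrDl mul1r.
  move: HT lnL h1 h2; rewrite !ler_norml /d.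
  move: (2 * `|B2| / L) (B2 / Lx) (L^-1) (Lx^-1) (ln L) (ln Lx) => u v w y l l'.
  by clear => /andP[? ?] /andP[? ?] ? ?; apply/andP; split; lra.
have dh : `|d| <= 2^-1.
  by apply: (le_trans dB); rewrite ler_pdivrMr //; lra.
have eB : `|expR d - 1| <= 2 * `|d|.
  have lo := expR_ge1Dx d; have lo' := expR_ge1Dx (- d).
  have pd := expR_gt0 d.
  have E : expR d * expR (- d) = 1 by rewrite -expRD subrr expR0.
  move: dh; rewrite ler_norml => /andP[d1 d2].
  have U : expR d * (1 - d) <= 1 by rewrite -[leRHS]E ler_pM2l.
  have [d0|d0] := leP 0 d.
    rewrite (ger0_norm d0) ler_norml; apply/andP; split; nra.
  rewrite (ltr0_norm d0) ler_norml; apply/andP; split; nra.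
have aE : L `^ (1 / 2) = expR (2^-1 * ln L) by rewrite /powR (gt_eqF L0) mul1r.
have bE : L `^ (3 / 2) = expR (2^-1 * ln L) * L.
  rewrite /powR (gt_eqF L0) -{3}(lnK (_ : L \is Num.pos)) ?posrE // -expRD.
  by congr expR; lra.
rewrite aE bE; set a := expR (2^-1 * ln L).
have a0 : 0 < a by exact: expR_gt0.
have k0 : 0 < expR (- kappa) by exact: expR_gt0.
have -> : expR (- T) = expR (- kappa) / a * expR d.
  by rewrite /a -expRN -!expRD; congr expR; rewrite /d; ring.
rewrite -[X in _ - X]mulr1 -mulrBr normrM ger0_norm; last by rewrite divr_ge0 // ltW.
apply: (@le_trans _ _ (expR (- kappa) / a * (2 * (C / L)))).
  by rewrite ler_pM2l ?divr_gt0 //; lra.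
by rewrite le_eqVlt; apply/orP; left; apply/eqP; field; rewrite !lt0r_neq0.
Unshelve. all: by end_near.
Qed.

End Product.

(** * Coefficients of q-expansions *)

Section PowerSeries.
Local Open Scope complex_scope.
Variable R : realType.
Local Notation C := R[i].

(** Convergence at [tau = 1/2] bounds the coefficients by [B 2^n]; a strong induction then isolates
    the first remaining coefficient by letting [tau] be small. *)
Lemma real_series_uniq (c : nat -> R) :
  (forall tau : R, 0 < tau < 1 -> forall e : R, 0 < e -> exists X0, forall X, (X0 <= X)%N ->
     `|\sum_(1 <= n < X.+1) c n * tau ^+ n| < e) ->
  forall n, (0 < n)%N -> c n = 0.
Proof.
move=> H; have [B B1 HB] : exists2 B : R, 1 <= B & forall n, (0 < n)%N -> `|c n| <= B * 2 ^+ n.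
  have h2 : 0 < (2^-1 : R) < 1 by apply/andP; split; lra.
  have [X0 HX] := H _ h2 _ ltr01.
  (* Beyond [X0] a term is the difference of two partial sums smaller than 1, hence below 2; the sum
     covers the earlier terms. *)
  pose B := 2 + \sum_(0 <= n < X0.+1) `|c n * 2^-1 ^+ n|.
  have S0 : 0 <= \sum_(0 <= n < X0.+1) `|c n * 2^-1 ^+ n| by apply: sumr_ge0.
  exists B; first by rewrite /B; lra.
  move=> n n0; have p2 : 0 < (2 : R) ^+ n by rewrite exprn_gt0.
  suff : `|c n * 2^-1 ^+ n| <= B.
    have i0 : 0 <= ((2 : R) ^+ n)^-1 by rewrite invr_ge0 ltW.
    by rewrite normrM exprVn (ger0_norm i0) ler_pdivrMr.
  have [nX|nX] := leqP n X0.
    apply: (@le_trans _ _ (\sum_(0 <= n < X0.+1) `|c n * 2^-1 ^+ n|)); last by rewrite /B; lra.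
    by rewrite (bigD1_seq n) ?mem_index_iota ?iota_uniq //= lerDl sumr_ge0.
  have h1 := HX n (ltnW nX).
  have h3 : `|\sum_(1 <= i < n) c i * 2^-1 ^+ i| < 1.
    by have := HX n.-1; rewrite prednK //; apply; lia.
  rewrite big_nat_recr //= in h1.
  move: h1 h3; set s := \sum_(_ <= _ < _) _; rewrite !ltr_norml ler_norml /B.
  by move=> /andP[? ?] /andP[? ?]; apply/andP; split; lra.
move=> n; elim/ltn_ind: n => n IH n0.
apply/eqP; rewrite -normr_eq0; apply/eqP/le_anti; rewrite normr_ge0 andbT.
apply/ler_addgt0Pr => e e0; rewrite add0r.
(* with tau small, the tail is at most (4 B 2^n tau) tau^n *)
pose P := 4 * B * 2 ^+ n; have P0 : 0 < P by rewrite /P !mulr_gt0 ?exprn_gt0 //; lra.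
pose tau := Num.min (1 / 4) (e / (2 * P)).
have e2P : 0 < e / (2 * P) by apply: divr_gt0 => //; apply: mulr_gt0.
have t0 : 0 < tau by rewrite /tau lt_min e2P andbT; lra.
have t4 : tau <= 1 / 4 by rewrite ge_min lexx.
have te : tau * P <= e / 2.
  have : tau <= e / (2 * P) by rewrite ge_min lexx orbT.
  by rewrite ler_pdivlMr ?mulr_gt0 //; lra.
have tn0 : 0 < tau ^+ n by rewrite exprn_gt0.
have h1 : 0 < tau < 1 by apply/andP; split; lra.
have [X0 HX] := H tau h1 (e / 2 * tau ^+ n) (mulr_gt0 (divr_gt0 e0 (ltr0Sn _ 1)) tn0).
have := HX (maxn X0 n) (leq_maxl _ _).
rewrite (big_cat_nat (n := n)) //=; last by rewrite ltnW // ltnS leq_maxr.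
rewrite big_nat_cond big1 ?add0r; last first.
  by move=> i /andP[/andP[i0 ni] _]; rewrite IH ?mul0r.
rewrite big_ltn ?ltnS ?leq_maxr // => Hs.
have tail : `|\sum_(n.+1 <= i < (maxn X0 n).+1) c i * tau ^+ i| <= P * tau * tau ^+ n.
  apply: (le_trans (ler_norm_sum _ _ _)).
  rewrite -[n.+1]add0n big_addn.
  apply: (@le_trans _ _ (\sum_(0 <= i < (maxn X0 n).+1 - n.+1) B * (2 * tau) ^+ n.+1 * (1 / 2) ^+ i)).
    apply: ler_sum => i _; have ti : 0 <= tau ^+ (i + n.+1) by rewrite exprn_ge0 // ltW.
    rewrite normrM (ger0_norm ti).
    apply: (le_trans (ler_wpM2r ti (HB _ _))); first by rewrite addnS.
    have -> : B * 2 ^+ (i + n.+1) * tau ^+ (i + n.+1) = B * (2 * tau) ^+ n.+1 * (2 * tau) ^+ i.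
      by rewrite -mulrA -exprMn addnC exprD mulrA.
    apply: ler_wpM2l.
      by apply: mulr_ge0; [lra|apply: exprn_ge0; lra].
    by apply: lerXn2r; rewrite ?nnegrE; lra.
  have Y0 : 0 <= B * (2 * tau) ^+ n.+1 by rewrite mulr_ge0 ?exprn_ge0 //; lra.
  have G y : \sum_(0 <= j < y) (1 / 2 : R) ^+ j <= 2.
    suff : \sum_(0 <= j < y) (1 / 2 : R) ^+ j = 2 - 2 * (1 / 2) ^+ y.
      move=> ->; have : 0 <= (1 / 2 : R) ^+ y by rewrite exprn_ge0.
      lra.
    elim: y => [|y IHy]; first by rewrite big_geq // expr0; lra.
    by rewrite big_nat_recr //= IHy exprS; lra.
  rewrite -mulr_sumr; apply: (le_trans (ler_wpM2l Y0 (G _))).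
  by rewrite le_eqVlt; apply/orP; left; apply/eqP; rewrite /P exprMn !exprS; ring.
have : `|c n * tau ^+ n| <= e * tau ^+ n.
  have q : P * tau * tau ^+ n <= e / 2 * tau ^+ n by rewrite ler_pM2r // mulrC.
  move: Hs tail q; set s := \sum_(_ <= _ < _) _; set w := c n * _; set y := P * _ * _.
  rewrite ltr_norml !ler_norml => /andP[? ?] /andP[? ?] ?.
  have -> : e * tau ^+ n = e / 2 * tau ^+ n + e / 2 * tau ^+ n by field.
  by apply/andP; split; lra.
by rewrite normrM (ger0_norm (ltW tn0)) ler_pM2r.
Qed.

Definition qsum (c : nat -> C) (X : nat) (z : C) : C := \sum_(1 <= n < X.+1) c n * qpow n z.

Definition eC (x : R) : C := cos x +i* sin x.

Lemma qpowE (n : nat) (x y : R) :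
  qpow n (x +i* y) = ((expR (- (pi *+ 2 * y))) ^+ n)%:C * eC (pi *+ 2 * x *+ n).
Proof.
rewrite /qpow /cexp /eC.
have -> : (0 +i* (pi *+ 2)) * n%:R * (x +i* y) =
   ((- (pi *+ 2 * y)) *+ n) +i* (pi *+ 2 * x *+ n) :> C.
  rewrite mulr_natr; case: (n) => [|m]; first by rewrite !mulr0n mul0r.
  rewrite mulrnAl; set w : C := (0 +i* _) * _.
  have -> : w = (- (pi *+ 2 * y)) +i* (pi *+ 2 * x).
    by rewrite /w; apply/eqP; rewrite eq_complex /=; apply/andP; split; apply/eqP; ring.
  move: (- (pi *+ 2 * y)) (pi *+ 2 * x) => u v; elim: m => [|m IH]; first by rewrite !mulr1n.
  by rewrite mulrS IH !(mulrS _ m.+1) /=.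
by rewrite /= -expRM_natr mulr_natr.
Qed.

Lemma Re_sum (I : Type) (s : seq I) (P : pred I) (F : I -> C) :
  complex.Re (\sum_(i <- s | P i) F i) = \sum_(i <- s | P i) complex.Re (F i).
Proof. by apply: (big_morph (@complex.Re R)) => // -[a b] [c d]. Qed.

Lemma Im_sum (I : Type) (s : seq I) (P : pred I) (F : I -> C) :
  complex.Im (\sum_(i <- s | P i) F i) = \sum_(i <- s | P i) complex.Im (F i).
Proof. by apply: (big_morph (@complex.Im R)) => // -[a b] [c d]. Qed.

Lemma normc_ge_Im' (x : C) : (`|complex.Im x|%:C <= `|x|).
Proof.
by have := normc_ge_Re (x * 'i); rewrite normrM normCi mulr1 ReiNIm normrN.
Qed.

(** On the imaginary axis [e^(2 pi i n z)] is [tau^n], with [tau = e^(- 2 pi y)] running over the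
    open unit interval, so the real and the imaginary parts of [c] are coefficients of real power
    series. *)
Lemma qsum_uniq (c : nat -> C) :
  (forall y : R, 0 < y -> (fun X => qsum c X (0 +i* y) : C^o) @ \oo --> (0 : C^o)) ->
  forall n, (0 < n)%N -> c n = 0.
Proof.
move=> H.
have K (tau : R) : 0 < tau < 1 -> forall e : R, 0 < e ->
    exists X0, forall X, (X0 <= X)%N ->
     `|\sum_(1 <= n < X.+1) c n * (tau ^+ n)%:C| < e%:C.
  move=> /andP[t0 t1] e e0.
  have pi0 : 0 < (pi *+ 2 : R) by rewrite mulrn_wgt0 // pi_gt0.
  pose y := - ln tau / (pi *+ 2).
  have y0 : 0 < y by rewrite divr_gt0 // oppr_gt0 ln_lt0 // t0 t1.
  have yE : expR (- (pi *+ 2 * y)) = tau.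
    by rewrite /y mulrC divfK ?lt0r_neq0 // opprK lnK.
  have := H y y0 => /cvgrPdistC_lt /(_ e%:C).
  have e0' : 0 < (e%:C : C) by rewrite ltcR.
  move=> /(_ e0')[X0 _ HX]; exists X0 => X /HX /=; rewrite subr0 /qsum.
  congr (`|_| < _); apply: eq_bigr => n _.
  by rewrite qpowE yE mulr0 mul0rn /eC cos0 sin0 mulr1.
move=> n n0; apply/eqP; rewrite eq_complex /=; apply/andP; split; apply/eqP.
  apply: (real_series_uniq (c := fun n => complex.Re (c n))) => // tau ht e e0.
  have [X0 HX] := K tau ht e e0; exists X0 => X /HX h.
  have := le_lt_trans (normc_ge_Re _) h; rewrite ltcR Re_sum.
  congr (`|_| < _); apply: eq_bigr => k _.
  by case: (c k) => a b /=; rewrite mulr0 subr0.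
apply: (real_series_uniq (c := fun n => complex.Im (c n))) => // tau ht e e0.
have [X0 HX] := K tau ht e e0; exists X0 => X /HX h.
have := le_lt_trans (normc_ge_Im' _) h; rewrite ltcR Im_sum.
congr (`|_| < _); apply: eq_bigr => k _.
by case: (c k) => a b /=; rewrite mulr0 add0r.
Qed.

End PowerSeries.

(** * Hecke operators at primes *)

Lemma big_dvdn (V : nmodType) (G : nat -> V) (p X : nat) : (0 < p)%N ->
  \sum_(1 <= n < X.+1 | (p %| n)%N) G n = \sum_(1 <= m < (X %/ p)%N.+1) G (p * m)%N.
Proof.
move=> p0; elim: X => [|X IH]; first by rewrite div0n !big_geq.
rewrite big_mkcond big_nat_recr //= -big_mkcond IH divnS //.
case: (boolP (p %| X.+1)%N) => pX; last by rewrite addr0 add0n.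
have e : (p * (X %/ p).+1)%N = X.+1.
  by have := divnK pX; rewrite mulnC divnS // pX add1n.
by rewrite add1n [RHS]big_nat_recr //= e.
Qed.

Section Hecke.
Local Open Scope complex_scope.
Variable R : realType.
Local Notation C := R[i].
Local Notation eC := (@eC R).

Lemma eCD (x y : R) : eC (x + y) = eC x * eC y.
Proof.
rewrite /eC cosD sinD; apply/eqP; rewrite eq_complex /=.
by apply/andP; split; apply/eqP; ring.
Qed.

Lemma eC0 : eC 0 = 1.
Proof. by rewrite /eC cos0 sin0. Qed.

Lemma eCMn (x : R) (n : nat) : eC (x *+ n) = eC x ^+ n.
Proof. by elim: n => [|n IH]; rewrite ?mulr0n ?eC0 // mulrS eCD IH exprS. Qed.

Lemma eC_2pi : eC (pi *+ 2) = 1.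
Proof.
by rewrite /eC cos2pi sin_mulr2n sinpi mulr0 mul0rn.
Qed.

Lemma eC_eq1 (x : R) : 0 < x < pi *+ 2 -> eC x != 1.
Proof.
move=> /andP[x0 x1]; apply/eqP => -[c1 _].
have h : 0 < sin (x / 2) by rewrite sin_gt0_pi //; apply/andP; split; lra.
have : cos x = 1 - 2 * sin (x / 2) ^+ 2.
  have {1}-> : x = x / 2 + x / 2 by field.
  by rewrite cosD -!expr2 cos2sin2; ring.
by rewrite c1; have := exprn_gt0 2 h; lra.
Qed.

Lemma sum_roots_unity (p n : nat) : (0 < p)%N ->
  \sum_(0 <= b < p) eC (pi *+ 2 * (b%:R / p%:R) *+ n) = if (p %| n)%N then p%:R else 0 :> C.
Proof.
move=> p0; have pR : 0 < (p%:R : R) by rewrite ltr0n.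
set w := eC (pi *+ 2 * (p%:R)^-1 *+ n).
have E b : eC (pi *+ 2 * (b%:R / p%:R) *+ n) = w ^+ b.
  rewrite /w -eCMn; congr eC.
  by rewrite [b%:R / _]mulrC mulr_natr mulrnAr mulrnAC.
under eq_bigr do rewrite E.
have wE : w = eC (pi *+ 2 * (p%:R)^-1 *+ (n %% p)%N).
  rewrite /w {1}(divn_eq n p) mulrnDr eCD [(_ * p)%N]mulnC mulrnA.
  have -> : pi *+ 2 * p%:R^-1 *+ p = pi *+ 2 :> R.
    by rewrite -[_ *+ p]mulr_natr divfK // lt0r_neq0.
  by rewrite eCMn eC_2pi expr1n mul1r.
case: (boolP (p %| n)%N) => pn.
  move: wE; rewrite (eqP pn) mulr0n eC0 => ->.
  by under eq_bigr do rewrite expr1n; rewrite sumr_const_nat subn0.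
have r0 : (0 < n %% p)%N by rewrite lt0n.
have w1 : w != 1.
  rewrite wE; apply: eC_eq1.
  have pi0 : 0 < (pi *+ 2 : R) by rewrite mulrn_wgt0 // pi_gt0.
  rewrite -mulr_natr -mulrA; apply/andP; split.
    by rewrite mulr_gt0 // mulr_gt0 ?invr_gt0 ?ltr0n.
  by rewrite -[ltRHS]mulr1 ltr_pM2l // mulrC ltr_pdivrMr // mul1r ltr_nat ltn_mod.
have wp : w ^+ p = 1.
  rewrite /w -eCMn -mulrnA [(n * p)%N]mulnC mulrnA -[_ *+ p]mulr_natr divfK ?lt0r_neq0 //.
  by rewrite eCMn eC_2pi expr1n.
apply: (mulfI (_ : w - 1 != 0)); first by rewrite subr_eq0.
by rewrite mulr0 big_mkord -subrX1 wp subrr.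
Qed.

Lemma qpowM (p m : nat) (x y : R) : (0 < p)%N ->
  qpow (p * m) ((x / p%:R) +i* (y / p%:R)) = qpow m (x +i* y).
Proof.
move=> p0; have pR : p%:R != 0 :> R by rewrite pnatr_eq0 -lt0n.
rewrite !qpowE; congr (_%:C * eC _).
  rewrite exprM; congr (_ ^+ _); rewrite -expRM_natl; congr expR.
  by field.
by rewrite mulrnA; congr (_ *+ _); rewrite -mulr_natr; field.
Qed.

Lemma divisors_prime_sum (p : nat) (G : nat -> C) : prime p ->
  \sum_(d <- divisors p) G d = G 1%N + G p.
Proof.
move=> pp; rewrite (perm_big [:: 1%N; p]) /=.
  by rewrite !big_cons big_nil addr0.
apply: uniq_perm; first exact: divisors_uniq.
  by rewrite /= inE eq_sym andbT neq_ltn prime_gt1 // orbT.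
move=> d; rewrite -dvdn_divisors ?prime_gt0 // !inE.
case/primeP: pp => _ H; apply/idP/idP => [/H //|/orP[/eqP->|/eqP->]]; first exact: dvd1n.
exact: dvdnn.
Qed.

Lemma real_divC (x y : R) (p : nat) : (0 < p)%N ->
  (x +i* y) / p%:R = (x / p%:R) +i* (y / p%:R) :> C.
Proof.
move=> p0; have pR : p%:R != 0 :> R by rewrite pnatr_eq0 -lt0n.
have pC : p%:R != 0 :> C by rewrite pnatr_eq0 -lt0n.
apply: (mulIf pC); rewrite divfK //.
have -> : p%:R = (p%:R)%:C :> C by rewrite rmorph_nat.
by apply/eqP; rewrite eq_complex /=; apply/andP; split; apply/eqP; field.
Qed.

Variables (N : nat) (f : C -> C) (a : nat -> int).
Hypothesis f_coef : q_expansion f (fun n => (a n)%:~R).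
Let A : nat -> C := fun n => (a n)%:~R.

(** The left side is the [m]-th coefficient of [T_p f]: the sum over [b] selects the exponents
    divisible by [p], and [f (p z)] contributes the term with [m / p]. *)
Lemma hecke_prime_coef (p : nat) (lambda : C) : prime p -> coprime p N ->
  (forall z, upper_half_plane z -> hecke_T 2 N p f z = lambda * f z) ->
  forall m, (0 < m)%N ->
  A (p * m)%N + (if (p %| m)%N then p%:R * A (m %/ p)%N else 0) = lambda * A m.
Proof.
move=> pp pN Hl m m0.
have p0 := prime_gt0 pp; have pR0 : 0 < (p%:R : R) by rewrite ltr0n.
have pC : p%:R != 0 :> C by rewrite pnatr_eq0 -lt0n.
pose h m := A (p * m)%N + (if (p %| m)%N then p%:R * A (m %/ p)%N else 0) - lambda * A m.
apply/eqP; rewrite -subr_eq0; apply/eqP; apply: (qsum_uniq (c := h)) => // y y0.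
have up (x : R) (k : R) : 0 < k -> upper_half_plane ((x +i* k) : C) by [].
have yp0 : 0 < y / p%:R by rewrite divr_gt0.
have yp1 : 0 < y * p%:R by rewrite mulr_gt0.
have T0 := Hl _ (up 0 y y0).
have TE : hecke_T 2 N p f (0 +i* y) =
   p%:R * f (0 +i* (y * p%:R)) +
   p%:R^-1 * \sum_(0 <= b < p) f ((b%:R / p%:R) +i* (y / p%:R)).
  rewrite /hecke_T expr1 big_mkcond divisors_prime_sum // divn1 pN divnn p0 coprime1n /=.
  rewrite big_nat1 expr1n invr1 mul1r. rewrite mulr1 addr0 mulrDr; congr (_ * f _ + _).
    have -> : p%:R = (p%:R)%:C :> C by rewrite rmorph_nat.
    by apply/eqP; rewrite eq_complex /=; apply/andP; split; apply/eqP; ring.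
  rewrite mulrA; congr (_ * _); first by field.
  apply: eq_bigr => b _; congr f; rewrite mul1r -real_divC //; congr (_ / _).
  have -> : b%:R = (b%:R)%:C :> C by rewrite rmorph_nat.
  by apply/eqP; rewrite eq_complex /=; apply/andP; split; apply/eqP; ring.
(* With truncations at [p Y] and at [Y / p] the identity holds exactly between partial sums, and it
   remains to take limits. *)
have SE Y : qsum h Y (0 +i* y) =
   p%:R^-1 * \sum_(0 <= b < p) qsum A (p * Y) ((b%:R / p%:R) +i* (y / p%:R))
   + p%:R * qsum A (Y %/ p)%N (0 +i* (y * p%:R)) - lambda * qsum A Y (0 +i* y).
  have -> : \sum_(0 <= b < p) qsum A (p * Y) ((b%:R / p%:R) +i* (y / p%:R)) =
      p%:R * \sum_(1 <= m < Y.+1) A (p * m)%N * qpow m (0 +i* y).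
    rewrite /qsum exchange_big /=.
    transitivity (\sum_(1 <= n < (p * Y).+1 | (p %| n)%N)
        p%:R * (A n * qpow n ((0 / p%:R) +i* (y / p%:R)))).
      rewrite [RHS]big_mkcond /=; apply: eq_bigr => n _.
      under eq_bigr do rewrite qpowE mulrA.
      rewrite -mulr_sumr sum_roots_unity //; case: ifP => _; last by rewrite mulr0.
      by rewrite qpowE mul0r mulr0 mul0rn eC0 mulr1 mulrC.
    rewrite big_dvdn // mulKn // mulr_sumr; apply: eq_bigr => k _.
    by rewrite qpowM.
  rewrite mulKf //.
  have -> : p%:R * qsum A (Y %/ p)%N (0 +i* (y * p%:R)) =
     \sum_(1 <= m < Y.+1) (if (p %| m)%N then p%:R * A (m %/ p)%N else 0) * qpow m (0 +i* y).
    rewrite [RHS](eq_bigr (fun m => if (p %| m)%N then p%:R * A (m %/ p)%N * qpow m (0 +i* y) else 0)).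
      rewrite -big_mkcond big_dvdn // /qsum mulr_sumr; apply: eq_bigr => k _.
      rewrite mulKn // -mulrA -(@qpowM p k 0 (y * p%:R)) //.
      by rewrite mul0r mulfK // lt0r_neq0.
    by move=> k _; case: ifP => // _; rewrite mul0r.
  rewrite /qsum mulr_sumr -big_split /= -sumrB; apply: eq_bigr => k _.
  by rewrite /h mulrBl mulrDl mulrA.
have -> : (fun X => qsum h X (0 +i* y) : C^o) = (fun Y =>
   p%:R^-1 * \sum_(0 <= b < p) qsum A (p * Y) ((b%:R / p%:R) +i* (y / p%:R))
   + p%:R * qsum A (Y %/ p)%N (0 +i* (y * p%:R)) - lambda * qsum A Y (0 +i* y) : C^o).
  by apply/funext => Y; exact: SE.
have cA x k : 0 < k -> (fun X => qsum A X (x +i* k) : C^o) @ \oo --> (f (x +i* k) : C^o).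
  by move=> k0; exact: f_coef (up x k k0).
pose L : C := p%:R^-1 * \sum_(0 <= b < p) f ((b%:R / p%:R) +i* (y / p%:R))
   + p%:R * f (0 +i* (y * p%:R)) - lambda * f (0 +i* y).
have L0 : L = 0.
  by apply/eqP; rewrite subr_eq0 -T0 TE; apply/eqP; exact: addrC.
have cL (u : nat -> C) : (u : nat -> C^o) @ \oo --> (L : C^o) -> (u : nat -> C^o) @ \oo --> (0 : C^o) by rewrite L0.
apply: cL; rewrite /L.
have mulY : (fun Y => p * Y)%N @ \oo --> \oo.
  by apply/cvgnyPge => M; exists M => // Y /= MY; rewrite (leq_trans MY) // leq_pmull.
have divY : (fun Y => Y %/ p)%N @ \oo --> \oo.
  by apply/cvgnyPge => M; exists (M * p)%N => // Y /= MY; rewrite leq_divRL.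
apply: cvgB; first apply: cvgD.
- apply: cvgM; first exact: cvg_cst.
  elim: (index_iota 0 p) => [|b s IH].
    rewrite big_nil; under eq_fun do rewrite big_nil; exact: cvg_cst.
  rewrite big_cons; under eq_fun do rewrite big_cons.
  have c1 := cvg_comp (fun Y => p * Y)%N (fun X => qsum A X ((b%:R / p%:R) +i* (y / p%:R)) : C^o) mulY (cA _ _ yp0).
  exact: (cvgD c1 IH).
- apply: cvgM; first exact: cvg_cst.
  exact: (cvg_comp (fun Y => Y %/ p)%N (fun X => qsum A X (0 +i* (y * p%:R)) : C^o) divY (cA _ _ yp1)).
- apply: cvgM; first exact: cvg_cst.
  exact: cA.
Qed.

(** [m = 1] identifies the eigenvalue as [a p], and [m = p] then gives the relation. *)
Lemma hecke_prime_sqr (p : nat) : hecke_eigenform 2 N f -> a 1%N = 1 ->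
  prime p -> coprime p N -> a (p * p)%N = a p ^+ 2 - p%:Z.
Proof.
move=> [_ _ He] a1 pp pN.
have [lambda Hl] := He p (prime_gt0 pp).
have H := hecke_prime_coef pp pN Hl.
have := H 1%N isT; rewrite muln1 dvdn1 (gtn_eqF (prime_gt1 pp)) addr0 /A a1 mulr1 => lE.
have := H p (prime_gt0 pp); rewrite dvdnn divnn (prime_gt0 pp) /A a1 mulr1 -lE.
move=> e; apply: (intr_inj (R := C)); rewrite rmorphB rmorphXn /= expr2 -e.
by rewrite -pmulrn addrK.
Qed.

End Hecke.

(** * Coefficients of the theta series *)

Lemma fsbig_levels (V : nmodType) (T : choiceType) (P : set T) (nu : T -> nat) (G : T -> V)
    (X : nat) :
  (forall Y, finite_set [set x | P x /\ (nu x <= Y)%N]) -> (forall x, P x -> (0 < nu x)%N) ->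
  \sum_(x \in [set x | P x /\ (nu x <= X)%N]) G x =
  \sum_(1 <= k < X.+1) \sum_(x \in [set x | P x /\ nu x = k]) G x.
Proof.
move=> fP nu0; elim: X => [|X IH].
  rewrite big_geq // (_ : [set x | _] = set0) ?fsbig_set0 //.
  by apply/seteqP; split => x //= [/nu0]; case: (nu x).
have -> : [set x | P x /\ (nu x <= X.+1)%N] =
    [set x | P x /\ (nu x <= X)%N] `|` [set x | P x /\ nu x = X.+1].
  apply/seteqP; split => x /=.
    by move=> [Px]; rewrite leq_eqVlt => /orP[/eqP e|h]; [right|left].
  by move=> [[Px h]|[Px ->]]; split => //; exact: leqW.
rewrite big_nat_recr //= -IH fsbigU0 //.
- by apply: sub_finite_set (fP X.+1) => x [Px e] /=; rewrite e.
- by move=> x [[_ h] [_ e]]; rewrite e ltnn in h.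
Qed.

Lemma cvg_sub0 (R : realType) (u v w : nat -> R[i]) (l : R[i]) :
  (u : nat -> R[i]^o) @ \oo --> (l : R[i]^o) ->
  (v : nat -> R[i]^o) @ \oo --> (l : R[i]^o) ->
  (forall X, w X = u X - v X) -> (w : nat -> R[i]^o) @ \oo --> (0 : R[i]^o).
Proof.
move=> cu cv wE; have -> : w = (fun X => u X - v X) by apply/funext.
have cL (s : nat -> R[i]) : (s : nat -> R[i]^o) @ \oo --> (l - l : R[i]^o) ->
   (s : nat -> R[i]^o) @ \oo --> (0 : R[i]^o) by rewrite subrr.
by apply: cL; exact: (cvgB cu cv).
Qed.

Section Theta.
Local Open Scope complex_scope.
Variables (R : realType) (K : fieldExtType rat) (m : set K) (psi : set K -> R[i]).
Variables (f : R[i] -> R[i]) (a : nat -> R[i]).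
Hypothesis f_coef : q_expansion f a.
Hypothesis f_theta : is_theta_series m psi f.
Hypothesis fin_norm : forall X, finite_set [set I : set K | integral_ideal I /\ (ideal_norm I <= X)%N].
Hypothesis norm_gt0 : forall I : set K, integral_ideal I -> (0 < ideal_norm I)%N.

(** Grouping ideals by norm turns the theta series into a second q-expansion of [f], and
    q-expansions are unique. *)
Lemma theta_coef (k : nat) : (0 < k)%N ->
  a k = \sum_(I \in [set I | (integral_ideal I /\ coprime_ideals I m) /\ ideal_norm I = k]) psi I.
Proof.
move=> k0; pose P := [set I : set K | integral_ideal I /\ coprime_ideals I m].
pose b k := \sum_(I \in [set I | P I /\ ideal_norm I = k]) psi I.
apply/eqP; rewrite -subr_eq0; apply/eqP.
apply: (qsum_uniq (c := fun k => a k - b k)) => // y y0.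
have fP Y : finite_set [set I | P I /\ (ideal_norm I <= Y)%N].
  by apply: sub_finite_set (fin_norm Y) => I [[]].
have P0 I : P I -> (0 < ideal_norm I)%N by case=> /norm_gt0.
have up : upper_half_plane ((0 +i* y) : R[i]) by [].
have H1 := f_coef up; have H2 := f_theta up.
apply: (cvg_sub0 H1 H2) => X; rewrite /qsum.
have -> : [set I : set K | [/\ integral_ideal I, coprime_ideals I m & (ideal_norm I <= X)%N]] =
   [set I | P I /\ (ideal_norm I <= X)%N].
  by apply/seteqP; split => I /=; [case|case=> -[]].
rewrite (fsbig_levels _ X fP P0).
rewrite -sumrB; apply: eq_bigr => j _; rewrite mulrBl; congr (_ - _).
rewrite /b mulrC.
rewrite mulr_fsumr; apply: eq_fsbigr => I; rewrite inE => -[_ ->].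
by rewrite mulrC.
Qed.

End Theta.

(** * Integral bases of imaginary quadratic fields *)

(** The integer polynomial is moved to [algC], where a rational algebraic integer is an integer. *)
Lemma rat_integral_int (F : numFieldType) (q : rat) :
  integralOver (intr : int -> F) (ratr q) -> exists z : int, q = z%:~R.
Proof.
case=> p pm pr.
have E (G : numFieldType) : map_poly (intr : int -> G) p = map_poly ratr (map_poly (intr : int -> rat) p).
  by rewrite -map_poly_comp; apply: eq_map_poly => z /=; rewrite ratr_int.
rewrite E fmorph_root in pr.
have : root (map_poly (intr : int -> algC) p) (ratr q) by rewrite E fmorph_root.
move=> H.
have : (ratr q : algC) \is a Num.int.
  apply: Cint_rat_Aint; first exact: Crat_rat.
  apply: (root_monic_Aint H); first by rewrite monic_map.
  by apply/polyOverP => i; rewrite coef_map /= rpred_int.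
move/intrP => [z zE]; exists z; apply: (fmorph_inj (@ratr algC)).
by apply: (etrans zE); rewrite /= ratr_int.
Qed.

Section Conj.
Local Open Scope complex_scope.
Variable R : realType.
Local Notation C := R[i].

Lemma conjc_fixed_Im (z : C) : conjc z = z -> complex.Im z = 0.
Proof. by case: z => x y [] /= e; lra. Qed.

Lemma conjc_ratr (q : rat) : conjc (ratr q : C) = ratr q.
Proof. exact: fmorph_rat. Qed.

Lemma Im_ratr (q : rat) : complex.Im (ratr q : C) = 0.
Proof. exact: conjc_fixed_Im (conjc_ratr q). Qed.

End Conj.

Section IntegralBasis.
Local Open Scope complex_scope.
Variables (R : realType) (K : fieldExtType rat) (iota : {rmorphism K -> R[i]}).
Hypothesis K_quad : imaginary_quadratic R K.
Local Notation C := R[i].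

Let iota_rat q : iota (q%:A) = ratr q.
Proof. exact: (fmorph_eq_rat (iota \o in_alg K)). Qed.

Let intK (z : int) : (z%:~R)%:A = z%:~R :> K.
Proof. exact: (rmorph_int (in_alg K)). Qed.

Lemma quad_basis (th : K) : (forall q : rat, th <> q%:A) ->
  forall x, exists a b : rat, x = a%:A + b%:A * th.
Proof.
move=> nth x.
have th1 : th \notin 1%VS.
  by apply/negP => /vlineP[q qE]; apply: (nth q); rewrite qE.
have U : (1 + <[th]>)%VS = fullv.
  apply/eqP; rewrite eqEdim subvf /=.
  rewrite (_ : \dim {:K} = 2%N); last by case: K_quad.
  rewrite ltnNge; apply: contra th1 => d1.
  have /eqP -> : (1%VS == (1 + <[th]>)%VS :> {vspace K}).
    by rewrite eqEdim addvSl dimv1.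
  by rewrite (subvP (addvSr _ _)) // memv_line.
have : x \in (1 + <[th]>)%VS by rewrite U memvf.
move=> /memv_addP[u /vlineP[a ->] [v /vlineP[b ->] ->]].
by exists a, b; rewrite mulr_algl.
Qed.

Lemma iota_nonreal (al : K) : (forall q : rat, al <> q%:A) -> complex.Im (iota al) != 0.
Proof.
move=> nal; have [_ /(_ iota) [x xI]] := K_quad.
have [a [b xE]] := quad_basis nal x; apply: contra xI => /eqP aI.
rewrite xE rmorphD rmorphM !iota_rat raddfD /= Im_ratr add0r.
have rb := Im_ratr R b; move: (ratr b) rb (iota al) aI => [p q] /= -> [r s] /= ->.
by rewrite mulr0 mul0r addr0.
Qed.

(** The conjugate of [iota al] is a root of the same quadratic equation, so [T] and [- c] are a sum
    and a product of algebraic integers, hence integers. For the sign, [t^2 - 4 n] is the square of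
    the purely imaginary [z - conjc z]. *)
Lemma integral_quad (al : K) : ring_of_integers al -> (forall q : rat, al <> q%:A) ->
  exists t n : int, al ^+ 2 = t%:~R * al - n%:~R /\ 0 < 4 * n - t ^+ 2.
Proof.
move=> ial nal; have [c [T sq]] := quad_basis nal (al ^+ 2).
have zI := iota_nonreal nal; set z := iota al in zI.
have zz : z ^+ 2 = ratr c + ratr T * z.
  by rewrite /z -rmorphXn sq rmorphD rmorphM !iota_rat.
have cz : (conjc z) ^+ 2 = ratr c + ratr T * conjc z.
  move: (conjc_ratr R c) (conjc_ratr R T) zz; move: (ratr c) (ratr T) => u v cu cv zz.
  by rewrite -rmorphXn zz rmorphD rmorphM /= cu cv.
have zcz : z - conjc z != 0.
  rewrite subr_eq0; apply: contra zI => /eqP e.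
  by apply/eqP; apply: conjc_fixed_Im.
have zi : integralOver (intr : int -> C) z.
  case: ial => p pm pr; exists p => //.
  have := rmorph_root iota pr; rewrite -map_poly_comp.
  by congr (root _ _); apply: eq_map_poly => k /=; rewrite rmorph_int.
have czi : integralOver (intr : int -> C) (conjc z).
  case: zi => p pm pr; exists p => //.
  have := rmorph_root (@conjc R) pr; rewrite -map_poly_comp.
  by congr (root _ _); apply: eq_map_poly => k /=; rewrite rmorph_int.
have TE : ratr T = z + conjc z.
  apply: (mulIf zcz).
  have -> : (z + conjc z) * (z - conjc z) = z ^+ 2 - (conjc z) ^+ 2 by ring.
  by rewrite zz cz; ring.
have cE : ratr (- c) = z * conjc z.
  rewrite rmorphN /=; have -> : ratr c = z ^+ 2 - ratr T * z by rewrite zz; ring.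
  by rewrite TE; ring.
have [t tE] : exists z : int, T = z%:~R.
  apply: (@rat_integral_int C); rewrite TE; exact: integral_add.
have [n nE] : exists z : int, - c = z%:~R.
  apply: (@rat_integral_int C); rewrite cE; exact: integral_mul.
exists t, n; split.
  by rewrite sq -(opprK c) nE tE -!intK scaleNr addrC.
have : (t%:~R ^+ 2 - 4 * n%:~R : C) = (z - conjc z) ^+ 2.
  by rewrite -(ratr_int C t) -(ratr_int C n) -tE -nE TE cE; ring.
move: zI; case: (z) => x y /= y0.
have -> : (x +i* y) - (x -i* y) = 0 +i* (2 * y) :> C.
  by apply/eqP; rewrite eq_complex /=; apply/andP; split; apply/eqP; ring.
have -> : t%:~R ^+ 2 - 4 * n%:~R = (t ^+ 2 - 4 * n)%:~R%:C :> C.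
  by rewrite rmorph_int rmorphB rmorphXn rmorphM.
rewrite expr2 => -[+ _] /=; rewrite mulr0 sub0r => e.
have : ((t ^+ 2 - 4 * n)%:~R : R) < 0.
  rewrite e oppr_lt0; have := exprn_even_gt0 (2 * y) (isT : ~~ odd 2); rewrite /= mulf_eq0 negb_or y0 andbT.
  by rewrite expr2 => ->; rewrite pnatr_eq0.
by rewrite ltrz0; lia.
Qed.

Lemma exists_integral_nonrat : exists al : K, ring_of_integers al /\ forall q : rat, al <> q%:A.
Proof.
have [_ /(_ iota) [x xI]] := K_quad.
have nx q : x <> q%:A.
  by move=> e; move: xI; rewrite e iota_rat Im_ratr eqxx.
have [c [T sq]] := quad_basis nx (x ^+ 2).
(* Clearing denominators: [d x] satisfies [X^2 = (T d) X + (c d) d], with integer coefficients. *)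
pose d : int := denq c * denq T.
have d0 : d != 0 by rewrite mulf_neq0 ?denq_neq0.
have dK : (d%:~R : K) != 0 by rewrite -intK scaler_eq0 oner_eq0 orbF intr_eq0.
have [c' cE] : exists z : int, c * d%:~R = z%:~R.
  by exists (numq c * denq T); rewrite rmorphM /= mulrA -numqE -rmorphM.
have [T' tE] : exists z : int, T * d%:~R = z%:~R.
  by exists (numq T * denq c); rewrite rmorphM /= mulrCA -numqE -rmorphM mulrC.
clearbody d.
exists (d%:~R * x); split; last first.
  move=> q e; apply: (nx ((d%:~R)^-1 * q)).
  by apply: (mulfI dK); rewrite e -intK mulr_algl scalerA mulrA mulfV ?mul1r // intr_eq0.
exists ('X^2 - (T' *: 'X + (c' * d)%:P)).
  apply/eqP; rewrite lead_coefDl ?lead_coefXn // size_polyXn size_polyN.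
  rewrite (leq_ltn_trans (size_polyD _ _)) // gtn_max.
  rewrite (leq_ltn_trans (size_scale_leq _ _)) ?size_polyX //=.
  by rewrite (leq_ltn_trans (size_polyC_leq1 _)).
rewrite rmorphB rmorphD /= map_polyXn map_polyZ /= map_polyX map_polyC /=.
apply/rootP; rewrite !hornerE /= exprMn sq rmorphM /=.
have cK : c'%:~R = c%:A * d%:~R :> K by rewrite -!intK -cE; exact: (rmorphM (in_alg K)).
have tK : T'%:~R = T%:A * d%:~R :> K by rewrite -!intK -tE; exact: (rmorphM (in_alg K)).
rewrite cK tK; ring.
Qed.

(** [w] is a non-rational integer of [K] with [4 n - t^2] minimal. If an integer of [K] had a
    non-integral [w]-coordinate, subtracting a nearest multiple of [w] would leave a coordinate
    [0 < |r| <= 1/2], and the value [r^2 (4 n - t^2)] would be smaller. *)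
Theorem integral_basis : exists (w : K) (t n : int),
  [/\ w ^+ 2 = t%:~R * w - n%:~R, 0 < 4 * n - t ^+ 2,
      forall x, ring_of_integers x <-> exists u v : int, x = u%:~R + v%:~R * w
    & forall u v : int, u%:~R + v%:~R * w = 0 -> u = 0 /\ v = 0].
Proof.
pose P (k : nat) := `[< exists (al : K) (t n : int), [/\ ring_of_integers al,
   (forall q : rat, al <> q%:A), al ^+ 2 = t%:~R * al - n%:~R & 4 * n - t ^+ 2 = k.+1%:Z ] >].
have [k0 k0P] : exists k, P k.
  have [al [ial nal]] := exists_integral_nonrat.
  have [t [n [e D0]]] := integral_quad ial nal.
  exists (absz (4 * n - t ^+ 2)%R).-1; apply/asboolP; exists al, t, n; split => //; lia.
have [k /asboolP[w [t [n [iw nw e De]]]] kmin] := ex_minnP (ex_intro _ k0 k0P).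
have D0 : 0 < 4 * n - t ^+ 2 by rewrite De.
have ratint (q : rat) : ring_of_integers (q%:A : K) -> exists z : int, q = z%:~R.
  move=> iq; apply: (@rat_integral_int C); rewrite -iota_rat.
  case: iq => p pm pr; exists p => //.
  have := rmorph_root iota pr; rewrite -map_poly_comp.
  by congr (root _ _); apply: eq_map_poly => z /=; rewrite rmorph_int.
have iint (z : int) : ring_of_integers (z%:~R : K) by exact: integral_id.
exists w, t, n; split => // [x|u v uv]; last first.
  have v0 : v = 0.
    apply/eqP/negPn/negP => v0.
    apply: (nw (- (u%:~R / v%:~R))).
    have vK : (v%:~R : K) != 0 by rewrite -intK scaler_eq0 oner_eq0 orbF intr_eq0.
    apply: (mulfI vK); rewrite -(addr0_eq uv) scaleNr mulrN; congr (- _).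
    by rewrite -!intK mulr_algl scalerA mulrCA mulfV ?mulr1 // intr_eq0.
  split => //; move: uv; rewrite v0 mul0r addr0 => /eqP.
  by rewrite -intK scaler_eq0 oner_eq0 orbF intr_eq0 => /eqP.
split=> [ix|[u [v ->]]]; last first.
  by apply: integral_add; [exact: iint|apply: integral_mul; [exact: iint|exact: iw]].
have [a [b xE]] := quad_basis nw x.
pose v := Num.floor (b + 1 / 2).
pose y := x - v%:~R * w.
have iy : ring_of_integers y.
  by apply: integral_sub; [exact: ix|apply: integral_mul; [exact: iint|exact: iw]].
pose r := b - v%:~R.
have yE : y = a%:A + r%:A * w.
  by rewrite /y xE /r scalerBl mulrBl addrA intK.
have r4 : r ^+ 2 <= 1 / 4.
  have /andP[h1 h2] := floor_itv (b + 1 / 2); rewrite -/v rmorphD /= in h1 h2.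
  rewrite /r; set q := (v%:~R : rat) in h1 h2 *; nra.
clearbody r.
have [r0|r0] := eqVneq r 0.
  have [z zE] : exists z : int, a = z%:~R.
    by apply: ratint; move: iy; rewrite yE r0 scale0r mul0r addr0.
  exists z, v; rewrite -[x](subrK (v%:~R * w)) -/y yE r0 scale0r mul0r addr0.
  by rewrite zE intK.
have nyq (q : rat) : y <> q%:A.
  move=> yq; apply: (nw (r^-1 * (q - a))).
  have rK : (r%:A : K) != 0 by rewrite scaler_eq0 oner_eq0 orbF.
  apply: (mulfI rK); have -> : r%:A * w = y - a%:A by rewrite yE addrC addKr.
  by rewrite yq -scalerBl mulr_algl scalerA mulrA mulfV ?mul1r.
have [t' [n' [e' D']]] := integral_quad iy nyq.
have disc : ((4 * n' - t' ^+ 2)%:~R : rat) = r ^+ 2 * (4 * n - t ^+ 2)%:~R.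
  have uniq (c d : rat) : c%:A + d%:A * w = 0 -> c = 0 /\ d = 0.
    move=> cd; have d0 : d = 0.
      apply/eqP/negPn/negP => d0; apply: (nw (d^-1 * - c)).
      have dK : (d%:A : K) != 0 by rewrite scaler_eq0 oner_eq0 orbF.
      apply: (mulfI dK); rewrite [RHS]mulr_algl scalerA mulrA mulfV // mul1r scaleNr.
      by apply/eqP; rewrite -addr_eq0 addrC cd.
    by split => //; move/eqP: cd; rewrite d0 scale0r mul0r addr0 scaler_eq0 oner_eq0 orbF => /eqP.
  pose A : {rmorphism rat -> K} := in_alg K; have AE q : A q = q%:A by [].
  (* The coordinates of [y^2 - t' y + n' = 0] in the basis [1, w]. *)
  have : A (a ^+ 2 - r ^+ 2 * n%:~R - t'%:~R * a + n'%:~R) + A (2 * a * r + r ^+ 2 * t%:~R - t'%:~R * r) * w = 0.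
    rewrite !(rmorphXn A, rmorphD A, rmorphN A, rmorphM A, rmorph_int A, rmorph1 A).
    have : y ^+ 2 - (t'%:~R * y - n'%:~R) = 0 by rewrite e' subrr.
    rewrite yE -!AE => <-.
    have -> : (A a + A r * w) ^+ 2 = A a ^+ 2 + 2 * A a * A r * w + A r ^+ 2 * w ^+ 2 by ring.
    by rewrite e; ring.
  move=> /uniq[h1 h2].
  have h3 : t'%:~R = 2 * a + r * t%:~R.
    by apply: (mulIf r0); apply/eqP; rewrite -subr_eq0 -oppr_eq0 -[X in _ == X]h2; apply/eqP; ring.
  have h4 : n'%:~R = t'%:~R * a - a ^+ 2 + r ^+ 2 * n%:~R.
    by apply/eqP; rewrite -subr_eq0 -[X in _ == X]h1; apply/eqP; ring.
  by rewrite !(rmorphXn, rmorphB, rmorphM) /= h4 h3; ring.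
have : P (absz (4 * n' - t' ^+ 2)%R).-1.
  by apply/asboolP; exists y, t', n'; split => //; lia.
move=> /kmin; have : (4 * n' - t' ^+ 2 < 4 * n - t ^+ 2).
  rewrite -(ltr_int rat) disc -[ltRHS]mul1r ltr_pM2r ?ltr0z //; lra.
by rewrite De; lia.
Qed.

End IntegralBasis.

(** * Ideals of the ring of integers *)

Lemma card_image_In (T : choiceType) (f : nat -> T) (m : nat) :
  {in `I_m &, injective f} -> #|` fset_set (f @` `I_m)|%fset = m.
Proof.
move=> fI; rewrite fset_set_image // card_in_imfset /=; last first.
  by move=> x y; rewrite !in_fset_set // => /[!inE] xm ym; apply: fI; rewrite inE.
by rewrite (card_fset_set (n := m)).
Qed.

Section Ideals.
Variables (K : fieldExtType rat) (w : K) (t n : int).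
Hypothesis w2 : w ^+ 2 = t%:~R * w - n%:~R.
Hypothesis D0 : 0 < 4 * n - t ^+ 2.
Hypothesis OKE : forall x, ring_of_integers x <-> exists u v : int, x = u%:~R + v%:~R * w.
Hypothesis w_free : forall u v : int, u%:~R + v%:~R * w = 0 -> u = 0 /\ v = 0.
Local Notation N := (nrm t n).

Definition quad_emb (p : int * int) : K := p.1%:~R + p.2%:~R * w.
Local Notation emb := quad_emb.
Definition qconj (p : int * int) : int * int := (p.1 + t * p.2, - p.2).
Definition qmul (p q : int * int) : int * int :=
  (p.1 * q.1 - n * p.2 * q.2, p.1 * q.2 + p.2 * q.1 + t * p.2 * q.2).

Lemma emb_inj : injective emb.
Proof.
move=> [x y] [x' y'] /eqP; rewrite -subr_eq0 /quad_emb /= => /eqP e.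
have := @w_free (x - x') (y - y'); rewrite !rmorphB /=.
by case=> [|/eqP + /eqP]; [rewrite -e; ring|rewrite !subr_eq0 => /eqP -> /eqP ->].
Qed.

Lemma embB p q : emb p - emb q = emb (p.1 - q.1, p.2 - q.2).
Proof. by rewrite /quad_emb /= !rmorphB /=; ring. Qed.

Lemma embD p q : emb p + emb q = emb (p.1 + q.1, p.2 + q.2).
Proof. by rewrite /quad_emb /= !rmorphD /=; ring. Qed.

Lemma embM p q : emb p * emb q = emb (qmul p q).
Proof.
rewrite /quad_emb /qmul /= !(rmorphB, rmorphD, rmorphM) /=.
transitivity (p.1%:~R * q.1%:~R + (p.1%:~R * q.2%:~R + p.2%:~R * q.1%:~R) * w
   + p.2%:~R * q.2%:~R * w ^+ 2 : K); first by ring.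
by rewrite w2; ring.
Qed.

Lemma emb_int (z : int) : emb (z, 0) = z%:~R.
Proof. by rewrite /quad_emb /= mul0r addr0. Qed.

Lemma emb_conj p : emb p * emb (qconj p) = (N p)%:~R.
Proof.
by rewrite embM -emb_int; congr emb; rewrite /qmul /nrm /=; congr pair; ring.
Qed.

Lemma emb_OK p : ring_of_integers (emb p).
Proof. by apply/OKE; exists p.1, p.2. Qed.

Lemma OK_emb x : ring_of_integers x -> exists p, x = emb p.
Proof. by move=> /OKE[u [v ->]]; exists (u, v). Qed.

Lemma int_OK (z : int) : ring_of_integers (z%:~R : K).
Proof. by rewrite -emb_int; exact: emb_OK. Qed.

Lemma emb_eq0 p : emb p = 0 -> p = (0, 0).
Proof. by move=> e; apply: emb_inj; rewrite e emb_int. Qed.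

Lemma nrm_emb_gt0 p : emb p != 0 -> 0 < N p.
Proof.
move=> p0; rewrite nrm_gt0 //; apply: contra p0 => /eqP ->.
by rewrite emb_int.
Qed.

Section OneIdeal.
Variable I : set K.
Hypothesis idI : integral_ideal I.

Lemma idealD x y : I x -> I y -> I (x + y).
Proof. by case: idI => _ _ H _; exact: H. Qed.

Lemma idealM r x : ring_of_integers r -> I x -> I (r * x).
Proof. by case: idI => _ _ _; apply. Qed.

Lemma ideal_mulz (z : int) x : I x -> I (z%:~R * x).
Proof. by apply: idealM; exact: int_OK. Qed.

Lemma idealB x y : I x -> I y -> I (x - y).
Proof.
move=> Ix /(ideal_mulz (-1)); rewrite rmorphN mulNr mul1r; exact: idealD.
Qed.

Lemma ideal_sub_emb x : I x -> exists p, x = emb p.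
Proof. by case: idI => S _ _ _ /S /OK_emb. Qed.

Lemma ideal_pos_int : exists k : nat, (0 < k)%N /\ I k%:R.
Proof.
case: idI => S [x Ix x0] _ _; have [p pE] := ideal_sub_emb Ix.
have N0 : 0 < N p by apply: nrm_emb_gt0; rewrite -pE.
exists (absz (N p)); split; first by lia.
have -> : (absz (N p))%:R = (N p)%:~R :> K by rewrite -[in RHS](gtz0_abs N0) pmulrn.
by rewrite -emb_conj mulrC -pE; apply: idealM => //; exact: emb_OK.
Qed.

(* Hermite normal form of I as a sublattice of Z + Z w. *)
Lemma ideal_hnf : exists a b d : nat, [/\ (0 < a)%N, (0 < d)%N, (b < a)%N, ((d %| a) && (d %| b))%N &
  forall p, I (emb p) <-> (d%:Z %| p.2)%Z /\ (a%:Z %| p.1 - b%:Z * (p.2 %/ d%:Z)%Z)%Z].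
Proof.
have [k [k0 Ik]] := ideal_pos_int.
have Ik' : I (emb (k%:Z, 0)) by rewrite emb_int -pmulrn.
have exa : exists a : nat, (0 < a)%N && `[< I (emb (a%:Z, 0)) >].
  by exists k; rewrite k0; apply/asboolP.
have [a /andP[a0 /asboolP Ia] amin] := ex_minnP exa.
have exd : exists d : nat, (0 < d)%N && `[< exists b : int, I (emb (b, d%:Z)) >].
  exists k; rewrite k0; apply/asboolP; exists 0.
  have := idealM (emb_OK (0, 1)) Ik'; rewrite embM; congr (I (emb _)).
  by rewrite /qmul /=; congr pair; ring.
have [d /andP[d0 /asboolP[b0 Ib0]] dmin] := ex_minnP exd.
have adiv (z : int) : I (emb (z, 0)) -> (a%:Z %| z)%Z.
  move=> Iz; apply/dvdz_mod0P/eqP/negPn/negP => r0.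
  have : I (emb ((z %% a%:Z)%Z, 0)).
    have := idealB Iz (ideal_mulz (z %/ a%:Z)%Z Ia).
    rewrite -(emb_int (z %/ a%:Z)%Z) embM embB; congr (I (emb _)).
    by rewrite /qmul /=; congr pair; [have := divz_eq z a%:Z; lia|ring].
  have rge : 0 <= (z %% a%:Z)%Z by apply: modz_ge0; lia.
  have rlt : (z %% a%:Z)%Z < a%:Z by apply: ltz_pmod; lia.
  rewrite -(gez0_abs rge) => Ir.
  have := amin (absz (z %% a%:Z)%Z); rewrite (_ : (0 < _)%N); last by lia.
  by move=> /(_ (introT (asboolP _) Ir)); lia.
pose b := absz (b0 %% a%:Z)%Z.
have bge : 0 <= (b0 %% a%:Z)%Z by apply: modz_ge0; lia.
have blt : (b0 %% a%:Z)%Z < a%:Z by apply: ltz_pmod; lia.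
have bE : b%:Z = (b0 %% a%:Z)%Z by rewrite /b gez0_abs.
have Ib : I (emb (b%:Z, d%:Z)).
  have := idealB Ib0 (ideal_mulz (b0 %/ a%:Z)%Z Ia).
  rewrite -(emb_int (b0 %/ a%:Z)%Z) embM embB; congr (I (emb _)).
  by rewrite /qmul /=; congr pair; [have := divz_eq b0 a%:Z; lia|ring].
have ddiv (u v : int) : I (emb (u, v)) -> (d%:Z %| v)%Z.
  move=> Iz; apply/dvdz_mod0P/eqP/negPn/negP => r0.
  have : I (emb (u - (v %/ d%:Z)%Z * b%:Z, (v %% d%:Z)%Z)).
    have := idealB Iz (ideal_mulz (v %/ d%:Z)%Z Ib).
    rewrite -(emb_int (v %/ d%:Z)%Z) embM embB; congr (I (emb _)).
    by rewrite /qmul /=; congr pair; [ring|have := divz_eq v d%:Z; lia].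
  have rge : 0 <= (v %% d%:Z)%Z by apply: modz_ge0; lia.
  have rlt : (v %% d%:Z)%Z < d%:Z by apply: ltz_pmod; lia.
  rewrite -(gez0_abs rge) => Ir.
  have := dmin (absz (v %% d%:Z)%Z); rewrite (_ : (0 < _)%N); last by lia.
  move=> /(_ (introT (asboolP _) (ex_intro _ _ Ir))); lia.
(* Multiplication by [w] sends [(a, 0)] to [(0, a)] and gives [(b, d)] the second coordinate
   [b + t d], whence [d] divides [a] and [b]. *)
have Iw p : I (emb p) -> I (emb (- n * p.2, p.1 + t * p.2)).
  move=> Ip; have := idealM (emb_OK (0, 1)) Ip; rewrite embM; congr (I (emb _)).
  by rewrite /qmul /=; congr pair; ring.
have da : (d %| a)%N.
  by have := ddiv _ _ (Iw _ Ia); rewrite /= mulr0 addr0 dvdzE.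
have db : (d %| b)%N.
  have := ddiv _ _ (Iw _ Ib); rewrite /= => H.
  have := dvdzB H (dvdz_mull t (dvdzz d%:Z)); rewrite addrK dvdzE //.
exists a, b, d; split => //; [by rewrite -ltz_nat bE|by rewrite da db|].
move=> [u v]; split => [Iuv|[/= /dvdzP[k' vE] /dvdzP[l uE]]].
  have dv := ddiv _ _ Iuv; split => //=; apply: adiv.
  have := idealB Iuv (ideal_mulz (v %/ d%:Z)%Z Ib).
  rewrite -(emb_int (v %/ d%:Z)%Z) embM embB; congr (I (emb _)).
  have := divzK dv; rewrite /qmul /= => e.
  by congr pair; [ring|rewrite -[X in X - _]e; ring].
have dz : d%:Z != 0 by lia.
rewrite vE mulzK // in uE.
have := idealD (ideal_mulz l Ia) (ideal_mulz k' Ib).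
rewrite -!emb_int !embM embD; congr (I (emb _)); rewrite /qmul /=.
by congr pair; [lia|rewrite vE; ring].
Qed.

(** The cosets are represented by [(i, j)] with [i < a] and [j < d], numbered by [k = i + j a]. *)
Lemma ideal_norm_hnf (a b d : nat) : (0 < a)%N -> (0 < d)%N ->
  (forall p, I (emb p) <-> (d%:Z %| p.2)%Z /\ (a%:Z %| p.1 - b%:Z * (p.2 %/ d%:Z)%Z)%Z) ->
  ideal_norm I = (a * d)%N.
Proof.
move=> a0 d0 H.
pose f (k : nat) : set K := [set (emb ((k %% a)%N%:Z, (k %/ a)%N%:Z) + y)%R | y in I].
have cosetE x x' : [set (x + y)%R | y in I] = [set (x' + y)%R | y in I] <-> I (x - x').
  split=> [e|Ix].
    have : [set (x' + y)%R | y in I] x.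
      rewrite -e; exists 0; last by rewrite addr0.
      by have [k [k0 Ik]] := ideal_pos_int; rewrite -(subrr k%:R); exact: idealB.
    by move=> [y Iy <-]; rewrite addrAC subrr add0r.
  apply/seteqP; split => _ [y Iy <-].
    by exists (x - x' + y); [exact: idealD|ring].
  by exists (y - (x - x')); [exact: idealB|ring].
have az : a%:Z != 0 by lia.
have dz : d%:Z != 0 by lia.
rewrite /ideal_norm (_ : [set _ | x in _] = f @` `I_(a * d)%N).
  apply: card_image_In => k k'; rewrite !inE /= => kl kl' /cosetE.
  rewrite embB => /H[/= h1 h2].
  have q1 : (k %/ a < d)%N by rewrite ltn_divLR // mulnC.
  have q2 : (k' %/ a < d)%N by rewrite ltn_divLR // mulnC.
  have e1 : (k %/ a)%N = (k' %/ a)%N.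
    move/dvdzP: h1 => [c cE]; have c0 : c = 0 by nia.
    by rewrite c0 mul0r in cE; lia.
  move: h2; rewrite e1 subrr div0z mulr0 subr0 => /dvdzP[c cE].
  have r1 := ltn_pmod k a0; have r2 := ltn_pmod k' a0.
  have c0 : c = 0 by nia.
  have e2 : (k %% a)%N = (k' %% a)%N by rewrite c0 mul0r in cE; lia.
  by rewrite (divn_eq k a) (divn_eq k' a) e1 e2.
apply/seteqP; split => [_ [x xO <-]|_ [k _ <-]]; last first.
  by exists (emb ((k %% a)%N%:Z, (k %/ a)%N%:Z)) => //; exact: emb_OK.
have [[u v] ->] := OK_emb xO.
pose j := absz (v %% d%:Z)%Z; pose q := (v %/ d%:Z)%Z.
pose i := absz ((u - b%:Z * q) %% a%:Z)%Z.
have jE : j%:Z = (v %% d%:Z)%Z by rewrite /j gez0_abs // modz_ge0.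
have iE : i%:Z = ((u - b%:Z * q) %% a%:Z)%Z by rewrite /i gez0_abs // modz_ge0.
have ia : (i < a)%N by rewrite -ltz_nat iE ltz_pmod //; lia.
have jd : (j < d)%N by rewrite -ltz_nat jE ltz_pmod //; lia.
exists (i + j * a)%N => /=; first by nia.
rewrite /f; apply/cosetE.
rewrite addnC modnMDl divnMDl // modn_small // divn_small // addn0 embB.
apply/H => /=.
have vE : v = q * d%:Z + j%:Z by rewrite jE; exact: divz_eq.
have uE : u - b%:Z * q = ((u - b%:Z * q) %/ a%:Z)%Z * a%:Z + i%:Z by rewrite iE; exact: divz_eq.
have -> : j%:Z - v = (- q) * d%:Z by rewrite vE; ring.
rewrite mulzK //; split; first exact: dvdz_mull.
apply/dvdzP; exists (- ((u - b%:Z * q) %/ a%:Z)%Z).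
by rewrite mulNr; lia.
Qed.

Lemma ideal_norm_gt0 : (0 < ideal_norm I)%N.
Proof.
have [a [b [d [a0 d0 _ _ H]]]] := ideal_hnf.
by rewrite (ideal_norm_hnf a0 d0 H) muln_gt0 a0.
Qed.

End OneIdeal.

(** An ideal is determined by its normal form, whose entries [a], [b], [d] are bounded by the norm
    [a d]. *)
Lemma finite_ideal_norm (X : nat) :
  finite_set [set I : set K | integral_ideal I /\ (ideal_norm I <= X)%N].
Proof.
pose g (x : nat * (nat * nat)) : set K :=
  emb @` [set p | (x.2.2%:Z %| p.2)%Z /\ (x.1%:Z %| p.1 - x.2.1%:Z * (p.2 %/ x.2.2%:Z)%Z)%Z].
apply: (@sub_finite_set _ _ (g @` (`I_X.+1 `*` (`I_X.+1 `*` `I_X.+1)))).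
  move=> I /= [idI]; have [a [b [d [a0 d0 ba _ H]]]] := ideal_hnf idI.
  rewrite (ideal_norm_hnf idI a0 d0 H) => adX.
  exists (a, (b, d)); first by rewrite /=; split => /=; [nia|split => /=; nia].
  apply/seteqP; split => [_ [p /H Ip <-] //|x Ix].
  by have [p pE] := ideal_sub_emb idI Ix; exists p => //; apply/H; rewrite -pE.
apply: finite_image; apply: finite_setX => //; exact: finite_setX.
Qed.

End Ideals.

(** * Ideals of norm [p] and of norm [p^2] *)

Section PrimeIdeals.
Variables (K : fieldExtType rat) (w : K) (t n : int).
Hypothesis w2 : w ^+ 2 = t%:~R * w - n%:~R.
Hypothesis D0 : 0 < 4 * n - t ^+ 2.
Hypothesis OKE : forall x, ring_of_integers x <-> exists u v : int, x = u%:~R + v%:~R * w.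
Hypothesis w_free : forall u v : int, u%:~R + v%:~R * w = 0 -> u = 0 /\ v = 0.
Local Notation N := (nrm t n).
Local Notation emb := (quad_emb w).
Local Notation qmul := (qmul t n).

Let embI := emb_inj w_free.

(** The ideal generated by [q] and [w - r], when [r] is a root modulo [q]. *)
Definition pideal (q : nat) (r : int) : set K := emb @` latt q r.

Lemma pideal_emb q r x : pideal q r (emb x) <-> latt q r x.
Proof. by split => [[y Ly /embI <-]|Lx] //; exists x. Qed.

Lemma natK_neq0 (q : nat) : (0 < q)%N -> (q%:R : K) != 0.
Proof.
move=> q0; rewrite pmulrn -(emb_int w); apply/eqP => /(emb_eq0 w_free) [e].
by rewrite e in q0.
Qed.

Lemma pideal_nat q r : pideal q r q%:R.
Proof.
by rewrite pmulrn -(emb_int w); apply/pideal_emb; rewrite /latt /= mulr0 addr0.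
Qed.

Lemma pideal_integral q r : (0 < q)%N -> is_root t n q r -> integral_ideal (pideal q r).
Proof.
move=> q0 hr; split.
- by move=> _ [x _ <-]; exact: emb_OK.
- by exists q%:R; [exact: pideal_nat|exact: natK_neq0].
- move=> _ _ [x Lx <-] [y Ly <-]; rewrite embD; apply/pideal_emb.
  by rewrite /latt /= in Lx Ly *; have := dvdzD Lx Ly; congr (_ %| _)%Z; ring.
- move=> z _ zO [x Lx <-]; have [c ->] := OK_emb OKE zO.
  rewrite (embM w2); apply/pideal_emb; rewrite /latt /qmul /= in Lx *.
  have -> : c.1 * x.1 - n * c.2 * x.2 + r * (c.1 * x.2 + c.2 * x.1 + t * c.2 * x.2) =
     (c.1 + r * c.2) * (x.1 + r * x.2) - (c.2 * x.2) * (r ^+ 2 - t * r + n) by ring.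
  by apply: dvdzB; exact: dvdz_mull.
Qed.

Lemma pideal_norm q r : (0 < q)%N -> is_root t n q r -> ideal_norm (pideal q r) = q.
Proof.
move=> q0 hr; have idP := pideal_integral q0 hr.
pose b := absz (- r %% q%:Z)%Z.
have bE : b%:Z = (- r %% q%:Z)%Z by rewrite /b gez0_abs // modz_ge0 //; lia.
suff H x : pideal q r (emb x) <-> (1%:Z %| x.2)%Z /\ (q%:Z %| x.1 - b%:Z * (x.2 %/ 1%:Z)%Z)%Z.
  by rewrite (ideal_norm_hnf w2 D0 OKE idP q0 (ltn0Sn 0) H) muln1.
rewrite pideal_emb divz1 dvd1z /latt /=.
have [k kE] : exists k, r = - (k * q%:Z + b%:Z).
  by exists (- r %/ q%:Z)%Z; rewrite bE -divz_eq opprK.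
have -> : x.1 + r * x.2 = (x.1 - b%:Z * x.2) - k * x.2 * q%:Z by rewrite kE; ring.
split=> [H|[_ H]]; last by apply: dvdzB => //; exact: dvdz_mull.
split => //; have := dvdzD H (dvdz_mull (k * x.2) (dvdzz q%:Z)).
by rewrite subrK.
Qed.

Lemma ideal_root (I : set K) (b : nat) (a : nat) : integral_ideal I ->
  (forall p, I (emb p) <-> (1%:Z %| p.2)%Z /\ (a%:Z %| p.1 - b%:Z * (p.2 %/ 1%:Z)%Z)%Z) ->
  is_root t n a (- b%:Z) /\ I = pideal a (- b%:Z).
Proof.
move=> idI H.
have lE x : I (emb x) <-> latt a (- b%:Z) x.
  rewrite H divz1 dvd1z /latt /= mulNr; split => [[]|] //.
have Ib : I (emb (b%:Z, 1)) by apply/lE; rewrite /latt /= mulr1 subrr dvdz0.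
split.
  have : I (emb ((N (b%:Z, 1)), 0)).
    rewrite (emb_int w) -(emb_conj w2) mulrC.
    by apply: (idealM idI) => //; exact: emb_OK.
  move/lE; rewrite /latt /is_root /nrm /=; congr (_ %| _)%Z; ring.
apply/seteqP; split => [x Ix|_ [p /lE Ip <-] //].
by have [p pE] := ideal_sub_emb OKE idI Ix; exists p => //; apply/lE; rewrite -pE.
Qed.

(** In the normal form [d] divides [a], so [d^2] divides [a d = p] and [d = 1]. *)
Lemma ideal_norm_prime (I : set K) (p : nat) : integral_ideal I -> prime p ->
  ideal_norm I = p -> exists r, is_root t n p r /\ I = pideal p r.
Proof.
move=> idI pp; have [a [b [d [a0 d0 ba /andP[da db] H]]]] := ideal_hnf w2 D0 OKE idI.
rewrite (ideal_norm_hnf w2 D0 OKE idI a0 d0 H) => adp.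
have d1 : d = 1%N.
  have : (d * d %| p)%N by rewrite -adp dvdn_mul.
  move=> dp; have : (d %| p)%N by apply: dvdn_trans dp; exact: dvdn_mulr.
  case/primeP: pp => p1 pd /pd /orP[/eqP //|/eqP dE].
  by move: dp => /dvdn_leq; rewrite dE => /(_ (ltnW p1)); nia.
move: H adp; rewrite d1 muln1 => H ap; rewrite -ap.
by exists (- b%:Z); exact: ideal_root H.
Qed.

Lemma principal_integral (x : K) : ring_of_integers x -> x != 0 ->
  integral_ideal (principal_ideal x).
Proof.
move=> xO x0; split.
- by move=> _ [c cO <-]; apply: integral_mul.
- by exists x => //; exists 1; rewrite ?mul1r //; exact: integral1.
- by move=> _ _ [c cO <-] [c' cO' <-]; exists (c + c'); [exact: integral_add|rewrite mulrDl].
- by move=> c _ cO [c' cO' <-]; exists (c * c'); [exact: integral_mul|rewrite mulrA].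
Qed.

Lemma principal_nat_emb (q : nat) x : (0 < q)%N ->
  principal_ideal (q%:R : K) (emb x) <-> (q%:Z %| x.1)%Z /\ (q%:Z %| x.2)%Z.
Proof.
move=> q0; split => [[_ /(OK_emb OKE)[c ->]]|[/dvdzP[c1 e1] /dvdzP[c2 e2]]].
  rewrite pmulrn -(emb_int w) (embM w2) => /embI <-.
  rewrite /qmul /= !mulr0 subr0 addr0 add0r.
  by split; exact: dvdz_mull.
exists (emb (c1, c2)); first exact: emb_OK.
rewrite pmulrn -(emb_int w) (embM w2); congr emb.
by case: x e1 e2 => x1 x2 /= -> ->; rewrite /qmul /=; congr pair; ring.
Qed.

Lemma principal_nat_norm (q : nat) : (0 < q)%N -> ideal_norm (principal_ideal (q%:R : K)) = (q * q)%N.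
Proof.
move=> q0; have idP : integral_ideal (principal_ideal (q%:R : K)).
  by apply: principal_integral; [exact: (int_OK OKE q%:Z)|exact: natK_neq0].
suff H x : principal_ideal (q%:R : K) (emb x) <-> (q%:Z %| x.2)%Z /\
    (q%:Z %| x.1 - 0%N%:Z * (x.2 %/ q%:Z)%Z)%Z by exact: (ideal_norm_hnf w2 D0 OKE idP q0 q0 H).
rewrite principal_nat_emb // mul0r subr0; tauto.
Qed.

(** The entry [d] divides [p^2]: the value [1] would produce a root modulo [p^2], the value [p^2]
    contradicts that [d] divides [a], and [p] leaves the ideal [(p)]. *)
Lemma ideal_norm_prime_sqr (I : set K) (p : nat) : integral_ideal I -> prime p ->
  (forall r, ~ is_root t n p r) ->
  ideal_norm I = (p * p)%N -> I = principal_ideal p%:R.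
Proof.
move=> idI pp nr; have [a [b [d [a0 d0 ba /andP[da db] H]]]] := ideal_hnf w2 D0 OKE idI.
rewrite (ideal_norm_hnf w2 D0 OKE idI a0 d0 H) => adp.
have p0 := prime_gt0 pp.
have : (d %| p ^ 2)%N by rewrite -mulnn -adp dvdn_mull.
case/(dvdn_pfactor _ _ pp) => j j2 dE.
case: j j2 dE => [|[|[|//]]] _ dE.
- move: H adp; rewrite dE expn0 muln1 => H ap.
  have [hr _] := ideal_root idI H; case: (nr (- b%:Z)).
  by rewrite /is_root in hr *; apply: dvdz_trans hr; rewrite ap dvdzE dvdn_mulr.
- rewrite expn1 in dE; have aE : a = p by move: adp; rewrite dE => /eqP; rewrite eqn_pmul2r // => /eqP.
  have pb : (p%:Z %| b%:Z)%Z by rewrite dvdzE -dE.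
  have E x : I (emb x) <-> principal_ideal (p%:R : K) (emb x).
    rewrite H principal_nat_emb // aE dE; split => [[h1 h2]|[h1 h2]]; split => //.
      by have := dvdzD h2 (dvdz_mulr (x.2 %/ p%:Z)%Z pb); rewrite subrK.
    by apply: dvdzB => //; exact: dvdz_mulr.
  apply/seteqP; split => x.
    by move=> Ix; have [c cE] := ideal_sub_emb OKE idI Ix; rewrite cE; apply/E; rewrite -cE.
  move=> Px; have [c cE] : exists c, x = emb c.
    case: Px => _ /(OK_emb OKE)[c ->] <-.
    by rewrite pmulrn -(emb_int w) (embM w2); eexists.
  by rewrite cE; apply/E; rewrite -cE.
- by move: da => /dvdn_leq; rewrite dE => /(_ a0); have := prime_gt1 pp; move: adp; rewrite dE expnS expn1; nia.
Qed.

Lemma coprime_ideals_nat (I m : set K) (p M : nat) : integral_ideal I -> integral_ideal m ->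
  I p%:R -> m M%:R -> coprime p M -> coprime_ideals I m.
Proof.
move=> idI idm Ip mM pM.
have /coprimezP[[u v] /= uv] : coprimez p%:Z M%:Z by rewrite coprimezE.
exists (u%:~R * p%:R), (v%:~R * M%:R); split.
- exact: (ideal_mulz OKE idI).
- exact: (ideal_mulz OKE idm).
- by rewrite !pmulrn -!intrM -rmorphD uv.
Qed.

Lemma pideal_neq (p : nat) (r : int) : ~~ (p%:Z %| 4 * n - t ^+ 2)%Z -> is_root t n p r ->
  pideal p r <> pideal p (t - r).
Proof.
move=> pD hr e.
have : pideal p r (emb (- r, 1)) by apply/pideal_emb; rewrite /latt /= mulr1 addNr dvdz0.
rewrite e => /pideal_emb; rewrite /latt /= mulr1 => h; case/negP: pD.
have -> : 4 * n - t ^+ 2 = 4 * (r ^+ 2 - t * r + n) - (- r + (t - r)) * (- r + (t - r)) by ring.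
by apply: dvdzB; [exact: dvdz_mull|exact: dvdz_mulr].
Qed.

Lemma ideal_mul_eq (I J L : set K) : integral_ideal L ->
  (forall x y, I x -> J y -> L (x * y)) ->
  (forall M : set K, integral_ideal M -> (forall x y, I x -> J y -> M (x * y)) -> L `<=` M) ->
  ideal_mul I J = L.
Proof.
move=> idL sub min; apply/seteqP; split => [z|z Lz M [idM IJM]].
  by apply; split => // _ [x Ix [y Jy <-]]; exact: sub.
by apply: (min M idM) => // x y Ix Jy; apply: IJM; exists x => //; exists y.
Qed.

Lemma ideal_mul_principal (x y : K) : ring_of_integers x -> ring_of_integers y ->
  x != 0 -> y != 0 ->
  ideal_mul (principal_ideal x) (principal_ideal y) = principal_ideal (x * y).
Proof.
move=> xO yO x0 y0; apply: ideal_mul_eq.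
- by apply: principal_integral; [exact: integral_mul|exact: mulf_neq0].
- move=> _ _ [c cO <-] [c' cO' <-]; exists (c * c'); first exact: integral_mul.
  by rewrite mulrACA.
- move=> M idM H _ [c cO <-]; apply: (idealM idM) => //.
  by apply: H; exists 1; rewrite ?mul1r //; exact: integral1.
Qed.

End PrimeIdeals.

(** * Values of the Hecke character *)

Section Forms.
Variables (t n : int).
Hypothesis D0 : 0 < 4 * n - t ^+ 2.
Local Notation N := (nrm t n).
Local Notation qmul := (qmul t n).

Lemma nrmM a b : N (qmul a b) = N a * N b.
Proof. by rewrite /nrm /qmul /=; ring. Qed.

Lemma nrm_conj a : N (qconj t a) = N a.
Proof. by rewrite /nrm /qconj /=; ring. Qed.

Lemma latt_conj (q : nat) r a : latt q r a -> latt q (t - r) (qconj t a).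
Proof. by rewrite /latt /qconj /=; congr (_ %| _)%Z; ring. Qed.

Lemma latt_mul_conj (q : nat) r a b : is_root t n q r -> latt q r a -> latt q (t - r) b ->
  (q%:Z %| (qmul a b).1)%Z /\ (q%:Z %| (qmul a b).2)%Z.
Proof.
rewrite /latt /is_root /qmul /= => hr La Lb; split.
  have -> : a.1 * b.1 - n * a.2 * b.2 = (a.1 + r * a.2) * b.1 - r * a.2 * (b.1 + (t - r) * b.2)
      - a.2 * b.2 * (r ^+ 2 - t * r + n) by ring.
  by apply: dvdzB; [apply: dvdzB; [exact: dvdz_mulr|exact: dvdz_mull]|exact: dvdz_mull].
have -> : a.1 * b.2 + a.2 * b.1 + t * a.2 * b.2 =
   (a.1 + r * a.2) * b.2 + a.2 * (b.1 + (t - r) * b.2) by ring.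
by apply: dvdzD; [exact: dvdz_mulr|exact: dvdz_mull].
Qed.

(** The norm on the ideal is [p] times a form of discriminant [-D], which takes a value at most [D]
    off the origin. *)
Lemma latt_short (p : nat) r : (0 < p)%N -> is_root t n p r ->
  exists a, [/\ latt p r a, 0 < N a & N a <= (4 * n - t ^+ 2) * p%:Z].
Proof.
move=> p0 /dvdzP[m mE].
have p0z : 0 < p%:Z by lia.
have [|x [y [xy H]]] := @form_represents_le_disc (4 * n - t ^+ 2) p%:Z (t - 2 * r) m D0 p0z.
  by rewrite -mulrA [p%:Z * m]mulrC -mE; ring.
have NE : N (p%:Z * x - r * y, y) = p%:Z * (p%:Z * x ^+ 2 + (t - 2 * r) * x * y + m * y ^+ 2).
  transitivity (p%:Z * (p%:Z * x ^+ 2 + (t - 2 * r) * x * y) + (r ^+ 2 - t * r + n) * y ^+ 2).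
    by rewrite /nrm /=; ring.
  by rewrite mE; ring.
exists (p%:Z * x - r * y, y); split.
- by rewrite /latt /= subrK dvdz_mulr.
- rewrite nrm_gt0 //; apply: contra xy => /eqP[+ y0]; rewrite y0 mulr0 subr0 => /eqP.
  by rewrite mulf_eq0 (gt_eqF p0z) /= => /eqP ->.
- by rewrite NE mulrC ler_pM2r.
Qed.

(* Translate (p s, 0), with p s = 1 mod M, by a multiple of M a for a short a in the lattice. *)
Lemma latt_short_congr (M : nat) : (1 < M)%N ->
  exists C : nat, forall (p : nat) r, (0 < p)%N -> coprime p M -> is_root t n p r ->
  exists b, [/\ latt p r b, (M%:Z %| b.1 - 1)%Z, (M%:Z %| b.2)%Z, 0 < N b & N b <= C%:Z * p%:Z].
Proof.
move=> M1; have n0 : 0 < n by nia.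
pose C1 : int := (1 + `|t| + n) * M%:Z ^+ 2 * (4 * n - t ^+ 2).
have C10 : 0 <= C1 by rewrite /C1 !mulr_ge0 //; lia.
exists (absz C1) => p r p0 pM hr.
have [a [La a0 aN]] := latt_short p0 hr.
have /coprimezP[[s s'] /= ss] : coprimez p%:Z M%:Z by rewrite coprimezE.
pose Q := M%:Z * N a; have Q0 : 0 < Q by rewrite mulr_gt0 //; lia.
pose z := (s * p%:Z * (a.1 + t * a.2), - (s * p%:Z * a.2)).
(* As [z / Q] is [s p / (M a)], [d] is its integer part by coordinates, and [b = s p - M a d].
   Multiplying [b] by the conjugate of [a] leaves the remainder [rho], whose coordinates are below
   [Q]. *)
pose d := ((z.1 %/ Q)%Z, (z.2 %/ Q)%Z); pose rho := ((z.1 %% Q)%Z, (z.2 %% Q)%Z).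
pose ad := qmul a d.
pose b := (s * p%:Z - M%:Z * ad.1, - (M%:Z * ad.2)).
have bE : qmul b (qconj t a) = rho.
  have e1 : rho.1 = z.1 - d.1 * Q by have := divz_eq z.1 Q; rewrite /rho /d /=; lia.
  have e2 : rho.2 = z.2 - d.2 * Q by have := divz_eq z.2 Q; rewrite /rho /d /=; lia.
  rewrite [RHS]surjective_pairing e1 e2 /qmul /b /ad /z /Q /nrm /qmul /qconj /=.
  by clearbody d; case: d {e1 e2 ad b rho} => d1 d2 /=; congr pair; ring.
have Lad : latt p r ad.
  have h : (p%:Z %| (a.1 + r * a.2) * (d.1 + r * d.2) - a.2 * d.2 * (r ^+ 2 - t * r + n))%Z.
    by apply: dvdzB; [exact: dvdz_mulr|exact: dvdz_mull].
  by move: h; rewrite /latt /ad /qmul /=; congr (_ %| _)%Z; ring.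
exists b; split.
- rewrite /latt /b /=.
  have -> : s * p%:Z - M%:Z * ad.1 + r * - (M%:Z * ad.2) = s * p%:Z - M%:Z * (ad.1 + r * ad.2) by ring.
  by apply: dvdzB; exact: dvdz_mull.
- rewrite /b /=; have -> : s * p%:Z - M%:Z * ad.1 - 1 = M%:Z * (- s' - ad.1) by rewrite -ss; ring.
  exact: dvdz_mulr.
- by rewrite /b /= -mulrN dvdz_mulr.
- rewrite nrm_gt0 //; apply/eqP => -[e1 _].
  have e2 : s * p%:Z = M%:Z * ad.1 by apply/eqP; rewrite -subr_eq0 e1.
  have : (M%:Z %| M%:Z * (ad.1 + s'))%Z by exact: dvdz_mulr.
  have -> : M%:Z * (ad.1 + s') = 1 by rewrite -[RHS]ss e2; ring.
  by rewrite dvdz1 /=; lia.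
- have rN : N rho <= (1 + `|t| + n) * Q ^+ 2.
    have r1 : 0 <= rho.1 < Q by rewrite modz_ge0 ?gt_eqF //= ltz_pmod.
    have r2 : 0 <= rho.2 < Q by rewrite modz_ge0 ?gt_eqF //= ltz_pmod.
    move: r1 r2; case: rho {bE} => x y /= /andP[x0 xQ] /andP[y0 yQ].
    have xx : x ^+ 2 <= Q ^+ 2 by rewrite ler_sqr ?nnegrE; lia.
    have yy : n * y ^+ 2 <= n * Q ^+ 2 by rewrite ler_wpM2l ?ler_sqr ?nnegrE; lia.
    have xy : t * (x * y) <= `|t| * Q ^+ 2.
      apply: (@le_trans _ _ (`|t| * (x * y))).
        by rewrite ler_wpM2r ?mulr_ge0 // ler_norm.
      by rewrite ler_wpM2l //; nia.
    rewrite /nrm /=; lia.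
  rewrite -bE nrmM nrm_conj in rN.
  have : N b * N a <= (1 + `|t| + n) * M%:Z ^+ 2 * N a * N a.
    by apply: (le_trans rN); rewrite le_eqVlt; apply/orP; left; apply/eqP; rewrite /Q; ring.
  rewrite ler_pM2r // => h; apply: (le_trans h); rewrite gez0_abs // /C1.
  have k0 : 0 <= (1 + `|t| + n) * M%:Z ^+ 2 by rewrite mulr_ge0 //; lia.
  by rewrite -[leRHS]mulrA; exact: (ler_wpM2l k0 aN).
Qed.

End Forms.

Section Embedding.
Local Open Scope complex_scope.
Variables (R : realType) (K : fieldExtType rat) (iota : {rmorphism K -> R[i]}).
Variables (w : K) (t n : int).
Hypothesis w2 : w ^+ 2 = t%:~R * w - n%:~R.
Hypothesis D0 : 0 < 4 * n - t ^+ 2.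
Local Notation C := R[i].
Local Notation emb := (quad_emb w).

(** A real value [x] of [iota w] would make the square of [2 x - t] equal to the negative number
    [t^2 - 4 n]; so the conjugate is the other root. *)
Lemma conj_iota_w : conjc (iota w) = t%:~R - iota w.
Proof.
have W2 : iota w ^+ 2 = t%:~R * iota w - n%:~R.
  by rewrite -rmorphXn w2 rmorphB rmorphM !rmorph_int.
have cW2 : conjc (iota w) ^+ 2 = t%:~R * conjc (iota w) - n%:~R.
  by rewrite -rmorphXn W2 rmorphB rmorphM !rmorph_int.
have nz : iota w - conjc (iota w) != 0.
  apply/eqP => e; have : complex.Im (iota w) = 0.
    by move: e; case: (iota w) => x y /= [_ h]; lra.
  move: W2; case: (iota w) => x y /= W2 y0; rewrite y0 in W2.
  have : (x%:C) ^+ 2 = t%:~R%:C * x%:C - n%:~R%:C :> C by rewrite !rmorph_int.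
  rewrite -rmorphXn -rmorphM -rmorphB => -[h].
  have : (0 : R) < (4 * n - t ^+ 2)%:~R by rewrite ltr0z.
  rewrite rmorphB rmorphM rmorphXn /=; have := sqr_ge0 (2 * x - t%:~R); nra.
apply/eqP; rewrite eq_sym subr_eq addrC -subr_eq0; apply/eqP.
apply: (mulfI nz); rewrite mulr0.
have -> : (iota w - conjc (iota w)) * (t%:~R - (iota w + conjc (iota w))) =
   (t%:~R * iota w - n%:~R - iota w ^+ 2) - (t%:~R * conjc (iota w) - n%:~R - conjc (iota w) ^+ 2).
  ring.
by rewrite W2 cW2 !subrr.
Qed.

Lemma conj_iota_emb p : conjc (iota (emb p)) = iota (emb (qconj t p)).
Proof.
rewrite /quad_emb /qconj /= !rmorphD !rmorphM !rmorph_int /= conj_iota_w.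
by rewrite rmorphN; ring.
Qed.

End Embedding.

Lemma finite_roots_exprz (F : closedFieldType) (k : int) (c : F) : k != 0 -> c != 0 ->
  finite_set [set z : F | z ^ k = c].
Proof.
move=> k0 c0.
have pos (j : nat) (e : F) : (0 < j)%N -> finite_set [set z : F | z ^+ j = e].
  move=> j0; have [r rE] := closed_field_poly_normal ('X^j - e%:P).
  apply: (@sub_finite_set _ _ [set` r]); last exact: finite_seq.
  move=> z /= ze; have : root ('X^j - e%:P) z by rewrite rootE !hornerE ze subrr.
  by rewrite rE rootZ ?root_prod_XsubC // lead_coef_eq0 -size_poly_gt0 size_XnsubC.
case: k k0 => j jn0.
  by apply: pos; lia.
apply: sub_finite_set (pos j.+1 c^-1 isT) => z /= <-.
by rewrite /exprz invrK.
Qed.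

(** * The infinity type, and split primes whose two character values cancel *)

Section HeckeChar.
Local Open Scope complex_scope.
Variables (R : realType) (K : fieldExtType rat) (iota : {rmorphism K -> R[i]}).
Variables (w : K) (t n : int).
Hypothesis w2 : w ^+ 2 = t%:~R * w - n%:~R.
Hypothesis D0 : 0 < 4 * n - t ^+ 2.
Hypothesis OKE : forall x, ring_of_integers x <-> exists u v : int, x = u%:~R + v%:~R * w.
Hypothesis w_free : forall u v : int, u%:~R + v%:~R * w = 0 -> u = 0 /\ v = 0.
Variables (m : set K) (psi : set K -> R[i]) (u v : int) (M : nat).
Hypothesis idm : integral_ideal m.
Hypothesis psi_neq0 : forall I, integral_ideal I -> coprime_ideals I m -> psi I != 0.
Hypothesis psiM : forall I J, integral_ideal I -> coprime_ideals I m ->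
  integral_ideal J -> coprime_ideals J m -> psi (ideal_mul I J) = psi I * psi J.
Hypothesis psi_principal : forall alpha, ring_of_integers alpha -> alpha != 0 -> m (alpha - 1) ->
  psi (principal_ideal alpha) = iota alpha ^ u * conjc (iota alpha) ^ v.
Hypothesis M1 : (1 < M)%N.
Hypothesis mM : m M%:R.
Local Notation C := R[i].
Local Notation N := (nrm t n).
Local Notation emb := (quad_emb w).
Local Notation qmul := (qmul t n).
Local Notation pideal := (pideal w).

Let embI := emb_inj w_free.

Lemma principal_nat_integral (q : nat) : (0 < q)%N -> integral_ideal (principal_ideal (q%:R : K)).
Proof.
move=> q0; apply: (principal_integral); first exact: (int_OK OKE q%:Z).
exact: (natK_neq0 w_free q0).
Qed.

Lemma principal_nat_coprime (q : nat) : (0 < q)%N -> coprime q M ->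
  coprime_ideals (principal_ideal (q%:R : K)) m.
Proof.
move=> q0 qM; apply: (coprime_ideals_nat OKE (principal_nat_integral q0) idm _ mM qM).
by exists 1; [exact: integral1|rewrite mul1r].
Qed.

Lemma psi_pow (p k : nat) : (0 < p)%N -> coprime p M -> (0 < k)%N ->
  psi (principal_ideal ((p ^ k)%N%:R : K)) = psi (principal_ideal (p%:R : K)) ^+ k.
Proof.
move=> p0 pM; case: k => // k _; elim: k => [|k IH]; first by rewrite expn1 expr1.
have pk0 : (0 < p ^ k.+1)%N by rewrite expn_gt0 p0.
rewrite exprS -IH -psiM; first last.
- by apply: principal_nat_coprime => //; rewrite coprimeXl.
- exact: principal_nat_integral.
- exact: principal_nat_coprime.
- exact: principal_nat_integral.
rewrite ideal_mul_principal //.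
- by rewrite expnS natrM.
- exact: (int_OK OKE p%:Z).
- exact: (int_OK OKE (p ^ k.+1)%N%:Z).
- exact: (natK_neq0 w_free p0).
- exact: (natK_neq0 w_free pk0).
Qed.

(** With [k = totient M] the integer [p^k] is 1 modulo [m], so [(- p)^k = (p^k)^(u + v)]; absolute
    values give the exponent. *)
Lemma infinity_type_sum (p : nat) : (1 < p)%N -> coprime p M ->
  psi (principal_ideal (p%:R : K)) = - p%:R -> u + v = 1.
Proof.
move=> p1 pM psip; have p0 : (0 < p)%N by lia.
pose k := totient M; have k0 : (0 < k)%N by rewrite totient_gt0; lia.
have pk0 : (0 < p ^ k)%N by rewrite expn_gt0 p0.
have E : m ((p ^ k)%N%:R - 1).
  have : (M %| p ^ k - 1)%N.
    by rewrite -eqn_mod_dvd //; apply/eqP; apply: cyclic.Euler_exp_totient.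
  move/dvdnP => [c cE]; have -> : (p ^ k)%N%:R - 1 = c%:~R * M%:R :> K.
    have -> : (p ^ k)%N%:R - 1 = (p ^ k - 1)%N%:R :> K by rewrite natrB.
    by rewrite cE natrM pmulrn.
  exact: (ideal_mulz OKE idm).
have H := psi_principal (int_OK OKE (p ^ k)%N%:Z) (natK_neq0 w_free pk0) E.
rewrite -pmulrn psi_pow // psip in H.
pose X : R := (p ^ k)%N%:R.
have X1 : 1 < X by rewrite ltr1n -(exp1n k) ltn_exp2r.
have X0 : 0 < X by lra.
have XC : iota (p ^ k)%N%:R = X%:C by rewrite rmorph_nat [in RHS]/X rmorph_nat.
rewrite XC conjc_real -(fmorphXz (real_complex R)) -(fmorphXz (real_complex R)) -rmorphM in H.
rewrite -expfzDr ?lt0r_neq0 // in H.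
have /(congr1 (fun z : C => `|z|)) := H.
rewrite normrX normrN normr_nat -natrX.
have -> : ((p ^ k)%N%:R : C) = X%:C by rewrite [in RHS]/X rmorph_nat.
rewrite ger0_norm; last by rewrite lecR exprz_ge0 // ltW.
move=> [e]; apply: (@ieexprIz R X X0 _ (u + v) 1); first by rewrite gt_eqF.
by rewrite -e expr1z.
Qed.

(** The cofactor [(b) P^(-1)], written as [(1 / p) b P'] because [P P' = (p)], where [P] and [P']
    belong to the roots [r] and [t - r]. *)
Definition jideal (p : nat) (r : int) (b : int * int) : set K :=
  emb @` [set x | exists y, latt p (t - r) y /\ (p%:Z * x.1, p%:Z * x.2) = qmul b y].

Section J.
Variables (p : nat) (r : int) (b : int * int).
Hypothesis pp : prime p.
Hypothesis pD : ~~ (p%:Z %| 4 * n - t ^+ 2)%Z.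
Hypothesis hr : is_root t n p r.
Hypothesis Lb : latt p r b.
Hypothesis bM1 : (M%:Z %| b.1 - 1)%Z.
Hypothesis bM2 : (M%:Z %| b.2)%Z.
Hypothesis b0 : 0 < N b.

Let p0 := prime_gt0 pp.
Let pz : p%:Z != 0. Proof. by have := p0; lia. Qed.

Let mem_j y : latt p (t - r) y -> exists x, jideal p r b (emb x) /\ p%:R * emb x = emb b * emb y.
Proof.
move=> Ly; have [/dvdzP[x1 e1] /dvdzP[x2 e2]] := latt_mul_conj hr Lb Ly.
have e : (p%:Z * x1, p%:Z * x2) = qmul b y.
  by rewrite [RHS]surjective_pairing e1 e2 ![_ * p%:Z]mulrC.
exists (x1, x2); split; first by exists (x1, x2) => //; exists y.
rewrite (embM w2) -e pmulrn -(emb_int w) (embM w2); congr emb.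
by rewrite /qmul /=; congr pair; ring.
Qed.

Let jP z : jideal p r b z -> exists y, latt p (t - r) y /\ p%:R * z = emb b * emb y.
Proof.
move=> [x [y [Ly e]] <-]; exists y; split => //.
rewrite (embM w2) -e pmulrn -(emb_int w) (embM w2); congr emb.
by rewrite /qmul /=; congr pair; ring.
Qed.

Let Lp : latt p (t - r) (p%:Z, 0).
Proof. by rewrite /latt /= mulr0 addr0. Qed.

Let pK := natK_neq0 w_free p0.

Lemma jideal_b : jideal p r b (emb b).
Proof.
have [x [Jx e]] := mem_j Lp; move: e; rewrite (emb_int w (p%:Z)) -pmulrn mulrC => /(mulIf pK) <- //.
Qed.

(** The conjugate of [b] lies in [P'], so [J] contains [b] times it divided by [p], the integer
    [N b / p]. A bound on [N b / p] therefore bounds an integer in [J]. *)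
Lemma jideal_norm : exists c : nat, N b = p%:Z * c%:Z /\ jideal p r b c%:R.
Proof.
have [x [Jx e]] := mem_j (latt_conj t Lb).
rewrite (emb_conj w2) in e.
have /dvdzP[c cE] : (p%:Z %| N b)%Z by exact: dvdz_nrm_latt hr Lb.
have c0 : 0 <= c by have := prime_gt0 pp; nia.
exists (absz c); rewrite gez0_abs //; split; first by rewrite mulrC.
have <- : emb x = (absz c)%:R.
  apply: (mulfI pK); rewrite e cE rmorphM /= mulrC -pmulrn; congr (_ * _).
  by rewrite -[in LHS](gez0_abs c0) pmulrn.
exact: Jx.
Qed.

Let embb0 : emb b != 0.
Proof.
by apply/eqP => /(emb_eq0 w_free) e; have := b0; rewrite e /nrm /=; lia.
Qed.

Lemma jideal_integral : integral_ideal (jideal p r b).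
Proof.
split.
- by move=> _ [x _ <-]; exact: emb_OK.
- by exists (emb b); [exact: jideal_b|].
- move=> x1 x2 J1 J2; have [y1 [L1 e1]] := jP J1; have [y2 [L2 e2]] := jP J2.
  have Ly : latt p (t - r) (y1.1 + y2.1, y1.2 + y2.2).
    by rewrite /latt /= in L1 L2 *; have := dvdzD L1 L2; congr (_ %| _)%Z; ring.
  have [x [Jx e]] := mem_j Ly; suff -> : x1 + x2 = emb x by [].
  apply: (mulfI pK); rewrite e -(embD w y1 y2) [LHS]mulrDr e1 e2.
  exact: esym (mulrDr _ _ _).
- move=> z x1 zO J1; have [y1 [L1 e1]] := jP J1; have [c cE] := OK_emb OKE zO.
  have P1 : pideal p (t - r) (emb c * emb y1).
    apply: (idealM (pideal_integral w2 OKE w_free p0 (is_rootN hr))); first exact: emb_OK.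
    exact/(pideal_emb w_free).
  rewrite (embM w2) in P1; have Ly := (pideal_emb w_free _ _ _).1 P1.
  have [x [Jx e]] := mem_j Ly; suff -> : z * x1 = emb x by [].
  by apply: (mulfI pK); rewrite e -(embM w2) cE mulrCA e1 mulrCA.
Qed.

Lemma emb_b_congr : m (emb b - 1).
Proof.
have /dvdzP[c1 e1] := bM1; have /dvdzP[c2 e2] := bM2.
have -> : emb b - 1 = emb (c1, c2) * M%:R.
  rewrite /quad_emb /= mulrDl mulrAC pmulrn -!intrM -e1 -e2 rmorphB /=; ring.
by apply: (idealM idm) => //; exact: emb_OK.
Qed.

Lemma jideal_coprime : coprime_ideals (jideal p r b) m.
Proof.
exists (emb b), (- (emb b - 1)); split; first exact: jideal_b.
  have -> : - (emb b - 1) = (-1)%:~R * (emb b - 1) by rewrite rmorphN mulN1r.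
  by apply: (ideal_mulz OKE idm); exact: emb_b_congr.
ring.
Qed.

Lemma ideal_mul_jideal : ideal_mul (pideal p r) (jideal p r b) = principal_ideal (emb b).
Proof.
have L2 : latt p (t - r) (r - t, 1) by rewrite /latt /= mulr1 addrC subrKA subrr.
apply: ideal_mul_eq.
- by apply: principal_integral => //; exact: emb_OK.
- move=> _ y [x Lx <-] /jP[z [Lz e]].
  have [/dvdzP[x1 e1] /dvdzP[x2 e2]] := latt_mul_conj hr Lx Lz.
  exists (emb (x1, x2)); first exact: emb_OK.
  have e3 : emb x * emb z = p%:R * emb (x1, x2).
    rewrite (embM w2) [qmul x z]surjective_pairing e1 e2 pmulrn -(emb_int w) (embM w2).
    by congr emb; rewrite /qmul /=; congr pair; ring.
  by apply: (mulfI pK); rewrite [RHS]mulrCA e [RHS]mulrCA e3 [RHS]mulrCA [emb b * _]mulrC.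
- move=> I idI H.
  have [g [Jg ge]] := mem_j L2.
  have I1 : I (p%:R * emb b) by apply: H; [exact: pideal_nat|exact: jideal_b].
  have I2 : I (p%:R * emb g) by apply: H; [exact: pideal_nat|].
  have I3 : I (emb (- r, 1) * emb b).
    apply: H; last exact: jideal_b.
    by apply/(pideal_emb w_free); rewrite /latt /= mulr1 addNr dvdz0.
  (* [I] contains [b (w + r - t)] and [b (w - r)], hence their difference [(2 r - t) b]. It also
     contains [p b], and [2 r - t] is prime to [p]. *)
  have I4 : I ((2 * r - t)%:~R * emb b).
    have := idealB OKE idI I2 I3; rewrite ge [emb b * _]mulrC -mulrBl embB /=.
    congr (I (_ * _)); rewrite -(emb_int w); congr emb; congr pair; ring.
  have pr : ~~ (p%:Z %| 2 * r - t)%Z.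
    apply: contra pD => h.
    have -> : 4 * n - t ^+ 2 = 4 * (r ^+ 2 - t * r + n) - (2 * r - t) * (2 * r - t) by ring.
    by apply: dvdzB; [exact: dvdz_mull|exact: dvdz_mulr].
  have /coprimezP[[c d] /= cd] : coprimez p%:Z (2 * r - t) by rewrite prime_coprimez.
  have Ib : I (emb b).
    have := idealD idI (ideal_mulz OKE idI c I1) (ideal_mulz OKE idI d I4).
    rewrite !mulrA -mulrDl pmulrn -!intrM -rmorphD /= cd.
    by rewrite mul1r.
  by move=> _ [x xO <-]; exact: (idealM idI).
Qed.

Lemma psi_pideal : coprime p M ->
  psi (pideal p r) * psi (jideal p r b) = iota (emb b) ^ u * conjc (iota (emb b)) ^ v.
Proof.
move=> pM; rewrite -psiM.
- rewrite ideal_mul_jideal psi_principal //; first exact: emb_OK.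
  exact: emb_b_congr.
- exact: (pideal_integral w2 OKE w_free).
- apply: (coprime_ideals_nat OKE (pideal_integral w2 OKE w_free p0 hr) idm _ mM pM).
  exact: pideal_nat.
- exact: jideal_integral.
- exact: jideal_coprime.
Qed.

End J.

(** In the normal form [a] divides [c] and [d] divides [a], so the norm is at most [C0^2]. *)
Lemma finite_ideals_containing (C0 : nat) :
  finite_set [set I : set K | integral_ideal I /\ exists c : nat, (0 < c <= C0)%N /\ I c%:R].
Proof.
apply: sub_finite_set (finite_ideal_norm w2 D0 OKE (C0 * C0)) => I /= [idI [c [/andP[c0 cC] Ic]]].
split => //; have [a [b [d [a0 d0 ba /andP[da db] H]]]] := ideal_hnf w2 D0 OKE idI.
rewrite (ideal_norm_hnf w2 D0 OKE idI a0 d0 H).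
have := (H (c%:Z, 0)).1; rewrite (emb_int w) -pmulrn => /(_ Ic)[_] /=.
rewrite div0z mulr0 subr0 dvdzE /= => /dvdn_leq => /(_ c0) ac.
by have := dvdn_leq a0 da; nia.
Qed.

Let slope (p : nat) (C0 : nat) : set C := [set z | [/\ prime p, (C0 < p)%N &
  exists b c, [/\ N b = p%:Z * c%:Z, (0 < c <= C0)%N &
     z = iota (emb b) / conjc (iota (emb b))]]].

(** Equal quotients make [b] times the conjugate of [b'] an integer [s] with [s^2 = p c p' c']. Then
    [p] divides [s], hence [c p' c']; as [c] and [c'] are below [p], this leaves [p = p']. *)
Let slope_inj C0 p p' z : slope p C0 z -> slope p' C0 z -> p = p'.
Proof.
move=> [pp Cp [b [c [bN /andP[c0 cC] ->]]]] [pp' Cp' [b' [c' [bN' /andP[c0' cC'] e]]]].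
have p0 := prime_gt0 pp; have p0' := prime_gt0 pp'.
have nz x (k l : nat) : (0 < k)%N -> (0 < l)%N -> N x = k%:Z * l%:Z -> iota (emb x) != 0.
  move=> k0 l0 xN; rewrite fmorph_eq0; apply/eqP => /(emb_eq0 w_free) x0.
  by move: xN; rewrite x0 /nrm /=; nia.
have B0 := nz _ _ _ p0 c0 bN; have B0' := nz _ _ _ p0' c0' bN'.
have cB0 : conjc (iota (emb b)) != 0 by rewrite fmorph_eq0.
have cB0' : conjc (iota (emb b')) != 0 by rewrite fmorph_eq0.
have E : iota (emb b) * conjc (iota (emb b')) = conjc (iota (emb b)) * iota (emb b').
  move: e => /(congr1 (fun x => x * (conjc (iota (emb b)) * conjc (iota (emb b'))))).
  by rewrite mulrA divfK // => ->; rewrite mulrCA divfK.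
have {}E : qmul b (qconj t b') = qmul (qconj t b) b'.
  apply: embI; rewrite -!(embM w2); apply: (fmorph_inj iota).
  by rewrite !rmorphM -!(conj_iota_emb iota w2 D0).
pose s := (qmul b (qconj t b')).1.
have s2 : (qmul b (qconj t b')).2 = 0.
  by have := congr1 snd E; rewrite /qmul /qconj /=; lia.
have Ns : s ^+ 2 = p%:Z * c%:Z * (p'%:Z * c'%:Z).
  rewrite -bN -bN' -(nrm_conj t n b') -nrmM [qmul _ _]surjective_pairing s2 -/s.
  by rewrite /nrm /=; ring.
have ps : (p%:Z %| s)%Z.
  have : (p%:Z %| s * s)%Z by rewrite -expr2 Ns -!mulrA dvdz_mulr.
  by rewrite prime_dvdzM // orbb.
have : (p%:Z * p%:Z %| p%:Z * (c%:Z * (p'%:Z * c'%:Z)))%Z.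
  by rewrite mulrA -Ns expr2; exact: dvdz_mul.
rewrite dvdz_mul2l; last by lia.
rewrite !prime_dvdzM // !dvdzE /= => /or3P[/dvdn_leq|h|/dvdn_leq].
- by move=> /(_ c0); lia.
- by apply/eqP; rewrite -dvdn_prime2.
- by move=> /(_ c0'); lia.
Qed.

Lemma psi_split_neq0 : u != v -> exists K0 : nat, forall (p : nat) r, prime p -> (K0 < p)%N ->
  is_root t n p r -> psi (pideal p r) + psi (pideal p (t - r)) != 0.
Proof.
move=> uv; have [C0 HC] := latt_short_congr D0 M1.
pose JJ := [set I : set K | (integral_ideal I /\ exists c : nat, (0 < c <= C0)%N /\ I c%:R)
   /\ coprime_ideals I m].
have fJ : finite_set JJ by apply: sub_finite_set (finite_ideals_containing C0) => I [].
(* If [psi P' = - psi P], dividing [psi P psi J = B^u conj(B)^v] by [psi P' psi J' = conj(B)^u B^v]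
   gives [(B / conj(B))^(u - v) = - psi J / psi J']. *)
pose Z : set C := \bigcup_(J in JJ `*` JJ) [set z | z ^ (u - v) = - psi J.1 / psi J.2].
have fZ : finite_set Z.
  apply: bigcup_finite; first exact: finite_setX.
  move=> [J J'] [[[/= J1 _] J2] [[J1' _] J2']]; apply: finite_roots_exprz.
    by rewrite subr_eq0.
  by rewrite mulf_neq0 ?invr_eq0 ?oppr_eq0 ?psi_neq0.
(* By [slope_inj] a quotient comes from at most one prime; the default [0] stands for none. *)
pose g (z : C) : nat := xget 0%N [set p | slope p C0 z].
have [K1 HK1] : exists K1, forall p, (g @` Z) p -> (p <= K1)%N.
  have fg := finite_image g fZ.
  exists (\max_(i <- fset_set (g @` Z)) i) => p gp.
  by apply: (leq_bigmax_seq (F := id)) => //; rewrite in_fset_set // inE.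
exists (maxn K1 (maxn C0 (maxn M (absz (4 * n - t ^+ 2)%R)))) => p r pp Kp hr.
apply/eqP => sum0.
have Cp : (C0 < p)%N by lia.
have p0 := prime_gt0 pp.
have pM : coprime p M by rewrite prime_coprime // gtnNdvd //; lia.
have pD : ~~ (p%:Z %| 4 * n - t ^+ 2)%Z by rewrite dvdzE /= gtnNdvd //; lia.
suff [z Zz sz] : exists2 z, Z z & slope p C0 z.
  have sg : slope (g z) C0 z by apply: (@xgetPex _ 0%N [set p | slope p C0 z]); exists p.
  have gz : g z = p by apply: slope_inj sg sz.
  have : (p <= K1)%N by apply: HK1; exists z.
  lia.
have [b [Lb b1 b2 b0 bC]] := HC p r p0 pM hr.
pose b' := qconj t b.
have Lb' : latt p (t - r) b' by exact: latt_conj.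
have b1' : (M%:Z %| b'.1 - 1)%Z.
  by have := dvdzD b1 (dvdz_mull t b2); rewrite /b' /qconj /=; congr (_ %| _)%Z; ring.
have b2' : (M%:Z %| b'.2)%Z by rewrite /b' /qconj /= rpredN.
have b0' : 0 < N b' by rewrite nrm_conj.
have hr' := is_rootN hr.
have cbound (c : nat) : 0 < p%:Z * c%:Z -> p%:Z * c%:Z <= C0%:Z * p%:Z -> (0 < c <= C0)%N.
  have pz : 0 < p%:Z by rewrite ltz_nat.
  by rewrite pmulr_rgt0 // [p%:Z * _]mulrC ler_pM2r // ltz_nat lez_nat => -> ->.
have inJ r1 b3 : is_root t n p r1 -> latt p r1 b3 -> (M%:Z %| b3.1 - 1)%Z -> (M%:Z %| b3.2)%Z ->
    0 < N b3 -> N b3 <= C0%:Z * p%:Z -> JJ (jideal p r1 b3).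
  move=> h1 L3 m1 m2 n3 nC; split; last exact: jideal_coprime.
  split; first exact: jideal_integral.
  have [c [cE Jc]] := jideal_norm pp pD h1 L3 m1 m2 n3.
  by exists c; split => //; apply: cbound; rewrite -cE.
have J1 := inJ r b hr Lb b1 b2 b0 bC.
have J2 : JJ (jideal p (t - r) b') by apply: inJ => //; rewrite nrm_conj.
have [[[iJ1 _] cJ1] [[iJ2 _] cJ2]] := (J1, J2).
have E1 := psi_pideal pp pD hr Lb b1 b2 b0 pM.
have E2 := psi_pideal pp pD hr' Lb' b1' b2' b0' pM.
rewrite -(conj_iota_emb iota w2 D0) conjcK in E2.
set B := iota (emb b) in E1 E2.
have B0 : B != 0.
  rewrite fmorph_eq0; apply/eqP => /(emb_eq0 w_free) e.
  by move: b0; rewrite e /nrm /=; lia.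
have cB0 : conjc B != 0 by rewrite fmorph_eq0.
exists (B / conjc B); last first.
  have [c [cE _]] := jideal_norm pp pD hr Lb b1 b2 b0.
  split; [exact: pp|exact: Cp|].
  by exists b, c; split => //; apply: cbound; rewrite -cE.
exists (jideal p r b, jideal p (t - r) b') => //=.
have Q1 := psi_neq0 iJ1 cJ1; have Q2 := psi_neq0 iJ2 cJ2.
have A2E : psi (pideal p (t - r)) = - psi (pideal p r) by apply/eqP; rewrite -addr_eq0 addrC sum0.
rewrite A2E in E2.
have A0 : psi (pideal p r) != 0.
  apply: psi_neq0; first exact: (pideal_integral w2 OKE w_free).
  apply: (coprime_ideals_nat OKE (pideal_integral w2 OKE w_free p0 hr) idm _ mM pM).
  exact: pideal_nat.
have U : (B / conjc B) ^ (u - v) = (B ^ u * conjc B ^ v) / (conjc B ^ u * B ^ v).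
  rewrite exprzMl ?unitfE ?invr_eq0 // exprz_inv !expfzDr // opprB expfzDr // -!invr_expz.
  by field; rewrite !expfz_neq0.
rewrite U -E1 -E2.
by field; rewrite A0 Q2.
Qed.

End HeckeChar.

Theorem proposition3p3 (R : realType) (N : nat) (f : R[i] -> R[i])
    (a : nat -> int) (hN : (0 < N)%N)
    (f_eigen : hecke_eigenform 2 N f)
    (f_coef : q_expansion f (fun n => (a n)%:~R))
    (f_normalized : a 1%N = 1)
    (f_CM : complex_multiplication f) :
  exists mu B : R, 0 < mu /\
    \forall z \near +oo,
      `|\prod_(5 <= p < (Num.truncn z).+1 |
                 [&& prime p, p%:R < z & a p != 0]) (1 - p%:R^-1)
        - mu / (ln z `^ (1 / 2))|
      <= B / (ln z `^ (3 / 2)).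
Proof.
have [K [m [psi [iq [[idm psi0 psiM [iota [u [v psiP]]]] _] theta]]]] := f_CM.
have [w [t [n [w2 D0 OKE w_free]]]] := integral_basis iota iq.
have [k [k0 mk]] := ideal_pos_int w2 D0 OKE idm.
pose M := (2 * k)%N; have M1 : (1 < M)%N by rewrite /M; lia.
have mM : m M%:R by rewrite /M natrM; exact: (ideal_mulz OKE idm 2 mk).
have coef j : (0 < j)%N -> (a j)%:~R =
    \sum_(I \in [set I | (integral_ideal I /\ coprime_ideals I m) /\ ideal_norm I = j]) psi I.
  apply: (theta_coef f_coef theta); first exact: (finite_ideal_norm w2 D0 OKE).
  by move=> I; exact: (ideal_norm_gt0 w2 D0 OKE).
have inert_coef p : prime p -> (forall r, ~ is_root t n p r) -> a p = 0.
  move=> pp nr; apply: (intr_inj (R := R[i])); rewrite coef ?prime_gt0 //.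
  rewrite (_ : [set I | _] = set0) ?fsbig_set0 //.
  apply/seteqP; split => // I [[idI _] nI].
  by have [r [hr _]] := ideal_norm_prime w2 D0 OKE idI pp nI; exact: nr hr.
(* The odd sum [u + v = 1] forbids [u = v]. The inert prime is taken beyond [N] for the Hecke
   relation and beyond [M] for coprimality to the conductor. *)
have uv : u != v.
  have [p [pp Kp nr]] := inert_infinite R (maxn M N) D0.
  have p0 := prime_gt0 pp.
  have pM : coprime p M by rewrite prime_coprime // gtnNdvd //; lia.
  have pN : coprime p N by rewrite prime_coprime // gtnNdvd //; lia.
  have app : a (p * p)%N = - p%:Z.
    rewrite (hecke_prime_sqr f_coef f_eigen f_normalized pp pN) inert_coef //.
    by rewrite expr0n sub0r.
  suff : u + v = 1 by move=> h; apply/eqP => e; rewrite e in h; lia.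
  apply: (infinity_type_sum D0 OKE w_free idm psiM psiP M1 mM (prime_gt1 pp) pM).
  have -> : - p%:R = (a (p * p)%N)%:~R :> R[i] by rewrite app rmorphN.
  (* The only ideal of norm [p^2] is [(p)], so the coefficient is a single value of [psi]. *)
  rewrite coef ?muln_gt0 ?p0 // (_ : [set I | _] = [set principal_ideal (p%:R : K)]) ?fsbig_set1 //.
  apply/seteqP; split => [I [[idI _] nI]|_ ->] /=.
    exact: (ideal_norm_prime_sqr w2 D0 OKE w_free idI pp nr nI).
  split; last exact: (principal_nat_norm w2 D0 OKE w_free p0).
  split; first exact: (principal_nat_integral OKE w_free p0).
  exact: (principal_nat_coprime OKE w_free idm mM p0 pM).
have [K0 split_neq0] := psi_split_neq0 w2 D0 OKE w_free idm psi0 psiM psiP M1 mM uv.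
pose K1 := (maxn K0 (maxn M (absz (4 * n - t ^+ 2)%R))).+1.
have a_split p : prime p -> (K1 <= p)%N -> splitp t n p = (a p != 0).
  move=> pp Kp; have p0 := prime_gt0 pp.
  have pM : coprime p M by rewrite prime_coprime // gtnNdvd //; lia.
  have pD : ~~ (p%:Z %| 4 * n - t ^+ 2)%Z by rewrite dvdzE /= gtnNdvd //; lia.
  have [/asboolP[r hr]|/asboolP nr] := boolP (splitp t n p); last first.
    by rewrite inert_coef ?eqxx // => r hr; apply: nr; exists r.
  apply/esym; rewrite -(intr_eq0 (R[i])) coef //.
  have hr' := is_rootN hr.
  have P r1 : is_root t n p r1 -> (integral_ideal (pideal w p r1) /\
      coprime_ideals (pideal w p r1) m) /\ ideal_norm (pideal w p r1) = p.
    move=> h1; have idP := pideal_integral w2 OKE w_free p0 h1.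
    split; last exact: (pideal_norm w2 D0 OKE w_free p0 h1).
    split => //; apply: (coprime_ideals_nat OKE idP idm _ mM pM).
    exact: pideal_nat.
  have -> : [set I | (integral_ideal I /\ coprime_ideals I m) /\ ideal_norm I = p] =
     [set pideal w p r] `|` [set pideal w p (t - r)].
    apply/seteqP; split => [I [[idI _] nI]|_ [->|->]] /=; [|exact: P|exact: P].
    have [r1 [h1 ->]] := ideal_norm_prime w2 D0 OKE idI pp nI.
    rewrite -(expn1 p) in h1 hr; have := root_cases pp pD (ltn0Sn 0) hr h1.
    by rewrite expn1 /pideal => /orP[] /latt_eq ->; [left|right].
  rewrite fsbigU0 ?fsbig_set1 //.
    by apply: split_neq0 => //; lia.
  by move=> I [/= -> ] /(pideal_neq w_free pD hr).
have [B HB] := mertens_split R D0.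
apply: (@mertens_product R (fun p => a p != 0)
  (B + \sum_(1 <= p < K1.+1) ln (p%:R : R) / p%:R)) => x x0.
have F0 p : 0 <= ln (p%:R : R) / p%:R by rewrite divr_ge0 // ln_nat_ge0.
have := sum_eventually_eq x F0 a_split; have := HB x x0.
set s := \sum_(_ <= _ < _ | _) _; set s' := \sum_(_ <= _ < _ | _) (a _ != 0)%:R * _.
move: (\sum_(_ <= _ < _) _) => d; rewrite !ler_norml => /andP[? ?] /andP[? ?].
by apply/andP; split; lra.
Qed.
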